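(* There exists a constant $c > 0$ such that $$\mathbf{P}[P_{r,d,D} \text{ is connected}] > c$$ for all constants $r,d,D \in \mathbf{N} \cup \{0\}$ satisfying $D \geq 3$ and $\mathcal{P}(r,d,D) \neq \emptyset$.
   Context: For integers $r,d,D \ge 0$, $\mathcal{P}(r,d,D)$ denotes the set of all labelled (simple) planar graphs on the vertex set $\{1,2,\ldots,r\}$ whose every vertex has degree between $d$ and $D$ inclusive (i.e. minimum degree at least $d$ and maximum degree at most $D$). $P_{r,d,D}$ denotes a graph chosen uniformly at random from $\mathcal{P}(r,d,D)$. *)

(* Defs.v *)
From HB Require Import structures.
From mathcomp Require Import all_boot all_order all_algebra.
From mathcomp Require Import all_classical all_reals all_analysis.
Import numFieldNormedType.Exports.

Set Implicit Arguments.
Unset Strict Implicit.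
Unset Printing Implicit Defensive.

Import Order.TTheory GRing.Theory Num.Theory.
Local Open Scope ring_scope.

(* A graph on V is identified with its edge set. *)
Notation edge_set V := {set {set V}}.

Definition simple_graph (V : finType) (G : edge_set V) : bool :=
  [forall e in G, #|e| == 2%N].

Definition adjacent_in (V : finType) (G : edge_set V) : rel V :=
  fun u v => [set u; v]%SET \in G.

Definition graph_degree (V : finType) (G : edge_set V) (v : V) : nat :=
  #|[set e in G | v \in e]%SET|.

(* The graph without vertices is connected. *)
Definition connected_graph (V : finType) (G : edge_set V) : bool :=
  [forall u, forall v, connect (adjacent_in G) u v].

Definition simple_arc (R : realType) (g : R -> R * R) : Prop :=
  ({within `[0, 1], continuous g})%classic /\
  {in `[0, 1] &, injective g}.

(* Vertex v is drawn at the point p v and edge e as the arc g e restricted to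
   [0, 1].  The equation between images says that g e joins the two ends of e,
   in either direction. *)
Definition plane_drawing (R : realType) (V : finType) (G : edge_set V)
    (p : V -> R * R) (g : {set V} -> R -> R * R) : Prop :=
  [/\ injective p,
      forall e, e \in G ->
        simple_arc (g e) /\
        (g e @` [set 0; 1] = p @` [set` e])%classic,
      forall e, e \in G -> forall (t : R) (v : V), 0 < t < 1 -> g e t <> p v
    & forall e f, e \in G -> f \in G -> e != f ->
        forall s t : R, 0 < s < 1 -> 0 < t < 1 -> g e s <> g f t].

Definition is_planar (R : realType) (V : finType) (G : edge_set V) : Prop :=
  exists (p : V -> R * R) (g : {set V} -> R -> R * R), plane_drawing G p g.

(* The vertices 1, ..., r are represented by 'I_r = {0, ..., r - 1}. *)
Definition planar_graphs (R : realType) (r d D : nat) : {set edge_set 'I_r} :=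
  [set G : edge_set 'I_r | [&& simple_graph G, `[< is_planar R G >]
                             & [forall v, d <= graph_degree G v <= D]%N]]%SET.

Definition unif_pr (R : realType) (T : finType) (A : {set T})
    (E : pred T) : R :=
  #|[set x in A | E x]%SET|%:R / #|A|%:R.

(* Main.v *)
(* Let A_k be the set of graphs of the class with k components.  Local surgeries
   that lower the number of components by one are counted from both sides, which
   gives k |A_(k+1)| <= 67 |A_k| for all parameters; hence the ratio of the size of
   the whole class to |A_1| is bounded by an absolute constant.

   If at least a tenth of the vertices have degree less than D, the surgeries are:
   join two such vertices u, x of different components; or, when all vertices of the
   component of x have degree D, replace a non-bridge xy by ux.  The new edge is a
   bridge, there are fewer than |V| bridges, and in the second case y is the only
   vertex of degree less than D on the side of x.

   Otherwise the sum m of the degrees is at least 2.7 |V|, so a positive proportion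
   of the pairs (u, v) are non-bridges with deg v > 2.  If the other component has a
   vertex x of degree at most 1, move x onto the edge uv.  If its degrees are at least
   2, replace uv and xy by ux and vy, where the edge xy is chosen such that in every
   2-edge cut {xy, f} the end of f on the side of y has degree at most 2.  Such an
   edge exists by uncrossing minimal cuts of size at most 2, and it makes the
   resulting 2-edge cut {ux, vy} recoverable from (u, x) alone: at most m preimages.

   These surgeries preserve planarity: open a small disc at an interior point of an
   edge, or next to a vertex straightened beforehand; an inversion maps its outside to
   a half-plane with the loose ends at prescribed points of the boundary line, and
   two such drawings are glued along that line after a reflection. *)

Require Import Defs.
From mathcomp Require Import all_boot all_order all_algebra.
From mathcomp Require Import zify.

Set Implicit Arguments.
Unset Strict Implicit.
Unset Printing Implicit Defensive.

(** * Components and bridges *)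

Section Graphs.
Variable V : finType.
Implicit Types (G H : edge_set V) (u v w x y a b : V) (S T : {set V}).

Local Notation adj := adjacent_in.

(** Iterating the ratio gives [|A_(k+1)| <= 67^k / k! |A_1|], which is summable because of the
    factor [k]; this factor is the number of foreign components to which a fixed place of surgery
    can be attached. The obstacle is a graph in which nearly every vertex has degree [D]. Edges can
    then hardly be added, so the surgery has to keep all degrees, and it leaves a 2-edge cut instead
    of a bridge. One edge may lie in many 2-edge cuts, strung along it like beads of a necklace, so
    [(u, x)] alone would not locate the second edge [vy]. The condition [deg v > 2] is the mark that
    singles it out: the choice of [xy] prevents competing cuts from carrying the same mark. In this
    case graphs are sorted by their degree sum [m]. The number of places for a surgery and the
    number of preimages are then both linear in the same [m], which cancels and leaves a constant
    free of [D]. Planarity enters the counting only as a predicate closed under subgraphs, bridges,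
    switches and insertions; topology is confined to the proofs of these closure properties. *)

Lemma set2C u v : [set u; v] = [set v; u].
Proof. exact: setUC. Qed.

Lemma set2_eq a b u v : ([set a; b] == [set u; v]) =
  (a == u) && (b == v) || (a == v) && (b == u).
Proof.
apply/eqP/orP => [E|[]/andP[/eqP -> /eqP ->] //]; last exact: set2C.
have ha : a \in [set u; v] by rewrite -E !inE eqxx.
have hb : b \in [set u; v] by rewrite -E !inE eqxx orbT.
have hu : u \in [set a; b] by rewrite E !inE eqxx.
have hv : v \in [set a; b] by rewrite E !inE eqxx orbT.
move: ha hb hu hv; rewrite !inE ![u == _]eq_sym ![v == _]eq_sym.
by case: (a == u); case: (a == v); case: (b == u); case: (b == v) => //=; auto.
Qed.

Lemma adj_sym G : symmetric (adj G).
Proof. by move=> u v; rewrite /adjacent_in set2C. Qed.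

Lemma connect_adj_sym G : connect_sym (adj G).
Proof. exact/sym_connect_sym/adj_sym. Qed.

Lemma adj_irr G u : simple_graph G -> adj G u u = false.
Proof.
move=> /forall_inP Gs; apply/negP => /Gs; by rewrite setUid cards1.
Qed.

Definition component G v : {set V} := [set w | connect (adj G) v w].
Definition components G : {set {set V}} := [set component G v | v : V].

Lemma mem_component G v : v \in component G v.
Proof. by rewrite inE connect0. Qed.

Lemma componentP G u v : reflect (component G u = component G v) (connect (adj G) u v).
Proof.
apply: (iffP idP) => [uv|E]; last first.
  by have := mem_component G v; rewrite -E inE.
apply/setP => w; rewrite !inE; apply/idP/idP; last exact: connect_trans.
by apply: connect_trans; rewrite connect_adj_sym.
Qed.

Lemma connect_cross H T a b : connect (adj H) a b -> a \in T -> b \notin T ->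
  exists c d, [/\ c \in T, d \notin T & adj H c d].
Proof.
move=> /connectP[p]; elim: p a => [|c p IH] a /=; first by move=> _ -> ->.
move=> /andP[ac pc] bE aT bT; have [cT|cT] := boolP (c \in T); last by exists a, c.
exact: IH pc bE cT bT.
Qed.

Lemma connect_closed H T a b : (forall c d, c \in T -> d \notin T -> ~~ adj H c d) ->
  a \in T -> connect (adj H) a b -> b \in T.
Proof.
move=> cl aT ab; apply/negPn/negP => bT.
by have [c [d [cT dT]]] := connect_cross ab aT bT; apply/negP/cl.
Qed.

Lemma component_stable G x a b : a \in component G x -> adj G a b -> b \in component G x.
Proof. by rewrite !inE => xa ab; apply: connect_trans xa (connect1 ab). Qed.

Lemma connect_mono G H a b : G \subset H -> connect (adj G) a b -> connect (adj H) a b.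
Proof.
move=> sub; apply: connect_sub => c d cd; apply: connect1.
exact: (subsetP sub).
Qed.

Lemma connect_del H u v : connect (adj (H :\ [set u; v])) u v ->
  connect (adj (H :\ [set u; v])) =2 connect (adj H).
Proof.
move=> uv a b; apply/idP/idP; first by apply: connect_mono; rewrite subsetDl.
apply: connect_sub => c d cd.
have [/eqP E|ne] := boolP ([set c; d] == [set u; v]); last first.
  by apply: connect1; rewrite /adjacent_in in_setD1 ne.
move/eqP: E; rewrite set2_eq => /orP[]/andP[/eqP -> /eqP ->] //.
by rewrite connect_adj_sym.
Qed.

(** A path from [a] never reaches [x], hence never uses the deleted edge. *)
Lemma connect_del_far H a b x y : connect (adj H) a b -> ~~ connect (adj H) a x ->
  connect (adj (H :\ [set x; y])) a b.
Proof.
move=> ab nax; have : b \in component (H :\ [set x; y]) a; last by rewrite inE.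
apply/negPn/negP => bT; have [c [d [cT dT cd]]] := connect_cross ab (mem_component _ a) bT.
have ac : connect (adj H) a c.
  by move: cT; rewrite inE; apply: connect_mono; rewrite subsetDl.
have [/eqP E|ne] := boolP ([set c; d] == [set x; y]); last first.
  by case/negP: dT; apply: component_stable cT _; rewrite /adjacent_in in_setD1 ne.
move/eqP: E; rewrite set2_eq => /orP[]/andP[/eqP Ec /eqP Ed].
  by rewrite -Ec ac in nax.
by case/negP: nax; rewrite -Ed; exact: connect_trans ac (connect1 cd).
Qed.

Lemma connect_add G u v a b : connect (adj ([set u; v] |: G)) a b =
  [|| connect (adj G) a b, connect (adj G) a u && connect (adj G) v b
    | connect (adj G) a v && connect (adj G) u b].
Proof.
apply/idP/idP => [ab|]; last first.
  have m c d : connect (adj G) c d -> connect (adj ([set u; v] |: G)) c d.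
    by apply: connect_mono; rewrite subsetUr.
  have uv : connect (adj ([set u; v] |: G)) u v.
    by apply: connect1; rewrite /adjacent_in setU11.
  case/or3P=> [/m //|/andP[/m au /m vb]|/andP[/m av /m ub]].
    exact: connect_trans au (connect_trans uv vb).
  by apply: connect_trans av (connect_trans _ ub); rewrite connect_adj_sym.
set T := [set w | [|| connect (adj G) a w, connect (adj G) a u && connect (adj G) v w
    | connect (adj G) a v && connect (adj G) u w]].
suff : b \in T by rewrite inE.
apply: connect_closed ab; last by rewrite inE connect0.
move=> c d cT dT; apply/negP; rewrite /adjacent_in in_setU1 => /orP[|cd].
  rewrite set2_eq => /orP[]/andP[/eqP Ec /eqP Ed]; move: cT dT; rewrite !inE Ec Ed.
    rewrite !negb_or !negb_and !connect0 !orbF => cT /and3P[nav nau _].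
    by move: cT; rewrite (negPf nau) (negPf nav).
  rewrite !negb_or !negb_and !connect0 !orbF => cT /and3P[nau _ nav].
  by move: cT; rewrite (negPf nau) (negPf nav).
move: dT; rewrite inE; case/negP; move: cT; rewrite inE.
case/or3P=> [ac|/andP[-> vc]|/andP[-> uc]].
- by rewrite (connect_trans ac (connect1 cd)).
- by rewrite (connect_trans vc (connect1 cd)) orbT.
- by rewrite (connect_trans uc (connect1 cd)) !orbT.
Qed.

Lemma components_add_connected G u v : connect (adj G) u v ->
  components ([set u; v] |: G) = components G.
Proof.
move=> uv; apply: eq_imset => a; apply/setP => b; rewrite !inE connect_add.
have [//|nab] := boolP (connect (adj G) a b).
rewrite /=; apply/negP => /orP[]/andP[ac db]; case/negP: nab.
  exact: connect_trans ac (connect_trans uv db).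
by apply: connect_trans ac (connect_trans _ db); rewrite connect_adj_sym.
Qed.

Lemma components_del H u v : connect (adj (H :\ [set u; v])) u v ->
  components (H :\ [set u; v]) = components H.
Proof.
move=> uv; apply: eq_imset => a; apply/setP => b; by rewrite !inE connect_del.
Qed.

Lemma component_add G u v a : ~~ connect (adj G) u v -> component ([set u; v] |: G) a =
  if (a \in component G u) || (a \in component G v) then component G u :|: component G v else component G a.
Proof.
move=> nuv; apply/setP => b; rewrite inE connect_add.
rewrite !inE (connect_adj_sym _ a u) (connect_adj_sym _ a v).
have [ua|nua] := boolP (connect (adj G) u a) => /=.
  rewrite inE !inE; have -> : connect (adj G) v a = false.
    by apply: contraNF nuv => va; apply: connect_trans ua _; rewrite connect_adj_sym.
  by rewrite orbF (same_connect (@connect_adj_sym G) ua).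
have [va|nva] := boolP (connect (adj G) v a) => /=; last by rewrite orbF inE.
by rewrite !inE orbC (same_connect (@connect_adj_sym G) va).
Qed.

Lemma card_components_add G u v : ~~ connect (adj G) u v ->
  #|components ([set u; v] |: G)|.+1 = #|components G|.
Proof.
move=> nuv.
have uU : component G u \in components G by apply: imset_f.
have vU : component G v \in components G by apply: imset_f.
have uv : component G u != component G v by apply: contraNneq nuv => /componentP.
have -> : components ([set u; v] |: G) =
    (component G u :|: component G v) |: (components G :\ component G u :\ component G v).
  apply/setP => C; apply/imsetP/idP => [[a _ ->]|].
    rewrite component_add //; case: ifP => [_|/norP[au av]]; first exact: setU11.
    rewrite !inE imset_f // andbT; apply/orP; right; apply/andP; split.
      by apply: contra av => /eqP <-; exact: mem_component.
    by apply: contra au => /eqP <-; exact: mem_component.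
  rewrite !inE => /orP[/eqP ->|/and3P[Cv Cu /imsetP[a _ Ea]]].
    by exists u => //; rewrite component_add // mem_component.
  exists a => //; rewrite component_add // Ea; case: ifP => // /orP[]; rewrite inE => /componentP E.
    by rewrite Ea E eqxx in Cu.
  by rewrite Ea E eqxx in Cv.
have nin : component G u :|: component G v \notin components G :\ component G u :\ component G v.
  rewrite !inE !negb_and !negbK orbA; apply/orP; right.
  apply/imsetP => -[a _ E].
  have : u \in component G a by rewrite -E !inE connect0.
  have : v \in component G a by rewrite -E !inE connect0 orbT.
  rewrite !inE => av au; case/negP: nuv; apply: connect_trans av.
  by rewrite connect_adj_sym.
rewrite cardsU1 nin (cardsD1 (component G u) (components G)) uU.
by rewrite (cardsD1 (component G v) (components G :\ component G u)) !inE eq_sym uv vU.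
Qed.

Lemma card_components_le G : #|components G| <= #|V|.
Proof. exact: leq_trans (leq_imset_card _ _) _. Qed.

Lemma connected_components G : (0 < #|V|)%N -> connected_graph G = (#|components G| == 1%N).
Proof.
move=> /card_gt0P[v0 _]; apply/idP/cards1P => [/forallP con|[C EC]].
  exists (component G v0); apply/setP => D; rewrite inE; apply/imsetP/eqP => [[a _ ->]|->].
    by apply/componentP; move/forallP: (con a); apply.
  by exists v0.
apply/forallP => a; apply/forallP => b; apply/componentP.
have : component G a \in components G by apply: imset_f.
have : component G b \in components G by apply: imset_f.
by rewrite EC !inE => /eqP -> /eqP ->.
Qed.

Definition bridge G u v := ([set u; v] \in G) && ~~ connect (adj (G :\ [set u; v])) u v.
Definition nonbridge G u v := ([set u; v] \in G) && connect (adj (G :\ [set u; v])) u v.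

(** A bridge stays a bridge when other edges are deleted, so removing [B] edge by edge gains a
    component each time. *)
Lemma card_bridges G (B : edge_set V) :
  (forall e, e \in B -> exists u v, e = [set u; v] /\ bridge G u v) ->
  (#|components G| + #|B| <= #|components (G :\: B)|)%N.
Proof.
have [n] := ubnP #|B|; elim: n B => // n IH B Bn Bb.
have [->|[e eB]] := set_0Vmem B; first by rewrite cards0 addn0 setD0.
have [u [v [Ee /andP[eG nuv]]]] := Bb e eB.
have Bn' : (#|B :\ e| < n)%N by move: Bn; rewrite (cardsD1 e B) eB.
have Bb' f : f \in B :\ e -> exists u v, f = [set u; v] /\ bridge G u v.
  by rewrite in_setD1 => /andP[_ /Bb].
have := IH (B :\ e) Bn' Bb'; rewrite (cardsD1 e B) eB.
have -> : G :\: (B :\ e) = [set u; v] |: (G :\: B).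
  apply/setP => f; rewrite !inE -Ee; have [->|fe] := eqVneq f e => /=.
    by rewrite Ee eG.
  by [].
have := @card_components_add (G :\: B) u v; move=> <-; first by lia.
apply: contra nuv; apply: connect_mono; apply/subsetP => f; rewrite !inE => /andP[fB ->].
by rewrite andbT -Ee; apply: contra fB => /eqP ->.
Qed.

(** Both orientations are counted because the ordered pair of ends is the code from which links and
    grafts are recovered. *)
Lemma card_bridge_darts G : (#|[set p : V * V | bridge G p.1 p.2]| <= 2 * #|V|)%N.
Proof.
pose B := [set [set p.1; p.2] | p in [set p : V * V | bridge G p.1 p.2]].
have Bn : (#|B| <= #|V|)%N.
  have H e : e \in B -> exists u v, e = [set u; v] /\ bridge G u v.
    by case/imsetP=> -[u v]; rewrite inE => br ->; exists u, v.
  exact: leq_trans (leq_trans (leq_addl _ _) (card_bridges H)) (card_components_le _).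
apply: (@leq_trans (2 * #|B|)); last by rewrite leq_mul2l Bn orbT.
rewrite -sum1_card (partition_big (fun p : V * V => [set p.1; p.2]) (mem B)) /=; last first.
  by move=> p pB; apply: imset_f.
rewrite mulnC -sum_nat_const; apply: leq_sum => e /imsetP[[a b] _ ->] /=.
rewrite sum1_card; apply: leq_trans (_ : #|[set (a, b); (b, a)]| <= 2)%N.
  apply: subset_leq_card; apply/subsetP => -[c d]; rewrite inE => /andP[_].
  rewrite set2_eq /= => /orP[]/andP[/eqP -> /eqP ->].
    by rewrite !inE eqxx.
  by rewrite !inE eqxx orbT.
by rewrite cards2; case: (_ == _).
Qed.

End Graphs.

(** * Cuts *)

Ltac venn2 A B := let v := fresh "v" in
  apply/setP => v; rewrite !inE; by case: (v \in A); case: (v \in B).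
Ltac disj2 A B := rewrite -setI_eq0; apply/eqP; venn2 A B.
Ltac venn3 A B C sub := let v := fresh "v" in
  apply/setP => v; have := sub v; rewrite !inE;
  by case: (v \in A); case: (v \in B); case: (v \in C).
Ltac disj3 A B C sub := rewrite -setI_eq0; apply/eqP; venn3 A B C sub.

Section Cuts.
Variables (V : finType) (G : edge_set V).
Hypothesis Gs : simple_graph G.
Implicit Types (u v w x y a b : V) (S T A B C Q : {set V}).

Local Notation adj := (adjacent_in G).

Lemma graph_degree_nbrs v : graph_degree G v = #|[set u | adj v u]|.
Proof.
have inj : {in [set u | adj v u] &, injective (fun u => [set v; u])}.
  move=> a b _ _ /eqP; rewrite set2_eq eqxx /= => /orP[/eqP //|/andP[/eqP -> /eqP ->]//].
rewrite -(card_in_imset inj); apply: eq_card => e; rewrite !inE.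
apply/andP/imsetP => [[eG ve]|[u]]; last by rewrite inE => ? ->; rewrite set21.
have /cards2P[a [b [_ E]]] : #|e| == 2%N by move/forall_inP: Gs; apply.
move: ve eG; rewrite E !inE => /orP[]/eqP <- eG; first by exists b; rewrite ?inE.
by exists a; rewrite ?inE /adjacent_in setUC.
Qed.

(** Ordered pairs are counted: an edge inside [A] contributes 2 to [darts A A], while an edge
    leaving [A] contributes 1 to [cut A]. *)
Definition darts A B := \sum_(a in A) \sum_(b in B) (adj a b : nat).
Definition cut A := darts A (~: A).

Lemma darts_sym A B : darts A B = darts B A.
Proof.
rewrite /darts exchange_big /=; apply: eq_bigr => b _; apply: eq_bigr => a _.
by rewrite adj_sym.
Qed.

Lemma darts_Ur A B C : [disjoint B & C] -> darts A (B :|: C) = darts A B + darts A C.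
Proof.
move=> dBC; rewrite /darts -big_split /=; apply: eq_bigr => a _.
by rewrite -bigU //; apply: eq_bigl => b; rewrite inE.
Qed.

Lemma darts_Ul A B C : [disjoint B & C] -> darts (B :|: C) A = darts B A + darts C A.
Proof. by move=> dBC; rewrite darts_sym darts_Ur // !(darts_sym A). Qed.

Lemma darts_gt0 A B : reflect (exists a b, [/\ a \in A, b \in B & adj a b]) (0 < darts A B).
Proof.
rewrite lt0n /darts sum_nat_eq0 negb_forall.
apply: (iffP existsP) => [[a]|[a [b [aA bB ab]]]].
  rewrite negb_imply sum_nat_eq0 negb_forall => /andP[aA /existsP[b]].
  by rewrite negb_imply => /andP[bB]; case ab: (adj a b) => // _; exists a, b.
exists a; rewrite negb_imply aA sum_nat_eq0 negb_forall; apply/existsP; exists b.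
by rewrite bB ab.
Qed.

Lemma sum_degree A : \sum_(a in A) graph_degree G a = darts A A + cut A.
Proof.
rewrite /cut -darts_Ur; last by rewrite -setI_eq0 setICr.
rewrite setUCr; apply: eq_bigr => a _.
rewrite graph_degree_nbrs -sum1_card big_mkcond /= [RHS]big_mkcond /=.
by apply: eq_bigr => b _; rewrite !inE; case: (adj a b).
Qed.

Lemma odd_darts_self A : ~~ odd (darts A A).
Proof.
have [n] := ubnP #|A|; elim: n A => // n IH A An.
have [->|[a aA]] := set_0Vmem A; first by rewrite /darts big_set0.
have d : [disjoint [set a] & A :\ a] by rewrite disjoints1 !inE eqxx.
rewrite -(setD1K aA) darts_Ul // !darts_Ur // (darts_sym (A :\ a) [set a]).
have -> : darts [set a] [set a] = 0.
  by rewrite /darts !big_set1 adj_irr.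
have : ~~ odd (darts (A :\ a) (A :\ a)) by apply: IH; move: An; rewrite (cardsD1 a A) aA.
lia.
Qed.

(** The degrees in [A] sum to [2 * #|A|], and the edges inside [A] use up an even part of this. This
    parity is what replaces the missing lower bound for cuts around sets without a vertex of degree
    above 2. *)
Lemma odd_cut_degree2 A : (forall a, a \in A -> graph_degree G a = 2) -> ~~ odd (cut A).
Proof.
move=> A2; have := sum_degree A; rewrite (eq_bigr (fun _ => 2)) // sum_nat_const.
have := odd_darts_self A; lia.
Qed.

Lemma darts_Ur3 A B C D : [disjoint B & C :|: D] -> [disjoint C & D] ->
  darts A (B :|: (C :|: D)) = darts A B + (darts A C + darts A D).
Proof. by move=> d1 d2; rewrite !darts_Ur. Qed.

(** Expanded over the four cells of the Venn diagram, the two sides differ by twice the number of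
    edges between [A :&: B] and the complement of [A :|: B]. *)
Lemma cut_posimodular A B : cut (A :\: B) + cut (B :\: A) <= cut A + cut B.
Proof.
pose P := A :\: B; pose Q := B :\: A; pose M := A :&: B; pose O := ~: (A :|: B).
have PE : cut P = darts P Q + (darts P M + darts P O).
  rewrite /cut -darts_Ur3; [|disj2 A B|disj2 A B]; congr darts; venn2 A B.
have QE : cut Q = darts Q P + (darts Q M + darts Q O).
  rewrite /cut -darts_Ur3; [|disj2 A B|disj2 A B]; congr darts; venn2 A B.
have AE : cut A = (darts P Q + darts P O) + (darts M Q + darts M O).
  rewrite -!darts_Ur -?darts_Ul; [|disj2 A B..].
  rewrite /cut; congr darts; venn2 A B.
have BE : cut B = (darts Q P + darts Q O) + (darts M P + darts M O).
  rewrite -!darts_Ur -?darts_Ul; [|disj2 A B..].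
  rewrite /cut; congr darts; venn2 A B.
rewrite -/P -/Q PE QE AE BE (darts_sym Q P) (darts_sym M Q) (darts_sym M P); lia.
Qed.

(* If [{xy, ab}] is a 2-edge cut with [b] on the side of [y], then [b] has degree at
   most 2; in particular [xy] is no bridge. *)
Definition good x y := adj x y && [forall T : {set V},
  [&& T \subset component G x, x \in T & y \notin T] ==>
  (1 < cut T) && ((cut T == 2) ==> [forall a in T, forall b in ~: T,
     adj a b ==> ((a, b) != (x, y)) ==> (graph_degree G b <= 2)])].

Lemma cut_gt0 x T a b : T \subset component G x -> a \in T -> b \in component G x -> b \notin T ->
  0 < cut T.
Proof.
move=> /subsetP TC aT bC bT.
have ab : connect adj a b.
  move: bC (TC a aT); rewrite !inE => xb; rewrite connect_adj_sym => ax.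
  exact: connect_trans ax xb.
have [c [d [cT dT cd]]] := connect_cross ab aT bT.
by apply/darts_gt0; exists c, d; rewrite in_setC.
Qed.

(** Edge counts between four blocks 1, 2, X, Y, with [Q] made of 1 and 2, and [T] made of 2 and Y.
    If [e12 = 1], then [2 < k2] places both edges allowed by [kQ <= 2] on block 2, so [k1 = 1],
    which is neither above 2 nor even. Hence [e12 >= 2], and [kT = 2] leaves nothing for the other
    terms. *)
Fact cut_sizes (e12 e1X e1Y e2X e2Y eXY k1 k2 kT kQ : nat) :
  k1 = e12 + (e1X + e1Y) -> k2 = e12 + (e2X + e2Y) ->
  kT = e12 + e2X + (e1Y + eXY) -> kQ = e1X + e1Y + (e2X + e2Y) -> kQ <= 2 ->
  0 < e12 -> 2 < k2 -> 2 < k1 \/ ~~ odd k1 ->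
  1 < kT /\ (kT = 2 -> [/\ e12 = 2, e1Y = 0, e2X = 0 & eXY = 0]).
Proof. by move=> -> -> -> -> ? ? ? [|] ?; (split; first by lia) => ?; split; lia. Qed.

(** Blocks 1 and 2 each need a third edge; with [kQ <= 2] each gets exactly one, block 1 towards X
    and block 2 towards Y. *)
Fact tight_cut_sizes (e12 e1X e1Y e2X e2Y eXY k1 k2 kX kY kQ : nat) :
  k1 = e12 + (e1X + e1Y) -> k2 = e12 + (e2X + e2Y) ->
  kX = e1X + (e2X + eXY) -> kY = e1Y + (e2Y + eXY) ->
  kQ = e1X + e1Y + (e2X + e2Y) -> kQ <= 2 -> 2 < k1 -> 2 < k2 ->
  e12 = 2 -> e1Y = 0 -> e2X = 0 -> eXY = 0 -> [/\ kX = 1, kY = 1 & kQ = 2].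
Proof. by move=> -> -> -> -> -> ? ? ? ? ? ? ?; split; lia. Qed.

(** Call a set fat if it has a vertex of degree above 2; cuts around other sets are even. The edge
    [xy] is taken inside a minimal fat set [Q] of cut at most 2, itself inside a minimal fat set
    [Q0] of cut at most 1. A cut [T] through [xy] splits [Q], and minimality of [Q] makes both parts
    have large or even cuts. If [cut T = 2] and [b] had degree above 2, both parts of [Q] would be
    fat, and the remainders [X] and [Y] of [S] would each hang on a single edge. Minimality of [Q0]
    then keeps them out of [Q0], so [Q0 = Q], although these have cuts at most 1 and equal to 2. *)
Lemma fat_good S :
  (forall A, A \subset S -> darts A (~: S) = 0) ->
  (forall A a b, A \subset S -> a \in A -> b \in S -> b \notin A -> 0 < cut A) ->
  (forall v, v \in S -> 2 <= graph_degree G v) ->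
  (exists2 v, v \in S & 2 < graph_degree G v) ->
  exists x y, [/\ x \in S, y \in S, adj x y & forall T, T \subset S -> x \in T -> y \notin T ->
    1 < cut T /\ (cut T = 2 -> forall a b, a \in T -> b \notin T -> adj a b ->
      (a, b) != (x, y) -> graph_degree G b <= 2)].
Proof.
move=> closed conn deg2 [f fS df].
pose fat (A : {set V}) := [exists a in A, 2 < graph_degree G a].
have nonfat A : A \subset S -> ~~ fat A -> ~~ odd (cut A).
  move=> /subsetP AS nf; apply: odd_cut_degree2 => a aA; apply/eqP.
  rewrite eqn_leq deg2 ?AS // andbT leqNgt; apply: contra nf => da.
  by apply/existsP; exists a; rewrite aA.
have fatS : fat S by apply/existsP; exists f; rewrite fS.
pose P0 (A : {set V}) := [&& A \subset S, fat A & cut A <= 1].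
have PS : P0 S by rewrite /P0 subxx fatS /cut closed.
(* The minimum exists because [S] itself is fat and has cut 0. *)
case: (arg_minnP (fun A : {set V} => #|A|) PS) => Q0 /and3P[Q0S fatQ0 cQ0] minQ0.
pose P1 (A : {set V}) := [&& A \subset Q0, fat A & cut A <= 2].
have PQ0 : P1 Q0 by rewrite /P1 subxx fatQ0 (leq_trans cQ0).
case: (arg_minnP (fun A : {set V} => #|A|) PQ0) => Q /and3P[QQ0 fatQ cQ] minQ.
have {}minQ0 A : A \proper Q0 -> fat A -> 1 < cut A.
  move=> AQ fA; rewrite ltnNge; apply/negP => cA.
  have : P0 A by rewrite /P0 (subset_trans (proper_sub AQ) Q0S) fA.
  by move=> /minQ0; rewrite leqNgt proper_card.
have {}minQ A : A \proper Q -> fat A -> 2 < cut A.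
  move=> AQ fA; rewrite ltnNge; apply/negP => cA.
  have : P1 A by rewrite /P1 (subset_trans (proper_sub AQ) QQ0) fA.
  by move=> /minQ; rewrite leqNgt proper_card.
have /existsP[x /andP[xQ dx]] := fatQ.
have QS := subset_trans QQ0 Q0S.
have xS := subsetP QS x xQ.
(* At most two of the three or more edges at [x] leave [Q]. *)
have [y [yQ xy]] : exists y, y \in Q /\ adj x y.
  have xQ1 : [set x] \subset Q by rewrite sub1set.
  have e1 : graph_degree G x = darts [set x] Q + darts [set x] (~: Q).
    have := sum_degree [set x]; rewrite big_set1 => ->.
    rewrite /cut -!darts_Ur ?setUCr //; by rewrite -setI_eq0 setICr.
  have e2 : darts [set x] (~: Q) <= cut Q.
    rewrite /cut -{2}(setD1K xQ) darts_Ul ?leq_addr //.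
    by rewrite disjoints1 !inE eqxx.
  have /darts_gt0[a [b [aA bQ ab]]] : 0 < darts [set x] Q.
    by move: dx e2 cQ; rewrite e1; clear; lia.
  by exists b; move: aA ab; rewrite inE => /eqP ->.
exists x, y; split=> //; first exact: (subsetP QS).
move=> T TS xT yT.
(* The four cells of [S] cut out by [Q] and [T]: [y] lies in [p1], [x] in [p2]. *)
pose p1 := Q :\: T; pose p2 := Q :&: T; pose X := S :\: T :\: Q; pose Y := T :\: Q.
have memb v : ((v \in Q) ==> (v \in S)) && ((v \in T) ==> (v \in S)).
  by apply/andP; split; apply/implyP; apply: subsetP.
have p1S : p1 \subset S by apply: subset_trans QS; exact: subsetDl.
have p2S : p2 \subset S by apply: subset_trans QS; exact: subsetIl.
have XS : X \subset S by apply: subset_trans (subsetDl _ _) (subsetDl _ _).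
have YS : Y \subset S by apply: subset_trans TS; exact: subsetDl.
have blocks A B C D : A \subset S -> ~: A = B :|: (C :|: (D :|: ~: S)) ->
    [disjoint B & C :|: (D :|: ~: S)] -> [disjoint C & D :|: ~: S] -> [disjoint D & ~: S] ->
    cut A = darts A B + (darts A C + darts A D).
  by move=> AS E d1 d2 d3; rewrite /cut E !darts_Ur // closed // addn0.
have c1 : cut p1 = darts p1 p2 + (darts p1 X + darts p1 Y).
  apply: (blocks _ _ _ _ p1S); [venn3 Q T S memb|disj3 Q T S memb..].
have c2 : cut p2 = darts p2 p1 + (darts p2 X + darts p2 Y).
  apply: (blocks _ _ _ _ p2S); [venn3 Q T S memb|disj3 Q T S memb..].
have cX : cut X = darts X p1 + (darts X p2 + darts X Y).
  apply: (blocks _ _ _ _ XS); [venn3 Q T S memb|disj3 Q T S memb..].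
have cY : cut Y = darts Y p1 + (darts Y p2 + darts Y X).
  apply: (blocks _ _ _ _ YS); [venn3 Q T S memb|disj3 Q T S memb..].
have two A A1 A2 B C : A \subset S -> A1 \subset S -> A2 \subset S -> A = A1 :|: A2 ->
    [disjoint A1 & A2] -> ~: A = B :|: (C :|: ~: S) ->
    [disjoint B & C :|: ~: S] -> [disjoint C & ~: S] ->
    cut A = darts A1 B + darts A1 C + (darts A2 B + darts A2 C).
  move=> AS A1S A2S E d E' d1 d2; rewrite /cut E' {1}E darts_Ul // !darts_Ur //.
  by rewrite !closed // !addn0.
have cT : cut T = darts p2 p1 + darts p2 X + (darts Y p1 + darts Y X).
  apply: (two _ _ _ _ _ TS p2S YS); [venn3 Q T S memb|disj3 Q T S memb|venn3 Q T S memb|disj3 Q T S memb..].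
have cQ' : cut Q = darts p1 X + darts p1 Y + (darts p2 X + darts p2 Y).
  apply: (two _ _ _ _ _ QS p1S p2S); [venn3 Q T S memb|disj3 Q T S memb|venn3 Q T S memb|disj3 Q T S memb..].
rewrite (darts_sym p2 p1) in c2 cT; rewrite (darts_sym X p1) (darts_sym X p2) in cX.
rewrite (darts_sym Y p1) (darts_sym Y p2) (darts_sym Y X) in cY.
rewrite (darts_sym Y p1) (darts_sym Y X) in cT.
have e12 : 0 < darts p1 p2.
  by apply/darts_gt0; exists y, x; rewrite !inE yT yQ xQ xT adj_sym.
have p2fat : fat p2 by apply/existsP; exists x; rewrite inE xQ xT.
have p2Q : p2 \proper Q.
  rewrite properEneq subsetIl andbT; apply: contraNneq yT => E.
  by have := yQ; rewrite -E inE => /andP[].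
have p1Q : p1 \proper Q.
  rewrite properEneq subsetDl andbT; apply: contraTneq xT => E.
  by have := xQ; rewrite -E inE => /andP[].
have c2_3 := minQ _ p2Q p2fat.
have c1_alt : 2 < cut p1 \/ ~~ odd (cut p1).
  by have [/(minQ _ p1Q)|/(nonfat _ p1S)] := boolP (fat p1); [left|right].
have [gt1 eq2] := cut_sizes c1 c2 cT cQ' cQ e12 c2_3 c1_alt.
split=> // /eq2[e12' e1Y e2X eXY] a b aT bT ab abxy.
have bS : b \in S.
  apply/negPn/negP => bS; have /eqP := closed T TS; rewrite -leqn0 leqNgt; case/negP.
  by apply/darts_gt0; exists a, b; rewrite in_setC.
have bp1 : b \in p1.
  rewrite inE bT /=; apply/negPn/negP => bQ.
  have bX : b \in X by rewrite !inE bQ bT.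
  have [aQ|aQ] := boolP (a \in Q).
    have /eqP := e2X; rewrite -leqn0 leqNgt; case/negP.
    by apply/darts_gt0; exists a, b; rewrite bX inE aQ.
  have /eqP := eXY; rewrite -leqn0 leqNgt; case/negP.
  by apply/darts_gt0; exists b, a; rewrite bX !inE aQ adj_sym.
rewrite leqNgt; apply/negP => db.
have p1fat : fat p1 by apply/existsP; exists b; rewrite bp1.
have c1_3 := minQ _ p1Q p1fat.
have [cX1 cY1 cQ2] := tight_cut_sizes c1 c2 cX cY cQ' cQ c1_3 c2_3 e12' e1Y e2X eXY.
(* Uncrossing with [Q0]: if [A] met [Q0], then [Q0 :\: A] would be fat and of cut at least 2, so
   posimodularity leaves cut 0 for [A :\: Q0]. Thus [A] lies in [Q0]; being of odd cut it is fat,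
   against the minimality of [Q0]. *)
have notin A : A \subset S -> x \notin A -> [disjoint A & Q] -> cut A = 1 -> [disjoint A & Q0].
  move=> AS xA dAQ cA1; rewrite -setI_eq0; apply/set0Pn => -[z]; rewrite inE => /andP[zA zQ0].
  have xQ0 := subsetP QQ0 x xQ.
  have fat1 : fat (Q0 :\: A) by apply/existsP; exists x; rewrite inE xA xQ0.
  have prop1 : Q0 :\: A \proper Q0.
    rewrite properEneq subsetDl andbT; apply: contraTneq zA => E.
    by move: zQ0; rewrite -E inE => /andP[].
  have {}gt1 := minQ0 _ prop1 fat1; have pm := cut_posimodular A Q0.
  rewrite cA1 in pm; have cD0 : ~~ (0 < cut (A :\: Q0)).
    by move: pm gt1 cQ0; move: (cut (A :\: Q0)) (cut (Q0 :\: A)) (cut Q0) => i j k; clear; lia.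
  have AQ0 : A \subset Q0.
    apply/subsetP => w wA; apply/negPn/negP => wQ0.
    have := @conn (A :\: Q0) w x; rewrite (subset_trans (subsetDl _ _) AS) !inE wA wQ0 xS xQ0.
    by move=> /(_ isT isT isT isT); apply/negP.
  have fatA : fat A by have [//|/(nonfat _ AS)] := boolP (fat A); rewrite cA1.
  have prop2 : A \proper Q0.
    by rewrite properEneq AQ0 andbT; apply/eqP => E; rewrite E xQ0 in xA.
  by have := minQ0 _ prop2 fatA; rewrite cA1.
have dX : [disjoint X & Q0].
  by apply: notin => //; [rewrite !inE xT andbF|disj3 Q T S memb].
have dY : [disjoint Y & Q0].
  by apply: notin => //; [rewrite !inE xQ|disj3 Q T S memb].
suff E : Q0 = Q by move: cQ0; rewrite E cQ2.
apply/eqP; rewrite eqEsubset QQ0 andbT; apply/subsetP => z zQ0; apply/negPn/negP => zQ.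
have zS := subsetP Q0S z zQ0.
have [zT|zT] := boolP (z \in T).
  by move: dY; rewrite disjoints_subset => /subsetP/(_ z); rewrite !inE zT zQ zQ0 => /(_ isT).
by move: dX; rewrite disjoints_subset => /subsetP/(_ z); rewrite !inE zT zQ zS zQ0 => /(_ isT).
Qed.

(** If every degree in the component is 2, it is a cycle and any edge serves: its cuts are positive
    and even, and the degree condition is automatic. Otherwise [fat_good] applies. *)
Lemma exists_good x0 : (forall v, v \in component G x0 -> 2 <= graph_degree G v) ->
  exists x y, [/\ x \in component G x0, y \in component G x0 & good x y].
Proof.
move=> deg2.
have compS x : x \in component G x0 -> component G x = component G x0 by rewrite inE => /componentP ->.
have [|nfat] := boolP [exists a in component G x0, 2 < graph_degree G a].
  move=> /existsP[f /andP[fS df]].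
  have [|||x [y [xS yS xy H]]] := @fat_good (component G x0) _ _ deg2.
  - move=> A AS; apply/eqP; rewrite -leqn0 leqNgt; apply/negP => /darts_gt0[a [b [aA bO ab]]].
    by move: bO; rewrite in_setC (component_stable _ ab) // (subsetP AS).
  - by move=> A a b AS aA; apply: cut_gt0 AS aA.
  - by exists f.
  exists x, y; split=> //; rewrite /good xy /= compS //.
  apply/forallP => T; apply/implyP => /and3P[TS xT yT]; have [-> H'] := H T TS xT yT.
  apply/implyP => /eqP/H' H2; apply/forall_inP => a aT; apply/forall_inP => b.
  by rewrite in_setC => bT; apply/implyP => ab; apply/implyP; exact: H2.
have [y] : exists y, y \in [set u | adj x0 u].
  by apply/card_gt0P; rewrite -graph_degree_nbrs; apply: leq_trans (deg2 _ _); rewrite ?mem_component.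
rewrite inE => x0y; have yS : y \in component G x0 := component_stable (mem_component _ _) x0y.
exists x0, y; split=> //; first exact: mem_component.
rewrite /good x0y /=; apply/forallP => T; apply/implyP => /and3P[TS xT yT].
have deg2' a : a \in component G x0 -> graph_degree G a <= 2.
  move=> aS; rewrite leqNgt; apply: contra nfat => da.
  by apply/existsP; exists a; rewrite aS.
have odd_c : ~~ odd (cut T).
  apply: odd_cut_degree2 => a aT; have aS := subsetP TS a aT.
  by apply/eqP; rewrite eqn_leq deg2 ?deg2'.
have pos_c := cut_gt0 TS xT yS yT.
apply/andP; split; first by lia.
apply/implyP => _; apply/forall_inP => a aT; apply/forall_inP => b bT.
apply/implyP => ab; apply/implyP => _; apply: deg2'; apply: component_stable ab.
exact: (subsetP TS).
Qed.

End Cuts.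

(** * Edge switches *)

Section Swaps.
Variable V : finType.
Implicit Types (G H : edge_set V) (u v w x y a b : V) (S T W : {set V}).
Implicit Types (E F : edge_set V).

Local Notation adj := adjacent_in.

Definition swap G E F : edge_set V := (G :\: E) :|: F.

Lemma swap_undo G E F : E \subset G -> [disjoint F & G] -> swap (swap G E F) F E = G.
Proof.
move=> /subsetP EG; rewrite disjoints_subset => /subsetP FG.
apply/setP => e; move: (EG e) (FG e) => /implyP + /implyP; rewrite !inE.
by case: (e \in E); case: (e \in F); case: (e \in G).
Qed.

Lemma swap_degree G E F w : E \subset G -> [disjoint F & G] ->
  graph_degree (swap G E F) w + #|[set e in E | w \in e]| =
  graph_degree G w + #|[set e in F | w \in e]|.
Proof.
move=> EG FG; rewrite /graph_degree.
have -> : [set e in swap G E F | w \in e] =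
    ([set e in G | w \in e] :\: [set e in E | w \in e]) :|: [set e in F | w \in e].
  apply/setP => e; rewrite !inE; by case: (w \in e); rewrite ?andbF // !andbT.
rewrite cardsU cardsD.
have -> : [set e in G | w \in e] :&: [set e in E | w \in e] = [set e in E | w \in e].
  apply/setIidPr/subsetP => e; rewrite !inE => /andP[eE ->].
  by rewrite (subsetP EG).
have -> : ([set e in G | w \in e] :\: [set e in E | w \in e])
     :&: [set e in F | w \in e] = set0.
  apply/eqP; rewrite setI_eq0 disjoint_sym disjoints_subset; apply/subsetP => e.
  rewrite !inE => /andP[eF we]; move: FG; rewrite disjoints_subset => /subsetP/(_ e eF).
  by rewrite inE => /negPf ->; rewrite andbF.
have : #|[set e in E | w \in e]| <= #|[set e in G | w \in e]|.
  apply: subset_leq_card; apply/subsetP => e; rewrite !inE => /andP[eE ->].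
  by rewrite (subsetP EG).
rewrite cards0; lia.
Qed.

Lemma card_incident1 (e : {set V}) w : #|[set f in [set e] | w \in f]| = (w \in e).
Proof.
case we: (w \in e).
  apply/eqP/cards1P; exists e; apply/setP => f; rewrite !inE.
  by case: eqVneq => // ->.
by apply/eqP; rewrite cards_eq0; apply/eqP/setP => f; rewrite !inE; case: eqVneq => // ->.
Qed.

Lemma card_incident2 (e f : {set V}) w : e != f ->
  #|[set g in [set e; f] | w \in g]| = (w \in e) + (w \in f).
Proof.
move=> ef; have -> : [set g in [set e; f] | w \in g] =
   [set g in [set e] | w \in g] :|: [set g in [set f] | w \in g].
  by apply/setP => g; rewrite !inE andb_orl.
rewrite cardsU !card_incident1; have -> : [set g in [set e] | w \in g] :&:
    [set g in [set f] | w \in g] = set0; last by rewrite cards0 subn0.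
apply/setP => g; rewrite !inE; case: eqVneq => //= ->.
by rewrite (negPf ef) andbF.
Qed.

Lemma swap_simple G E F : simple_graph G -> simple_graph F -> simple_graph (swap G E F).
Proof.
move=> /forall_inP Gs /forall_inP Fs; apply/forall_inP => e; rewrite !inE.
by move=> /orP[/andP[_ /Gs]|/Fs].
Qed.

Lemma simple_edge1 u v : u != v -> simple_graph [set [set u; v]].
Proof. by move=> uv; apply/forall_inP => e; rewrite inE => /eqP ->; rewrite cards2 uv. Qed.

Lemma simple_edge2 u v x y : u != v -> x != y -> simple_graph [set [set u; v]; [set x; y]].
Proof.
move=> uv xy; apply/forall_inP => e; rewrite !inE.
by move=> /orP[]/eqP ->; rewrite cards2 ?uv ?xy.
Qed.

Lemma cut_card G T : cut G T = #|[set p : V * V | [&& p.1 \in T, p.2 \notin T & adj G p.1 p.2]]|.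
Proof.
rewrite /cut /darts pair_big_dep /= -sum1_card [LHS]big_mkcond [RHS]big_mkcond /=.
apply: eq_bigr => -[a b] _ /=; rewrite !inE /=.
by case: (a \in T); case: (b \in T) => //=; case: (adj G a b).
Qed.

(** The traces that a switch leaves in [H], with [S] the former component of [x]: the 2-edge cut,
    what [good] said about the deleted edge [xy], the connectedness of [S], the fact that [uv] was
    no bridge, and the mark [deg v > 2]. The original graph does not occur, so two candidate
    preimages can be compared inside [H]. *)
Definition splice H u v x y S : Prop :=
  [/\ u != v, u \notin S, v \notin S, x \in S & y \in S] /\
  [/\ forall a b, a \in S -> b \notin S ->
        adj H a b = ((a, b) == (x, u)) || ((a, b) == (y, v)),
      forall T, T \subset S -> x \in T -> y \notin T ->
        (forall p q, p.1 \in T -> p.2 \in S :\: T -> adj H p.1 p.2 ->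
           q.1 \in T -> q.2 \in S :\: T -> adj H q.1 q.2 -> p = q) ->
        exists a b, [/\ a \in T, b \in S :\: T, adj H a b & graph_degree H b <= 2],
      forall T, T \subset S -> x \in T -> y \in T -> T != S ->
        exists a b, [/\ a \in T, b \in S :\: T & adj H a b],
      forall W, u \in W -> v \notin W ->
        exists a b, [/\ a \in W, b \notin W, a \notin S, b \notin S & adj H a b]
    & 2 < graph_degree H v].

(** Suppose [S] is not inside [S'] and let [T] be their intersection. An edge from [T] to the rest
    of [S] leaves [S'], so it is [y'v'], because [u] is outside [S]. If [y] is not in [T], the third
    clause gives [v'] degree at most 2, a contradiction. If [y] is in [T], then [v'] is in [S], so
    no edge of the cut of [S'] avoids [S]. Now [v] in [S'] contradicts the connection from [u] to
    [v] outside [S], and [v] outside [S'] makes [yv] a third edge of the cut of [S']. *)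
Lemma splice_sub H u v v' x y y' S S' :
  splice H u v x y S -> splice H u v' x y' S' -> S \subset S'.
Proof.
move=> [[uv uS vS xS yS] [F2 F3 F4 F5 _]] [[uv' uS' vS' xS' yS'] [F2' _ _ _ dv']].
apply/negPn/negP => SS'; pose T := S :&: S'.
have TS : T \subset S by exact: subsetIl.
have neT : T != S by apply: contra SS' => /eqP <-; exact: subsetIr.
have xT : x \in T by rewrite inE xS.
have leave a b : a \in T -> b \in S :\: T -> adj H a b -> a = y' /\ b = v'.
  rewrite !inE => /andP[aS aS'] /andP[]; move=> + bS; rewrite bS /= => bS' ab.
  have := F2' a b aS' bS'; rewrite ab => /esym/orP[]/eqP[-> // E].
  by move: bS; rewrite E (negPf uS).
have [yT|yT] := boolP (y \in T); last first.
  have [|a [b [aT bT ab db]]] := F3 T TS xT yT.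
    move=> [a b] [a' b'] /= aT bT ab aT' bT' ab'.
    have [-> ->] := leave _ _ aT bT ab; by have [-> ->] := leave _ _ aT' bT' ab'.
  by have [_ E] := leave _ _ aT bT ab; move: dv'; rewrite -E ltnNge db.
have [a [b [aT bT ab]]] := F4 T TS xT yT neT.
have [Ea Eb] := leave _ _ aT bT ab; subst a b.
have v'S : v' \in S by move: bT; rewrite inE => /andP[].
have [yS1 yS'1] : y \in S /\ y \in S' by move: yT; rewrite inE => /andP[].
have [vinS'|vnS'] := boolP (v \in S').
  have [||a [b [aW bW aS bS ab']]] := F5 (~: (S :|: S')).
  - by rewrite !inE negb_or uS.
  - by rewrite !inE vinS' orbT.
  have {bW} bS' : b \in S' by move: bW; rewrite !inE negbK (negPf bS).
  have {aW} aS' : a \notin S' by move: aW; rewrite !inE negb_or => /andP[].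
  have := F2' b a bS' aS'; rewrite adj_sym ab' => /esym/orP[]/eqP[E1 E2].
    by move: bS; rewrite E1 xS.
  by move: aS; rewrite E2 v'S.
have := F2' y v yS'1 vnS'; have -> : adj H y v by rewrite F2 // eqxx orbT.
move=> /esym/orP[]/eqP[E1 E2]; first by move: uv; rewrite E2 eqxx.
by move: vS; rewrite E2 v'S.
Qed.

Lemma splice_unique H u v v' x y y' S S' :
  splice H u v x y S -> splice H u v' x y' S' -> v = v' /\ y = y'.
Proof.
move=> sp sp'; have E : S = S'.
  by apply/eqP; rewrite eqEsubset (splice_sub sp sp') (splice_sub sp' sp).
case: sp sp' => [[uv uS vS xS yS] [F2 _ _ _ _]] [[uv' uS' vS' xS' yS'] [F2' _ _ _ _]].
rewrite -E in F2' yS' vS'.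
have := F2' y v yS vS; rewrite F2 // eqxx orbT => /esym/orP[]/eqP[E1 E2] //.
by move: uv; rewrite E2 eqxx.
Qed.

(** * The switch of two edges in different components *)

Section Switch.
Variables (G : edge_set V) (u v x y : V).
Hypotheses (Gs : simple_graph G) (uvG : nonbridge G u v)
  (nux : ~~ connect (adj G) u x) (xyG : adj G x y).

Let S := component G x.
Let H := swap G [set [set u; v]; [set x; y]] [set [set u; x]; [set v; y]].

Lemma switch_side : [/\ u != v, u \notin S, v \notin S, x \in S & y \in S].
Proof.
have /andP[uvE uvC] := uvG.
have uS : u \notin S by rewrite inE connect_adj_sym.
have xS : x \in S by exact: mem_component.
split=> //.
- by apply/eqP => E; have := adj_irr v Gs; rewrite /adjacent_in -{1}E uvE.
- apply: contra uS => vS; apply: component_stable vS _.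
  by rewrite adj_sym.
- exact: component_stable (mem_component _ _) xyG.
Qed.

Lemma switch_neq : x != y.
Proof. by apply/eqP => E; have := adj_irr y Gs; rewrite -{1}E xyG. Qed.

Lemma switch_sub : [set [set u; v]; [set x; y]] \subset G.
Proof. by have /andP[uvE _] := uvG; apply/subsetP => e; rewrite !inE => /orP[]/eqP ->. Qed.

Lemma switch_disj : [disjoint [set [set u; x]; [set v; y]] & G].
Proof.
have [uv uS vS xS yS] := switch_side.
rewrite disjoints_subset; apply/subsetP => e; rewrite !inE => /orP[]/eqP ->; apply/negP => eG.
  by case/negP: nux; apply: connect1.
by case/negP: vS; apply: component_stable yS _; rewrite adj_sym.
Qed.

Lemma switch_degree w : graph_degree H w = graph_degree G w.
Proof.
have [uv uS vS xS yS] := switch_side.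
have ux a b : a \in S -> b \notin S -> a != b.
  by move=> aS; apply: contraNneq => <-.
have := swap_degree w switch_sub switch_disj; rewrite -/H.
rewrite card_incident2; last first.
  by rewrite set2_eq negb_or !negb_and; apply/andP; split; apply/orP; left; rewrite eq_sym ux.
rewrite card_incident2; last by rewrite set2_eq negb_or !negb_and uv /= eq_sym ux.
have orE (a b : V) : a != b -> ((w == a) || (w == b) : nat) = (w == a) + (w == b).
  by move=> ab; have [->|_] := eqVneq w a; rewrite ?(negPf ab).
have [ux' vy'] : u != x /\ v != y by rewrite !(eq_sym _ x) !(eq_sym _ y) !ux.
rewrite !inE !orE // ?switch_neq // => /eqP.
by rewrite [X in _ == _ + X]addnACA eqn_add2r => /eqP.
Qed.

Lemma switch_adj_far a b : a \notin S -> b \notin S -> [set a; b] != [set u; v] ->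
  adj G a b -> adj H a b.
Proof.
have [uv uS vS xS yS] := switch_side.
move=> aS bS ab abG; rewrite /adjacent_in !inE (negPf ab) /= [_ \in G]abG andbT.
apply/orP; left; rewrite set2_eq negb_or !negb_and.
by apply/andP; split; apply/orP; left; [move: aS xS|move: aS yS];
   move=> + S1; apply: contraNneq => ->.
Qed.

Lemma switch_adj_near a b : a \in S -> b \in S ->
  adj H a b = adj G a b && ([set a; b] != [set x; y]).
Proof.
have [uv uS vS xS yS] := switch_side.
move=> aS bS; rewrite /adjacent_in !inE.
have n c e : c \notin S -> ([set a; b] == [set c; e]) = false.
  move=> cS; rewrite set2_eq; apply/negP => /orP[]/andP[/eqP Ea /eqP Eb]; move: cS.
    by rewrite -Ea aS.
  by rewrite -Eb bS.
by rewrite (n u) // (n u) // (n v) //= !orbF andbC.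
Qed.

Lemma switch_splice : good G x y -> 2 < graph_degree G v -> splice H u v x y S.
Proof.
have [uv uS vS xS yS] := switch_side.
move=> /andP[_ /forallP gd] dv; split=> //; split; last by rewrite switch_degree.
- move=> a b aS bS; rewrite /adjacent_in !inE.
  have -> : ([set a; b] \in G) = false.
    by apply/negP => ab; case/negP: bS; apply: component_stable aS ab.
  rewrite andbF /= !set2_eq !xpair_eqE.
  have nu : (a == u) = false by apply/eqP => E; move: uS; rewrite -E aS.
  have nv : (a == v) = false by apply/eqP => E; move: vS; rewrite -E aS.
  by rewrite nu nv.
- move=> T TS xT yT uniq.
  (* In [G] the edge [xy] also crosses [T]; without it the crossing edges are those counted by
     [uniq]. So [1 < cut T] provides such an edge and [uniq] turns the cut into one of size exactly
     2. *)
  have := gd T; rewrite TS xT yT /= cut_card.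
  set Dp := [set p : V * V | _].
  have xyD : (x, y) \in Dp by rewrite inE /= xT yT xyG.
  rewrite (cardsD1 (x, y) Dp) xyD add1n ltnS => /andP[/card_gt0P[[a b]]].
  have DpP c e : (c, e) \in Dp :\ (x, y) -> [/\ c \in T, e \in S :\: T, adj H c e,
      adj G c e & (c, e) != (x, y)].
    rewrite in_setD1 inE => /and4P[/= ne cT eT ce].
    have cS := subsetP TS c cT; have eS : e \in S := component_stable cS ce.
    have eD : e \in S :\: T by rewrite in_setD eT.
    have ceH : adj H c e.
      rewrite switch_adj_near // ce /= set2_eq negb_or -xpair_eqE ne /= negb_and.
      by apply/orP; left; apply: contraNneq yT => <-.
    by split.
  move=> abD; have [aT bT abH abG ne] := DpP _ _ abD.
  have bT' : b \in ~: T by move: bT; rewrite in_setC in_setD => /andP[].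
  have -> /= : #|Dp :\ (x, y)| = 1.
    apply/eqP/cards1P; exists (a, b); apply/eqP; rewrite eqEsubset sub1set abD andbT.
    apply/subsetP => -[c e] /DpP[cT eT ceH _ _]; rewrite inE.
    by apply/eqP; apply: (uniq (c, e) (a, b)).
  move=> /forall_inP/(_ a aT)/forall_inP/(_ b bT'); rewrite abG ne /= => db.
  by exists a, b; rewrite switch_degree.
- move=> T TS xT yT neT.
  have [z zS zT] : exists2 z, z \in S & z \notin T.
    by apply/subsetPn; apply: contra neT => ST; rewrite eqEsubset TS.
  have xz : connect (adj G) x z by move: zS; rewrite inE.
  have [c [e [cT eT ce]]] := connect_cross xz xT zT.
  have cS := subsetP TS c cT; have eS := component_stable cS ce.
  exists c, e; split; rewrite ?in_setD ?eT //.
  rewrite switch_adj_near // ce /= set2_eq negb_or !negb_and.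
  by apply/andP; split; apply/orP; right; apply: contraNneq eT => ->.
- move=> W uW vW; have /andP[uvE uvC] := uvG.
  have [||c [e [cT eT ce]]] := @connect_cross _ _ (W :&: component G u) u v uvC.
  - by rewrite in_setI uW mem_component.
  - by rewrite in_setI (negPf vW).
  move: ce; rewrite /adjacent_in in_setD1 => /andP[ne ceG].
  move: cT eT; rewrite in_setI => /andP[cW cC].
  have eC := component_stable cC ceG; rewrite in_setI eC andbT => eW.
  have far z : z \in component G u -> z \notin S.
    rewrite !inE => uz; apply: contra nux => xz; apply: connect_trans uz _.
    by rewrite connect_adj_sym.
  exists c, e; split; rewrite ?far //; apply: switch_adj_far => //; exact: far.
Qed.

(** The four changes are made one at a time: [ux] merges two components, [vy] joins vertices that
    are already connected, and [uv], then [xy], can be deleted because neither was a bridge and each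
    detour stays in its own former component. *)
Lemma switch_components : nonbridge G x y -> #|components H|.+1 = #|components G|.
Proof.
have [uv uS vS xS yS] := switch_side; have xy := switch_neq.
move=> /andP[xyE xyC]; have /andP[uvE uvC] := uvG.
pose G1 := [set u; x] |: G; pose G2 := [set v; y] |: G1.
have E1 : #|components G1|.+1 = #|components G| by exact: card_components_add.
have sub1 : G \subset G1 by exact: subsetUr.
have sub2 : G1 \subset G2 by exact: subsetUr.
have vy1 : connect (adj G1) v y.
  have m a b : adj G a b -> connect (adj G1) a b.
    by move=> ab; apply: connect_mono sub1 (connect1 ab).
  apply: connect_trans (m v u _) _; first by rewrite adj_sym.
  by apply: connect_trans (m x y _) => //; apply: connect1; rewrite /adjacent_in setU11.
have E2 : components G2 = components G1 by exact: components_add_connected.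
have E3 : components (G2 :\ [set u; v]) = components G2.
  apply: components_del; apply: connect_mono uvC; apply: setSD.
  exact: subset_trans sub1 sub2.
have E4 : components (G2 :\ [set u; v] :\ [set x; y]) = components (G2 :\ [set u; v]).
  apply: components_del; apply: connect_mono
    (_ : G :\ [set x; y] :\ [set u; v] \subset _) _.
    apply/subsetP => e; rewrite !inE => /and3P[-> -> ->]; by rewrite !orbT.
  apply: connect_del_far => //.
  by apply: contra nux => xu; rewrite connect_adj_sym; apply: connect_mono xu; rewrite subsetDl.
have -> : H = G2 :\ [set u; v] :\ [set x; y].
  apply/setP => e; rewrite !inE.
  have dis : (e == [set u; x]) || (e == [set v; y]) -> (e != [set u; v]) && (e != [set x; y]).
    move=> /orP[]/eqP ->; rewrite !set2_eq.
      have -> : (x == v) = false by apply/eqP => E; move: vS; rewrite -E xS.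
      have -> : (u == x) = false by apply/eqP => E; move: uS; rewrite E xS.
      have -> : (u == y) = false by apply/eqP => E; move: uS; rewrite E yS.
      by rewrite andbF (negPf uv).
    have -> : (y == v) = false by apply/eqP => E; move: vS; rewrite -E yS.
    have -> : (y == u) = false by apply/eqP => E; move: uS; rewrite -E yS.
    have -> : (v == x) = false by apply/eqP => E; move: vS; rewrite E xS.
    have -> : (v == y) = false by apply/eqP => E; move: vS; rewrite E yS.
    by rewrite !andbF.
  move: dis; case: (e == [set u; x]); case: (e == [set v; y]); case: (e == [set u; v]);
  case: (e == [set x; y]) => //= dis; rewrite ?orbT ?orbF ?andbT //; by have := dis isT.
by rewrite E4 E3 E2.
Qed.

End Switch.

(** If [xy] were a bridge, the side of [x] after its deletion would be a set with only one leaving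
    edge. *)
Lemma good_nonbridge G x y : good G x y -> nonbridge G x y.
Proof.
move=> /andP[xy /forallP gd]; rewrite /nonbridge [_ \in G]xy /=.
apply/negPn/negP => nxy; pose T := component (G :\ [set x; y]) x.
have TS : T \subset component G x.
  by apply/subsetP => z; rewrite !inE; apply: connect_mono; rewrite subsetDl.
have := gd T; rewrite TS mem_component inE nxy /= cut_card => /andP[+ _].
rewrite ltnNge; case/negP; rewrite -(cards1 (x, y)); apply: subset_leq_card.
apply/subsetP => -[a b]; rewrite inE => /and3P[/= aT bT ab].
have [/eqP E|ne] := boolP ([set a; b] == [set x; y]); last first.
  by case/negP: bT; apply: component_stable aT _; rewrite /adjacent_in in_setD1 ne.
move/eqP: E; rewrite set2_eq => /orP[]/andP[/eqP -> /eqP Eb]; first by rewrite Eb inE.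
by case/negP: bT; rewrite Eb mem_component.
Qed.

End Swaps.

(** * Counting surgeries *)

Lemma card_pairs (S T : finType) (X : {set S}) (F : S -> {set T}) :
  #|[set p : S * T | (p.1 \in X) && (p.2 \in F p.1)]| = \sum_(a in X) #|F a|.
Proof.
transitivity (\sum_(a in X) \sum_(b in F a) 1); last first.
  by apply: eq_bigr => a _; rewrite sum1_card.
by rewrite pair_big_dep /= -sum1_card; apply: eq_bigl => -[a b]; rewrite inE.
Qed.

Lemma card_sections (S T : finType) (X : {set S * T}) :
  #|X| = \sum_a #|[set b | (a, b) \in X]|.
Proof.
have := @card_pairs S T setT (fun a => [set b | (a, b) \in X]).
rewrite (eq_bigl xpredT) => [<-|a]; last by rewrite inE.
by apply: eq_card => -[a b]; rewrite !inE.
Qed.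

(** Double counting: [(G, t)] goes injectively to the pair of its result and its code, and each
    result admits only its own codes. *)
Lemma count_moves (Z T E : finType) (X Y : {set Z}) (ops : Z -> {set T})
    (out : Z -> T -> Z) (code : T -> E) (codes : Z -> {set E}) :
  (forall G t, G \in X -> t \in ops G -> out G t \in Y /\ code t \in codes (out G t)) ->
  (forall G G' t t', G \in X -> G' \in X -> t \in ops G -> t' \in ops G' ->
     out G t = out G' t' -> code t = code t' -> t = t' /\ G = G') ->
  \sum_(G in X) #|ops G| <= \sum_(H in Y) #|codes H|.
Proof.
move=> outY inj; rewrite -!card_pairs.
pose f (p : Z * T) := (out p.1 p.2, code p.2).
rewrite -(@card_in_imset _ _ f) => [|[G t] [G' t']]; last first.
  rewrite !inE /= => /andP[GX tG] /andP[GX' tG'] [E1 E2].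
  by have [-> ->] := inj _ _ _ _ GX GX' tG tG' E1 E2.
apply: subset_leq_card; apply/subsetP => _ /imsetP[[G t] + ->].
rewrite !inE /= => /andP[GX tG]; by have [-> ->] := outY _ _ GX tG.
Qed.

Lemma sum_card_fibers (Z : finType) (X : {set Z}) (M : Z -> nat) j N :
  \sum_(i < N) #|[set G in X | M G == i + j]| =
  \sum_(G in X) \sum_(i < N) (M G == i + j).
Proof.
rewrite exchange_big /=; apply: eq_bigr => i _.
rewrite -sum1_card big_mkcond /= [RHS]big_mkcond /=; apply: eq_bigr => G _.
by rewrite inE; case: (G \in X).
Qed.

(** Fibres over distinct values are disjoint. The shift [j] is there because insertions raise the
    degree sum by 2. *)
Lemma sum_card_fibers_le (Z : finType) (X : {set Z}) (M : Z -> nat) j N :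
  \sum_(i < N) #|[set G in X | M G == i + j]| <= #|X|.
Proof.
rewrite sum_card_fibers -sum1_card; apply: leq_sum => G _.
have [i0 Hi0|no] := pickP (fun i : 'I_N => M G == i + j); last first.
  by rewrite big1 // => i _; rewrite no.
rewrite (bigD1 i0) //= Hi0 big1 // => i; rewrite (eqP Hi0) eqn_add2r eq_sym.
by rewrite -val_eqE /= => /negPf ->.
Qed.

Lemma card_fibers (Z : finType) (X : {set Z}) (M : Z -> nat) N :
  (forall G, G \in X -> M G < N) -> #|X| <= \sum_(i < N) #|[set G in X | M G == i + 0]|.
Proof.
move=> MN; rewrite sum_card_fibers -sum1_card; apply: leq_sum => G GX.
by rewrite (bigD1 (Ordinal (MN G GX))) //= addn0 eqxx.
Qed.

Section Counting.
Variables (V : finType) (P : pred (edge_set V)) (d D : nat).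
Hypothesis D3 : 2 < D.
Implicit Types (G H : edge_set V) (u v w x y z : V).

Local Notation adj := adjacent_in.
Local Notation deg := graph_degree.

Hypothesis P_sub : forall G H, H \subset G -> P G -> P H.
Hypothesis P_bridge : forall G u x, simple_graph G -> P G ->
  ~~ connect (adj G) u x -> P ([set u; x] |: G).
Hypothesis P_switch : forall G u v x y, simple_graph G -> P G -> nonbridge G u v ->
  ~~ connect (adj G) u x -> adj G x y ->
  P (swap G [set [set u; v]; [set x; y]] [set [set u; x]; [set v; y]]).
Hypothesis P_insert : forall G u v x, simple_graph G -> P G -> adj G u v ->
  ~~ connect (adj G) u x -> deg G x <= 1 ->
  P (swap G [set [set u; v]] [set [set u; x]; [set v; x]]).

Definition degree_class : {set edge_set V} :=
  [set G | [&& simple_graph G, P G & [forall v, d <= deg G v <= D]]].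
Definition level k := [set G in degree_class | #|components G| == k].
Definition degsum G := \sum_v deg G v.

Lemma levelP k G : G \in level k ->
  [/\ simple_graph G, P G, forall v, d <= deg G v <= D & #|components G| = k].
Proof. by rewrite !inE => /andP[/and3P[? ? /forallP ?] /eqP]. Qed.

Lemma mem_level k G : simple_graph G -> P G -> (forall v, d <= deg G v <= D) ->
  #|components G| = k -> G \in level k.
Proof. by move=> Gs PG dG cG; rewrite !inE Gs PG cG eqxx andbT; apply/forallP. Qed.

Lemma degsum_card G : simple_graph G -> degsum G = #|[set p : V * V | adj G p.1 p.2]|.
Proof.
move=> Gs; rewrite card_sections; apply: eq_bigr => v _.
by rewrite graph_degree_nbrs //; apply: eq_card => u; rewrite !inE.
Qed.

Lemma disconnected_notin G u x : ~~ connect (adj G) u x -> [set u; x] \notin G.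
Proof. by apply: contra => ux; apply: connect1. Qed.

Lemma disconnected_neq G u x : ~~ connect (adj G) u x -> u != x.
Proof. by apply: contraNneq => ->. Qed.

Lemma disjoint_edge1 G e : e \notin G -> [disjoint [set e] & G].
Proof. by rewrite disjoints1. Qed.

Definition link_ops G : {set V * V} :=
  [set t | [&& ~~ connect (adj G) t.1 t.2, deg G t.1 < D & deg G t.2 < D]].

Lemma link_count k (X : {set edge_set V}) : X \subset level k.+1 ->
  \sum_(G in X) #|link_ops G| <= 2 * #|V| * #|level k|.
Proof.
move=> /subsetP Xk.
apply: (@leq_trans (\sum_(H in level k) #|[set p : V * V | bridge H p.1 p.2]|)); last first.
  rewrite mulnC -sum_nat_const; apply: leq_sum => H _; exact: card_bridge_darts.
apply: (@count_moves _ _ _ _ _ _ (fun G t => [set t.1; t.2] |: G) id).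
  move=> G [u x] /Xk /levelP[Gs PG dG cG]; rewrite [_ \in link_ops _]inE /= => /and3P[nux du dx].
  have uxG := disconnected_notin nux; have ux := disconnected_neq nux.
  split; last first.
    by rewrite inE /bridge /= setU11 setU1K.
  have E : [set u; x] |: G = swap G set0 [set [set u; x]] by rewrite /swap setD0 setUC.
  apply: mem_level.
  - by rewrite E; apply: swap_simple => //; exact: simple_edge1.
  - exact: P_bridge.
  - move=> w; have := @swap_degree _ G set0 [set [set u; x]] w (sub0set _) (disjoint_edge1 uxG).
    rewrite -E card_incident1; have -> : [set e in (set0 : edge_set V) | w \in e] = set0.
      by apply/setP => e; rewrite !inE.
    rewrite cards0 addn0 !inE => ->; have := dG w.
    have [->|_] := eqVneq w u; first by rewrite (negPf ux) /=; move: du; clear; lia.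
    by have [->|_] := eqVneq w x => /=; move: dx; clear; lia.
  - by apply/eqP; rewrite -eqSS card_components_add // cG.
move=> G G' t t' /Xk /levelP[Gs _ _ _] /Xk /levelP[Gs' _ _ _].
rewrite !inE => /and3P[nux _ _] /and3P[nux' _ _] E /= Et; subst t'; split=> //.
by rewrite -(setU1K (disconnected_notin nux)) E setU1K // disconnected_notin.
Qed.

Definition graft_ops G : {set V * (V * V)} :=
  [set t | [&& ~~ connect (adj G) t.1 t.2.1, deg G t.1 < D,
    [forall w in component G t.2.1, deg G w == D] & nonbridge G t.2.1 t.2.2]].

Definition graft G (t : V * (V * V)) : edge_set V :=
  swap G [set [set t.2.1; t.2.2]] [set [set t.1; t.2.1]].

Lemma graftP G u x y : simple_graph G -> (u, (x, y)) \in graft_ops G ->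
  [/\ ~~ connect (adj G) u x, x != y, u != y, nonbridge G x y & u != x].
Proof.
move=> Gs; rewrite [_ \in graft_ops _]inE /= => /and4P[nux _ _ xyG]; have /andP[xyE _] := xyG.
have xy : x != y by apply/eqP => E; have := adj_irr y Gs; rewrite /adjacent_in -{1}E xyE.
split=> //; last exact: disconnected_neq nux.
by apply: contraNneq nux => ->; rewrite connect_adj_sym; apply: connect1.
Qed.

Lemma graft_degree G u x y w : simple_graph G -> (u, (x, y)) \in graft_ops G ->
  deg (graft G (u, (x, y))) w + (w == y) = deg G w + (w == u).
Proof.
move=> Gs tG; have [nux xy uy /andP[xyE _] ux] := graftP Gs tG.
have := @swap_degree _ G [set [set x; y]] [set [set u; x]] w.
rewrite sub1set xyE disjoint_edge1 ?disconnected_notin // => /(_ isT isT).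
rewrite !card_incident1 !inE -/(graft G (u, (x, y))).
have [->|wx] := eqVneq w x; last by rewrite orbF.
by rewrite orbT (negPf xy) eq_sym (negPf ux) => /addIn ->.
Qed.

Lemma graft_del G u x y : simple_graph G -> (u, (x, y)) \in graft_ops G ->
  graft G (u, (x, y)) :\ [set u; x] = G :\ [set x; y].
Proof.
move=> Gs tG; have [nux _ _ _ _] := graftP Gs tG; have nG := disconnected_notin nux.
apply/setP => e; rewrite !inE /=; case: eqVneq => [->|_] /=; last by rewrite orbF.
by rewrite (negPf nG) andbF.
Qed.

Lemma graft_count k (X : {set edge_set V}) : X \subset level k.+1 ->
  \sum_(G in X) #|graft_ops G| <= 2 * #|V| * #|level k|.
Proof.
move=> /subsetP Xk.
apply: (@leq_trans (\sum_(H in level k) #|[set p : V * V | bridge H p.1 p.2]|)); last first.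
  rewrite mulnC -sum_nat_const; apply: leq_sum => H _; exact: card_bridge_darts.
apply: (@count_moves _ _ _ _ _ _ graft (fun t => (t.1, t.2.1))).
  move=> G [u [x y]] /Xk /levelP[Gs PG dG cG] tG.
  have [nux xy uy xyG ux] := graftP Gs tG.
  have := tG; rewrite [_ \in graft_ops _]inE /= => /and4P[_ du /forall_inP full _].
  have E : graft G (u, (x, y)) = ([set u; x] |: G) :\ [set x; y].
    apply/setP => e; rewrite !inE /=; case: (e =P [set u; x]) => [->|_] /=; last by rewrite orbF.
    by rewrite orbT set2_eq (negPf uy) (negPf ux).
  have /andP[xyE xyC] := xyG.
  split; last first.
    rewrite inE /bridge /= graft_del // !inE eqxx orbT /=.
    by apply: contra nux; apply: connect_mono; rewrite subsetDl.
  apply: mem_level.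
  - by apply: swap_simple => //; exact: simple_edge1.
  - by rewrite E; apply: P_sub (subsetDl _ _) _; exact: P_bridge.
  (* The vertex [y] drops to degree [D - 1]; this is at least [d] because [d <= deg u < D]. *)
  - move=> w; have := graft_degree w Gs tG; have := dG w; have := dG u.
    have [->|_] := eqVneq w y.
      rewrite eq_sym (negPf uy) (eqP (full y _)); first by move: du; clear; lia.
      by apply: component_stable (mem_component _ _) xyE.
    by have [->|_] := eqVneq w u; move: du; clear; lia.
  - apply/eqP; rewrite -eqSS -cG -(card_components_add nux) E components_del //.
    by apply: connect_mono xyC; apply: setSD; exact: subsetUr.
move=> G G' [u [x y]] [u' [x' y']] /Xk /levelP[Gs _ dG _] /Xk /levelP[Gs' _ dG' _] tG tG' E.
move=> [/= Eu Ex]; subst u' x'.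
have [nux xy uy /andP[xyE xyC] ux] := graftP Gs tG.
have [nux' xy' uy' /andP[xyE' xyC'] _] := graftP Gs' tG'.
have K : G :\ [set x; y] = G' :\ [set x; y'].
  by rewrite -(graft_del Gs tG) -(graft_del Gs' tG') E.
(* Deleting a non-bridge changes no component, so [x] has the same component in both preimages. *)
have CE z : connect (adj G) x z = connect (adj G') x z.
  by rewrite -(connect_del xyC) -(connect_del xyC') K.
(* Seen from [G], the vertex [y] has degree [D - 1] in the image; seen from [G'] with [y']
   different, it still has degree [D]. *)
have yy : y = y'.
  apply/eqP/negPn/negP => ne.
  have := tG; rewrite [_ \in graft_ops _]inE /= => /and4P[_ _ /forall_inP full _].
  have := tG'; rewrite [_ \in graft_ops _]inE /= => /and4P[_ _ /forall_inP full' _].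
  have yC : y \in component G x by rewrite inE; apply: connect1.
  have yC' : y \in component G' x by rewrite inE -CE; apply: connect1.
  have yu : (y == u) = false by rewrite eq_sym (negPf uy).
  have e1 := graft_degree y Gs tG; have e2 := graft_degree y Gs' tG'.
  rewrite E yu eqxx (eqP (full _ yC)) addn0 addn1 in e1.
  rewrite yu (negPf ne) (eqP (full' _ yC')) !addn0 in e2.
  by move/eqP: e1; rewrite e2 eqn_leq ltnn.
subst y'; split=> //.
by rewrite -(setD1K xyE) K setD1K.
Qed.

Definition switch_ops G : {set (V * V) * (V * V)} :=
  [set t | [&& nonbridge G t.1.1 t.1.2, 2 < deg G t.1.2,
     ~~ connect (adj G) t.1.1 t.2.1 & good G t.2.1 t.2.2]].

Definition switch G (t : (V * V) * (V * V)) : edge_set V :=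
  swap G [set [set t.1.1; t.1.2]; [set t.2.1; t.2.2]]
         [set [set t.1.1; t.2.1]; [set t.1.2; t.2.2]].

(** All degrees are kept, so the image has exactly [m] darts, and the code [(u, x)] is one of them;
    [splice_unique] supplies [v] and [y]. *)
Lemma switch_count k (X : {set edge_set V}) m :
  X \subset [set G in level k.+1 | degsum G == m] ->
  \sum_(G in X) #|switch_ops G| <= m * #|[set G in level k | degsum G == m]|.
Proof.
move=> /subsetP Xk.
apply: (@leq_trans (\sum_(H in [set G in level k | degsum G == m])
    #|[set p : V * V | adj H p.1 p.2]|)); last first.
  rewrite mulnC -sum_nat_const; apply: leq_sum => H; rewrite inE => /andP[/levelP[Hs _ _ _]].
  by rewrite degsum_card // => /eqP ->.
apply: (@count_moves _ _ _ _ _ _ switch (fun t => (t.1.1, t.2.1))).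
  move=> G [[u v] [x y]] /Xk; rewrite inE => /andP[/levelP[Gs PG dG cG] /eqP mG].
  rewrite [_ \in switch_ops _]inE /= => /and4P[uvG dv nux gxy].
  have xyN := good_nonbridge gxy; have /andP[xyG _] := xyN.
  have [uv uS vS xS yS] := switch_side Gs uvG nux xyG.
  have dE := switch_degree Gs uvG nux xyG.
  split; last by rewrite inE /= /adjacent_in !inE eqxx !orbT.
  rewrite inE; apply/andP; split; last first.
    by rewrite -mG /degsum; apply/eqP/eq_bigr => w _; exact: dE.
  apply: mem_level.
  - apply: swap_simple => //; apply: simple_edge2; first exact: disconnected_neq nux.
    by apply/eqP => /= E; move: vS; rewrite E yS.
  - exact: P_switch.
  - by move=> w; rewrite dE.
  - by apply/eqP; rewrite -eqSS switch_components // cG.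
move=> G G' [[u v] [x y]] [[u' v'] [x' y']] /Xk + /Xk.
rewrite !inE => /andP[/andP[/and3P[Gs _ _] _] _] /andP[/andP[/and3P[Gs' _ _] _] _] /=.
move=> /and4P[uvG dv nux gxy] /and4P[uvG' dv' nux' gxy'] E [Eu Ex]; subst u' x'.
have /andP[xyG _] := gxy; have /andP[xyG' _] := gxy'.
have sp := switch_splice Gs uvG nux xyG gxy dv.
have sp' := switch_splice Gs' uvG' nux' xyG' gxy' dv'.
rewrite -/(switch G' ((u, v'), (x, y'))) -E in sp'.
have [Ev Ey] := splice_unique sp sp'; subst v' y'; split=> //.
rewrite -(swap_undo (switch_sub uvG xyG) (switch_disj Gs uvG nux xyG)).
by rewrite -/(switch G ((u, v), (x, y))) E swap_undo ?switch_sub ?switch_disj.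
Qed.

Definition insert_ops G : {set (V * V) * V} :=
  [set t | [&& nonbridge G t.1.1 t.1.2, ~~ connect (adj G) t.1.1 t.2 & deg G t.2 <= 1]].

Definition insert G (t : (V * V) * V) : edge_set V :=
  swap G [set [set t.1.1; t.1.2]] [set [set t.1.1; t.2]; [set t.1.2; t.2]].

Lemma insertP G u v x : simple_graph G -> ((u, v), x) \in insert_ops G ->
  [/\ u != v, u != x, v != x, [set [set u; v]] \subset G &
      [disjoint [set [set u; x]; [set v; x]] & G]].
Proof.
move=> Gs; rewrite [_ \in insert_ops _]inE /= => /and3P[/andP[uvE _] nux _].
have nvx : ~~ connect (adj G) v x.
  by apply: contra nux; apply: connect_trans (connect1 _).
split.
- by apply/eqP => E; have := adj_irr v Gs; rewrite /adjacent_in -{1}E uvE.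
- exact: disconnected_neq nux.
- exact: disconnected_neq nvx.
- by rewrite sub1set.
- rewrite disjoints_subset; apply/subsetP => e; rewrite !inE.
  by move=> /orP[]/eqP ->; exact: disconnected_notin.
Qed.

Lemma insert_degree G u v x w : simple_graph G -> ((u, v), x) \in insert_ops G ->
  deg (insert G ((u, v), x)) w = deg G w + 2 * (w == x).
Proof.
move=> Gs tG; have [uv ux vx sub dis] := insertP Gs tG.
have := swap_degree w sub dis; rewrite -/(insert G ((u, v), x)) card_incident1.
rewrite card_incident2; last by rewrite set2_eq negb_or !negb_and uv (eq_sym x) vx orbT.
rewrite !inE; have [->|wu] := eqVneq w u.
  by rewrite (negPf uv) (negPf ux) /=; clear; lia.
have [->|wv] := eqVneq w v; first by rewrite (negPf vx) /=; clear; lia.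
by case: (w == x) => /=; clear; lia.
Qed.

(** In the image [x] has degree at most 3, so [x] together with an ordered pair [(u, v)] of its
    neighbours can be chosen in at most [9 * #|V|] ways, and these three vertices determine the
    original graph. *)
Lemma insert_count k (X : {set edge_set V}) m :
  X \subset [set G in level k.+1 | degsum G == m] ->
  \sum_(G in X) #|insert_ops G| <= 9 * #|V| * #|[set G in level k | degsum G == m + 2]|.
Proof.
move=> /subsetP Xk.
pose codes H := [set c : V * (V * V) | [&& deg H c.1 <= 3, adj H c.1 c.2.1 & adj H c.1 c.2.2]].
apply: (@leq_trans (\sum_(H in [set G in level k | degsum G == m + 2]) #|codes H|)); last first.
  rewrite mulnC -sum_nat_const; apply: leq_sum => H; rewrite inE => /andP[/levelP[Hs _ _ _] _].
  rewrite card_sections mulnC -sum_nat_const; apply: leq_sum => x _.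
  have [d3|d3] := leqP (deg H x) 3; last first.
    rewrite (_ : [set b | _] = set0) ?cards0 //.
    by apply/setP => b; rewrite !inE /= leqNgt d3.
  have N := graph_degree_nbrs Hs x.
  apply: leq_trans (_ : #|setX [set u | adj H x u] [set u | adj H x u]| <= 9).
    by apply: subset_leq_card; apply/subsetP => -[a b]; rewrite !inE /= => /and3P[_ -> ->].
  by rewrite cardsX -N; apply: (@leq_mul _ _ 3 3).
apply: (@count_moves _ _ _ _ _ _ insert (fun t => (t.2, t.1))).
  move=> G [[u v] x] /Xk; rewrite inE => /andP[/levelP[Gs PG dG cG] /eqP mG] tG.
  have [uv ux vx sub dis] := insertP Gs tG.
  have := tG; rewrite [_ \in insert_ops _]inE /= => /and3P[uvG nux dx]; have /andP[uvE uvC] := uvG.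
  have dE w := insert_degree w Gs tG.
  split; last first.
    rewrite inE /= dE eqxx; apply/and3P; split; first by move: dx; clear; lia.
      by rewrite adj_sym /adjacent_in !inE eqxx orbT.
    by rewrite adj_sym /adjacent_in !inE eqxx !orbT.
  rewrite inE; apply/andP; split; last first.
    rewrite -mG /degsum; under eq_bigr => w _ do rewrite dE.
    rewrite big_split /=; have -> : \sum_w 2 * (w == x) = 2; last by [].
    rewrite (bigD1 x) ?inE //= big1 ?addn0 => [|w /negPf -> //].
    by rewrite eqxx.
  apply: mem_level.
  - by apply: swap_simple => //; exact: simple_edge2.
  - exact: P_insert.
  - move=> w; rewrite dE; have [->|_] := eqVneq w x; last by rewrite muln0 addn0.
    (* The degree of [x] rises from at most 1 to at most 3, which [D >= 3] permits. *)
    by move: (dG x) dx D3; clear; lia.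
  - pose G1 := [set u; x] |: G; pose G2 := [set v; x] |: G1.
    have vx1 : connect (adj G1) v x.
      apply: (@connect_trans _ _ u).
        by apply: connect_mono (subsetUr _ _) _; apply: connect1; rewrite adj_sym.
      by apply: connect1; rewrite /adjacent_in setU11.
    apply/eqP; rewrite -eqSS -cG -(card_components_add nux) -/G1 eqSS.
    rewrite -(components_add_connected vx1) -/G2.
    have -> : insert G ((u, v), x) = G2 :\ [set u; v].
      apply/setP => e; rewrite !inE /=.
      have dis' : (e == [set u; x]) || (e == [set v; x]) -> e != [set u; v].
        move=> /orP[]/eqP ->; rewrite set2_eq.
          by rewrite (eq_sym x) (negPf vx) (negPf uv) andbF.
        by rewrite (eq_sym v) (negPf uv) (eq_sym x u) (negPf ux) andbF.
      move: dis'; case: (e == [set u; x]); case: (e == [set v; x]); case: (e == [set u; v]);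
        case: (e \in G) => //= dis'; by have := dis' isT.
    rewrite components_del //; apply: connect_mono uvC; apply: setSD.
    exact: subset_trans (subsetUr _ _) (subsetUr _ _).
move=> G G' [[u v] x] [[u' v'] x'] /Xk + /Xk.
move=> + + tG tG' E [Ex Eu Ev]; subst u' v' x'.
rewrite !inE => /andP[/andP[/and3P[Gs _ _] _] _] /andP[/andP[/and3P[Gs' _ _] _] _].
split=> //; have [_ _ _ sub dis] := insertP Gs tG.
have [_ _ _ sub' dis'] := insertP Gs' tG'.
by rewrite -(swap_undo sub dis) -/(insert G ((u, v), x)) E swap_undo.
Qed.

(** Turns a surgery for every foreign component into a number of surgeries: those at a fixed [u] hit
    all components but one. Two index sets are allowed because two kinds of surgery share the
    work. *)
Lemma cover_components G u (T1 T2 : finType) (S1 : {set T1}) (S2 : {set T2})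
    (f1 : T1 -> V) (f2 : T2 -> V) :
  (forall z, ~~ connect (adj G) u z ->
     (exists2 t, t \in S1 & connect (adj G) z (f1 t)) \/
     (exists2 t, t \in S2 & connect (adj G) z (f2 t))) ->
  #|components G| <= (#|S1| + #|S2|).+1.
Proof.
move=> cov; have uC : component G u \in components G by apply: imset_f.
rewrite (cardsD1 (component G u) (components G)) uC add1n ltnS.
apply: leq_trans (_ : #|[set component G (f1 t) | t in S1] :|:
  [set component G (f2 t) | t in S2]| <= _); last first.
  apply: leq_trans (leq_card_setU _ _) _; apply: leq_add; exact: leq_imset_card.
apply: subset_leq_card; apply/subsetP => C; rewrite in_setD1 => /andP[Cu /imsetP[z _ EC]].
have nuz : ~~ connect (adj G) u z.
  by apply: contra Cu => /componentP ->; rewrite EC.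
rewrite inE EC; have [[t tS /componentP ->]|[t tS /componentP ->]] := cov z nuz.
  by apply/orP; left; apply: imset_f.
by apply/orP; right; apply: imset_f.
Qed.

Definition slack G := [set v | deg G v < D].

(** A foreign component either has a vertex of degree below [D] to be linked with [u], or all its
    degrees are [D >= 2] and [exists_good] provides a non-bridge for a graft. *)
Lemma slack_moves k G : G \in level k.+1 ->
  #|slack G| * k <= #|link_ops G| + #|graft_ops G|.
Proof.
move=> /levelP[Gs _ dG cG]; rewrite !card_sections -big_split /=.
rewrite -sum_nat_const big_mkcond /=; apply: leq_sum => u _; case: ifP => // uS.
rewrite -ltnS -cG; apply: (@cover_components G u _ _ _ _ id fst) => z nuz.
rewrite inE in uS.
have [/existsP[x /andP[zx dx]]|/existsPn full] :=
    boolP [exists x, connect (adj G) z x && (deg G x < D)].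
  left; exists x => //; rewrite !inE /= uS dx !andbT.
  by apply: contra nuz => ux; apply: connect_trans ux _; rewrite connect_adj_sym.
have fullC w : w \in component G z -> deg G w = D.
  rewrite inE => zw; apply/eqP; rewrite eqn_leq; have /andP[_ ->] := dG w.
  by have := full w; rewrite zw /= -leqNgt.
right; have [|x [y [xz yz /good_nonbridge xyN]]] := @exists_good _ G Gs z.
  by move=> w /fullC ->; lia.
have zx : connect (adj G) z x by move: xz; rewrite inE.
exists (x, y) => //; rewrite !inE /= uS xyN andbT /=; apply/andP; split.
  by apply: contra nuz => ux; apply: connect_trans ux _; rewrite connect_adj_sym.
by apply/forall_inP => w; rewrite -(componentP _ _ _ zx) => /fullC ->.
Qed.

Definition sites G := [set p : V * V | nonbridge G p.1 p.2 && (2 < deg G p.2)].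

Lemma site_moves k G : G \in level k.+1 ->
  #|sites G| * k <= #|switch_ops G| + #|insert_ops G|.
Proof.
move=> /levelP[Gs _ dG cG]; rewrite (card_sections (switch_ops G)) (card_sections (insert_ops G)) -big_split /=.
rewrite -sum_nat_const big_mkcond /=; apply: leq_sum => -[u v] _; case: ifP => // uvS.
rewrite -ltnS -cG; apply: (@cover_components G u _ _ _ _ fst id) => z nuz.
move: uvS; rewrite inE /= => /andP[uvN dv].
have far x : connect (adj G) z x -> ~~ connect (adj G) u x.
  by move=> zx; apply: contra nuz => ux; apply: connect_trans ux _; rewrite connect_adj_sym.
have [/existsP[x /andP[zx dx]]|/existsPn full] :=
    boolP [exists x, connect (adj G) z x && (deg G x <= 1)].
  by right; exists x => //; rewrite !inE /= uvN far.
left; have [|x [y [xz yz gxy]]] := @exists_good _ G Gs z.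
  by move=> w; rewrite inE => zw; have := full w; rewrite zw /= -ltnNge.
have zx : connect (adj G) z x by move: xz; rewrite inE.
by exists (x, y) => //; rewrite !inE /= uvN dv far.
Qed.

(** Vertices outside [slack G] have degree [D], which is at least 3. *)
Lemma degsum_ge k G : G \in level k -> 3 * #|V| <= degsum G + 3 * #|slack G|.
Proof.
move=> /levelP[_ _ dG _].
have -> : 3 * #|slack G| = \sum_v 3 * (v \in slack G).
  by rewrite -big_distrr /= -sum1_card [in LHS]big_mkcond.
rewrite /degsum -big_split /= mulnC -sum_nat_const; apply: leq_sum => v _.
by rewrite inE; case: ltnP; lia.
Qed.

(** A dart that is no site is a bridge, or its head has degree at most 2. In the latter case the
    head is slack, since [D >= 3], and carries at most two such darts. *)
Lemma sites_ge k G : G \in level k -> degsum G <= #|sites G| + 2 * #|V| + 2 * #|slack G|.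
Proof.
move=> /levelP[Gs _ dG _]; rewrite degsum_card //.
pose low := [set p : V * V | (p.1 \in slack G) && (p.2 \in [set w | adj G p.1 w & deg G p.1 <= 2])].
pose low' := [set (p.2, p.1) | p in low].
apply: (@leq_trans #|sites G :|: [set p : V * V | bridge G p.1 p.2] :|: low'|).
  apply: subset_leq_card; apply/subsetP => -[u v]; rewrite !inE /= => uv.
  rewrite /nonbridge /bridge [_ \in G]uv /=.
  case: connect => //=; rewrite ?orbT //= orbF.
  have [//|dv] := ltnP; apply/imsetP; exists (v, u) => //.
  by rewrite !inE /= adj_sym uv dv andbT (leq_ltn_trans dv).
apply: leq_trans (leq_card_setU _ _) _; apply: leq_add.
  apply: leq_trans (leq_card_setU _ _) _; rewrite leq_add2l; exact: card_bridge_darts.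
apply: leq_trans (leq_imset_card _ _) _.
rewrite /low (@card_pairs _ _ (slack G) (fun a => [set w | adj G a w & deg G a <= 2])).
rewrite mulnC -sum_nat_const; apply: leq_sum => a _.
have [da|da] := leqP (deg G a) 2; last first.
  by rewrite (_ : [set w | _] = set0) ?cards0 //; apply/setP => w; rewrite !inE andbF.
apply: leq_trans da; rewrite graph_degree_nbrs //.
by apply: subset_leq_card; apply/subsetP => w; rewrite !inE => /andP[].
Qed.

(** Let [n] be the number of vertices. Graphs in [I] have at least [k n / 10] links and grafts,
    against [2 n + 2 n] codes per image: this costs 40. In [J], at least [5 m k / 27] surgeries face
    [m] codes per switched image and at most [4 m] per inserted one: this costs
    [27 * (1 + 4) / 5 = 27]. *)
Lemma level_ratio k : 0 < #|V| -> k * #|level k.+1| <= 67 * #|level k|.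
Proof.
move=> n0; pose I := [set G in level k.+1 | #|V| <= 10 * #|slack G|].
pose J := level k.+1 :\: I.
have Isub : I \subset level k.+1 by apply/subsetP => G; rewrite inE => /andP[].
have cardE : #|level k.+1| = #|I| + #|J|.
  by rewrite -(cardsID I (level k.+1)) (setIidPr Isub).
have boundI : k * #|I| <= 40 * #|level k|.
  have H : #|V| * k * #|I| <= 10 * \sum_(G in I) (#|link_ops G| + #|graft_ops G|).
    rewrite mulnC -sum_nat_const big_distrr /=; apply: leq_sum => G; rewrite inE => /andP[Gk s10].
    apply: leq_trans (_ : 10 * (#|slack G| * k) <= _); first by rewrite mulnA leq_mul2r s10 orbT.
    by rewrite leq_mul2l slack_moves.
  rewrite big_split /= in H.
  have H1 := link_count Isub; have H2 := graft_count Isub.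
  rewrite -(leq_pmul2l n0); move: H H1 H2.
  move: (\sum_(G in I) #|link_ops G|) (\sum_(G in I) #|graft_ops G|) => S1 S2.
  move: #|I| #|level k| #|V| => i l n H H1 H2.
  have -> : n * (40 * l) = 20 * (2 * n * l) by lia.
  by rewrite mulnA; lia.
have boundJ m : 5 * k * #|[set G in J | degsum G == m]| <=
    27 * (#|[set G in level k | degsum G == m]| + 4 * #|[set G in level k | degsum G == m + 2]|).
  set X := [set G in J | degsum G == m].
  have [->|[G0 G0X]] := set_0Vmem X; first by rewrite cards0 muln0.
  have Xsub : X \subset [set G in level k.+1 | degsum G == m].
    by apply/subsetP => G; rewrite !inE => /andP[/andP[_ ->] ->].
  have XP G : G \in X -> [/\ G \in level k.+1, degsum G = m & 10 * #|slack G| < #|V|].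
    rewrite inE => /andP[+ /eqP ->]; rewrite in_setD => /andP[nI Gk]; split=> //.
    by rewrite ltnNge; apply: contra nI => le; rewrite inE Gk.
  have nm : 27 * #|V| <= 10 * m.
    by have [Gk <- s10] := XP _ G0X; have := degsum_ge Gk; lia.
  have H : 5 * m * k * #|X| <= 27 * \sum_(G in X) (#|switch_ops G| + #|insert_ops G|).
    rewrite mulnC -sum_nat_const big_distrr /=; apply: leq_sum => G /XP[Gk mG s10].
    apply: leq_trans (_ : 27 * (#|sites G| * k) <= _); last by rewrite leq_mul2l site_moves.
    rewrite mulnA leq_mul2r; apply/orP; right.
    (* Here [#|sites G| >= m - 2.2 n], and [27 n <= 10 m] bounds [2.2 n] by [22 m / 27]. *)
    by have := sites_ge Gk; have := degsum_ge Gk; rewrite mG; lia.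
  rewrite big_split /= in H.
  have H1 := switch_count Xsub; have H2 := insert_count Xsub.
  have m0 : 0 < m by lia.
  rewrite -(leq_pmul2l m0).
  move: H H1 H2 nm.
  move: (\sum_(G in X) #|switch_ops G|) (\sum_(G in X) #|insert_ops G|) #|X| => S1 S2 c.
  move: #|[set G in level k | degsum G == m]| #|[set G in level k | degsum G == m + 2]| => a b.
  move: #|V| => n H H1 H2 nm.
  (* From [27 n <= 10 m] one has [9 n <= 10 m / 3], rounded up to [4 m]. *)
  have H3 : 9 * n * b <= 4 * m * b by rewrite leq_mul2r; apply/orP; right; lia.
  have -> : m * (5 * k * c) = 5 * m * k * c by lia.
  have -> : m * (27 * (a + 4 * b)) = 27 * (m * a + 4 * m * b) by lia.
  by apply: leq_trans H _; rewrite leq_mul2l /=; apply: leq_add; [exact: H1|exact: leq_trans H2 H3].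
(* Any number above all the degree sums serves as the range of summation. *)
pose N := (\sum_(G in level k.+1) degsum G).+1.
have JN G : G \in J -> degsum G < N.
  rewrite inE => /andP[_ Gk]; rewrite ltnS (bigD1 G) //=; exact: leq_addr.
have boundJ' : k * #|J| <= 27 * #|level k|.
  rewrite -(leq_pmul2l (isT : 0 < 5)) mulnA.
  apply: leq_trans (_ : 5 * k * \sum_(i < N) #|[set G in J | degsum G == i + 0]| <= _).
    by rewrite leq_mul2l card_fibers // orbT.
  have L : \sum_(i < N) 5 * k * #|[set G in J | degsum G == i + 0]| <=
      \sum_(i < N) 27 * (#|[set G in level k | degsum G == i + 0]| +
                         4 * #|[set G in level k | degsum G == i + 2]|).
    by apply: leq_sum => i _; have := boundJ i; rewrite !addn0.
  rewrite big_distrr /=; apply: leq_trans L _; rewrite -big_distrr big_split -big_distrr /=.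
  have h0 := @sum_card_fibers_le _ (level k) degsum 0 N.
  have h2 := @sum_card_fibers_le _ (level k) degsum 2 N.
  rewrite mulnCA leq_mul2l /=; apply: leq_trans (leq_add h0 (leq_mul (leqnn 4) h2)) _.
  by rewrite -mulSn.
rewrite cardE mulnDr (_ : 67 = 40 + 27) // mulnDl; exact: leq_add.
Qed.

End Counting.

(** From index [2 L] on the terms at least halve, so a tail is at most twice its first term. Going
    down the [2 L] earlier indices replaces [C] by [1 + C * L] each time. The constant is chosen
    before the sequence, which makes it uniform in all parameters of the class. *)
Lemma sum_ratio_bound L : 0 < L -> exists C, forall a : nat -> nat,
  (forall k, 0 < k -> k * a k.+1 <= L * a k) ->
  forall N, \sum_(i < N) a (1 + i) <= C * a 1.
Proof.
move=> L0.
have recl (a : nat -> nat) N k :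
    \sum_(i < N.+1) a (k + i) = a k + \sum_(i < N) a (k.+1 + i).
  rewrite big_ord_recl addn0; congr (_ + _); apply: eq_bigr => i _.
  by congr a; rewrite /= /bump /=; lia.
have tail j : exists C, forall a : nat -> nat,
    (forall k, 0 < k -> k * a k.+1 <= L * a k) ->
    forall N k, 0 < k -> 2 * L <= k + j -> \sum_(i < N) a (k + i) <= C * a k.
  elim: j => [|j [C HC]].
    exists 2 => a Ha; elim=> [|N IH] k k0; rewrite ?addn0 => Lk; first by rewrite big_ord0.
    rewrite recl; have := IH k.+1 isT; rewrite addn0 => /(_ (leqW Lk)) H.
    have : 2 * a k.+1 <= a k.
      rewrite -(leq_pmul2l L0); apply: leq_trans (Ha k k0).
      by rewrite mulnA leq_mul2r mulnC Lk orbT.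
    by move: H; move: (\sum_(i < N) _) (a k) (a k.+1) => S p q; clear; lia.
  exists (1 + C * L) => a Ha [|N] k k0 Lk; first by rewrite big_ord0.
  rewrite recl mulnDl mul1n leq_add2l -mulnA.
  apply: leq_trans (HC a Ha N k.+1 isT _) _; first by lia.
  rewrite leq_mul2l; apply/orP; right; apply: leq_trans (Ha k k0).
  by rewrite leq_pmull.
have [C HC] := tail (2 * L); exists C => a Ha N; apply: HC => //; exact: leq_addl.
Qed.

Lemma connected_share : exists C, forall (V : finType) (P : pred (edge_set V)) (d D : nat),
  2 < D -> 0 < #|V| ->
  (forall G H : edge_set V, H \subset G -> P G -> P H) ->
  (forall (G : edge_set V) u x, simple_graph G -> P G ->
     ~~ connect (adjacent_in G) u x -> P ([set u; x] |: G)) ->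
  (forall (G : edge_set V) u v x y, simple_graph G -> P G -> nonbridge G u v ->
     ~~ connect (adjacent_in G) u x -> adjacent_in G x y ->
     P (swap G [set [set u; v]; [set x; y]] [set [set u; x]; [set v; y]])) ->
  (forall (G : edge_set V) u v x, simple_graph G -> P G -> adjacent_in G u v ->
     ~~ connect (adjacent_in G) u x -> graph_degree G x <= 1 ->
     P (swap G [set [set u; v]] [set [set u; x]; [set v; x]])) ->
  #|degree_class P d D| <= C * #|[set G in degree_class P d D | connected_graph G]|.
Proof.
have [C HC] := @sum_ratio_bound 67 isT.
exists C => V P d D D3 V0 P1 P2 P3 P4.
have -> : [set G in degree_class P d D | connected_graph G] = level P d D 1.
  by apply/setP => G; rewrite !inE connected_components.
apply: leq_trans (_ : \sum_(i < #|V|) #|level P d D (1 + i)| <= _); last first.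
  by apply: (HC (fun k => #|level P d D k|)) => k _; exact: level_ratio.
have lt G : G \in degree_class P d D -> #|components G| < #|V|.+1.
  by move=> _; rewrite ltnS; exact: card_components_le.
apply: leq_trans (card_fibers lt) _; rewrite big_ord_recl /= addn0.
(* Level 0 is empty because there is a vertex; the sum therefore starts at level 1, the connected
   graphs. *)
have -> : [set G in degree_class P d D | #|components G| == 0] = set0.
  apply/setP => G; rewrite !inE; apply/negP => /andP[_ /eqP/cards0_eq E].
  have /card_gt0P[v _] := V0.
  have : component G v \in components G by apply: imset_f.
  by rewrite E inE.
rewrite cards0 add0n; apply: leq_sum => i _.
by rewrite /bump /= addn0.
Qed.

From mathcomp Require Import all_classical all_reals all_analysis.
From mathcomp Require Import ring lra.
Import Order.TTheory GRing.Theory Num.Theory.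
Import numFieldNormedType.Exports.
Local Open Scope ring_scope.

(** * Real functions and points of the plane *)

Section RealFunctions.
Variable R : realType.
Implicit Types (f : R -> R) (t a b : R).

(** Retraction of the line onto the unit interval: composing an arc with it expresses continuity on
    the interval as continuity on the whole line. *)
Definition clamp t : R := Num.max 0 (Num.min 1 t).

Lemma clamp_id t : 0 <= t <= 1 -> clamp t = t.
Proof.
by case/andP=> t0 t1; rewrite /clamp (min_idPr t1) (max_idPr t0).
Qed.

Lemma clamp_itv t : 0 <= clamp t <= 1.
Proof. by rewrite /clamp le_max lexx /= ge_max ler01 ge_min lexx. Qed.

Lemma continuous_clamp : continuous clamp.
Proof.
move=> t; rewrite /clamp; apply: (@continuous_max _ _ (cst 0)); first exact: cvg_cst.
apply: (@continuous_min _ _ (cst 1)); [exact: cvg_cst | exact: cvg_id].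
Qed.

Lemma positive_lower_bound f : continuous f ->
  (forall t : R, 0 <= t <= 1 -> 0 < f t) ->
  exists2 e : R, 0 < e & forall t : R, 0 <= t <= 1 -> e < f t.
Proof.
move=> fc fpos; have [//||c cI cmin] := @EVT_min R f 0 1.
  exact: continuous_subspaceT.
exists (f c / 2).
  by rewrite divr_gt0 ?fpos//; move: cI; rewrite in_itv.
move=> t t01; have ft : f c <= f t by apply: cmin; rewrite in_itv.
have : 0 < f c by apply: fpos; move: cI; rewrite in_itv.
lra.
Qed.

Lemma finite_positive_bound (I : finType) (P : I -> R -> Prop) :
  (forall i (e e' : R), 0 < e' <= e -> P i e -> P i e') ->
  (forall i, exists2 e : R, 0 < e & P i e) ->
  exists2 e : R, 0 < e & forall i, P i e.
Proof.
move=> mono ex.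
have nP i : (\forall e \near 0^'+, P i e)%classic.
  have [e e0 Pe] := ex i; near=> e'; apply: mono Pe.
  by apply/andP; split=> //; near: e'; apply: nbhs_right_le.
have nall : (\forall e \near 0^'+, forall i, P i e)%classic.
  exact: filter_forall.
have : (\forall e \near 0^'+, 0 < e /\ forall i, P i e)%classic.
  near=> e; split=> //; near: e; exact: nall.
by case/filter_ex => e [e0 Pe]; exists e.
Unshelve. all: by end_near.
Qed.

(** The least point of the compact set where [f <= 0]; by the intermediate value theorem [f] cannot
    be negative there. *)
Lemma first_zero f a b : continuous f -> a < b -> 0 < f a -> f b <= 0 ->
  exists c : R, [/\ a < c <= b, f c = 0 & forall t : R, a <= t < c -> 0 < f t].
Proof.
move=> fc ab fa fb.
pose E := (`[a, b] `&` f @^-1` [set y | y <= 0])%classic.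
have cE : compact E.
  apply: (@subclosed_compact _ _ `[a, b]%classic); last exact: subIsetl.
    apply: closedI; first exact: itv_closed.
    by apply: closed_comp; [move=> x _; exact: fc | exact: closed_le].
  exact: segment_compact.
have E0 : (E !=set0)%classic by exists b; split=> //=; rewrite in_itv/= lexx ltW.
have [|c cE' cmin] := @compact_EVT_min _ R id E E0 cE.
  by apply: continuous_subspaceT => x; exact: cvg_id.
have [] : E c by rewrite -in_setE.
rewrite /= in_itv/= => /andP[ac cb] fc0.
have pos t : a <= t < c -> 0 < f t.
  move=> /andP[at_ tc]; rewrite ltNge; apply/negP => ft.
  have : c <= t.
    by apply: cmin; rewrite in_setE; split=> //=; rewrite in_itv/= at_ (le_trans (ltW tc)).
  by rewrite leNgt tc.
have ac' : a < c.
  by rewrite lt_neqAle ac andbT; apply/eqP => e; move: fc0; rewrite -e leNgt fa.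
exists c; split; [by rewrite ac' cb| |exact: pos].
apply/eqP; rewrite eq_le fc0 /= leNgt; apply/negP => fcneg.
have [||d dI fd] := @IVT R f a c 0 ac.
- exact: continuous_subspaceT.
- by rewrite ge_min le_max (ltW fcneg) orbT (ltW fa).
move: dI; rewrite in_itv/= => /andP[ad dc].
have dc' : d < c.
  by rewrite lt_neqAle dc andbT; apply/eqP => e; move: fd fcneg; rewrite e => ->; rewrite ltxx.
by have := pos d; rewrite ad dc' fd ltxx => /(_ isT).
Qed.

Lemma last_zero f a b : continuous f -> a < b -> f a <= 0 -> 0 < f b ->
  exists c : R, [/\ a <= c < b, f c = 0 & forall t : R, c < t <= b -> 0 < f t].
Proof.
move=> fc ab fa fb.
have [||||c [cI fc0 pos]] := @first_zero (f \o -%R) (- b) (- a).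
- by move=> x; apply: continuous_comp; [exact: opp_continuous|exact: fc].
- lra.
- by rewrite /= opprK.
- by rewrite /= opprK.
exists (- c); split=> //; first lra.
move=> t ct; have := pos (- t); rewrite /= opprK; apply; lra.
Qed.

End RealFunctions.

Lemma continuous_for (S T : topologicalType) (f : S -> T) :
  (forall x, {for x, continuous f}) -> continuous f.
Proof. by []. Qed.

Section PlanePoints.
Variable R : realType.
Implicit Types z w : R * R.

(** Euclidean, since the discs have to be bounded by round circles, which an inversion can map to
    lines. *)
Definition sqdist z w : R := (z.1 - w.1) ^+ 2 + (z.2 - w.2) ^+ 2.

Lemma sqdist_ge0 z w : 0 <= sqdist z w.
Proof. by rewrite addr_ge0 ?sqr_ge0. Qed.

Lemma sqdist_gt0 z w : z <> w -> 0 < sqdist z w.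
Proof.
move=> zw; rewrite lt_neqAle sqdist_ge0 andbT eq_sym; apply/eqP => e; apply: zw.
move: e => /eqP; rewrite /sqdist paddr_eq0 ?sqr_ge0// !sqrf_eq0 !subr_eq0.
by move=> /andP[/eqP e1 /eqP e2]; rewrite (surjective_pairing z) e1 e2; case: w {e1 e2}.
Qed.

Section Continuity.
Variables (T : topologicalType) (x : T).
Implicit Types f g : T -> R.

Lemma continuous_pair f g : {for x, continuous f} -> {for x, continuous g} ->
  {for x, continuous (fun y => (f y, g y))}.
Proof. by move=> fc gc; exact: (@cvg_pair _ _ _ _ _ _ _ _ _ f g fc gc). Qed.

Lemma continuous_fst (h : T -> R * R) : {for x, continuous h} ->
  {for x, continuous (fun y => (h y).1)}.
Proof. by move=> hc; exact: (@continuous_comp _ _ _ h fst x hc (@cvg_fst _ _ _ _ _)). Qed.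

Lemma continuous_snd (h : T -> R * R) : {for x, continuous h} ->
  {for x, continuous (fun y => (h y).2)}.
Proof. by move=> hc; exact: (@continuous_comp _ _ _ h snd x hc (@cvg_snd _ _ _ _ _)). Qed.

Lemma continuous_add f g : {for x, continuous f} -> {for x, continuous g} ->
  {for x, continuous (fun y => f y + g y)}.
Proof. by move=> fc gc; exact: (@cvgD R R^o _ _ _ f g _ _ fc gc). Qed.

Lemma continuous_opp f : {for x, continuous f} ->
  {for x, continuous (fun y => - f y)}.
Proof. by move=> fc; exact: (@cvgN R R^o _ _ _ f _ fc). Qed.

Lemma continuous_mul f g : {for x, continuous f} -> {for x, continuous g} ->
  {for x, continuous (fun y => f y * g y)}.
Proof. by move=> fc gc; exact: (@cvgM R _ _ _ f g _ _ fc gc). Qed.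

Lemma continuous_div f g : {for x, continuous f} -> {for x, continuous g} ->
  g x != 0 -> {for x, continuous (fun y => f y / g y)}.
Proof. by move=> fc gc g0; apply: (continuous_mul fc); exact: (@cvgV R _ _ _ g _ g0 gc). Qed.

End Continuity.

Lemma continuous_sqdist (T : topologicalType) (x : T) (h k : T -> R * R) :
  {for x, continuous h} -> {for x, continuous k} ->
  {for x, continuous (fun y => sqdist (h y) (k y))}.
Proof.
move=> hc kc; apply: continuous_add.
  have c : {for x, continuous (fun y => (h y).1 - (k y).1)}.
    by apply: continuous_add; [exact: continuous_fst
      | apply: continuous_opp; exact: continuous_fst].
  exact: (continuous_mul c c).
have c : {for x, continuous (fun y => (h y).2 - (k y).2)}.
  by apply: continuous_add; [exact: continuous_snd
    | apply: continuous_opp; exact: continuous_snd].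
exact: (continuous_mul c c).
Qed.

End PlanePoints.

(** * Drawings *)

Definition sumf (A B C : Type) (f : A -> C) (g : B -> C) (x : A + B) : C :=
  match x with inl a => f a | inr b => g b end.

Section Drawings.
Variable R : realType.
Local Notation point := (R * R)%type.

(** Arcs have an arbitrary index type and chosen ends, so that edges, loose ends and halves of edges
    are all treated alike. *)
Definition drawn (V I : Type) (dom : I -> Prop) (s t : I -> V)
    (p : V -> point) (g : I -> R -> point) : Prop :=
  [/\ injective p,
      forall i, dom i -> [/\ continuous (g i \o @clamp R), g i 0 = p (s i),
        g i 1 = p (t i)
        & forall a b : R, 0 <= a <= 1 -> 0 <= b <= 1 -> g i a = g i b -> a = b],
      forall i (a : R) v, dom i -> 0 < a < 1 -> g i a <> p v
    & forall i j (a b : R), dom i -> dom j -> i <> j -> 0 < a < 1 -> 0 < b < 1 ->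
        g i a <> g j b].

Lemma drawn_avoid (V I : Type) (dom : I -> Prop) (s t : I -> V) p g i j a b :
  drawn dom s t p g -> dom i -> dom j -> i <> j -> 0 <= a <= 1 -> 0 < b < 1 ->
  g i a <> g j b.
Proof.
move=> [_ ends avoid disj] di dj ij a01 b01.
have [a0|a0] := eqVneq a 0.
  by have [_ e _ _] := ends i di; rewrite a0 e => e'; exact: (avoid j b (s i)).
have [a1|a1] := eqVneq a 1.
  by have [_ _ e _] := ends i di; rewrite a1 e => e'; exact: (avoid j b (t i)).
apply: disj => //; move: a01; rewrite !le_eqVlt eq_sym (negPf a0) (negPf a1) /=.
by [].
Qed.

(** The map need only behave well on a region [Z] that holds the drawing; this admits inversions,
    which have a pole elsewhere. *)
Lemma drawn_comp (V I : Type) (dom : I -> Prop) (s t : I -> V) p g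
    (Phi : point -> point) (Z : point -> Prop) :
  drawn dom s t p g -> (forall v, Z (p v)) ->
  (forall i (a : R), dom i -> 0 < a < 1 -> Z (g i a)) ->
  (forall z, Z z -> {for z, continuous Phi}) ->
  (forall z w, Z z -> Z w -> Phi z = Phi w -> z = w) ->
  drawn dom s t (Phi \o p) (fun i => Phi \o g i).
Proof.
move=> [pinj ends avoid disj] Zp Zg Pc Pinj.
have Zg' i a : dom i -> 0 <= a <= 1 -> Z (g i a).
  move=> di a01; have [_ e0 e1 _] := ends i di.
  have [->|a0] := eqVneq a 0; first by rewrite e0.
  have [->|a1] := eqVneq a 1; first by rewrite e1.
  apply: Zg => //; move: a01; rewrite !le_eqVlt eq_sym (negPf a0) (negPf a1) /=.
  by [].
split.
- by move=> v w /= e; apply: pinj; apply: Pinj e.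
- move=> i di; have [gc e0 e1 ginj] := ends i di; split.
  + move=> x.
    apply: (@continuous_comp _ _ _ (g i \o @clamp R) Phi x (gc x)).
    by apply: Pc; apply: Zg' => //; exact: clamp_itv.
  + by rewrite /= e0.
  + by rewrite /= e1.
  + by move=> a b a01 b01 /= e; apply: ginj => //; apply: Pinj e; exact: Zg'.
- by move=> i a v di a01 /= e; apply: (avoid i a v di a01); apply: Pinj e => //; exact: Zg.
- move=> i j a b di dj ij a01 b01 /= e; apply: (disj i j a b) => //.
  by apply: Pinj e; exact: Zg.
Qed.

Lemma free_disc (V I : finType) (dom : I -> Prop) (s t : I -> V) p g z
    (W : V -> Prop) (J : I -> Prop) :
  drawn dom s t p g -> (forall v, W v -> p v <> z) -> (forall i, J i -> dom i) ->
  (forall i (a : R), J i -> 0 <= a <= 1 -> g i a <> z) ->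
  exists rho : R, [/\ 0 < rho, forall v, W v -> rho ^+ 2 < sqdist (p v) z
    & forall i (a : R), J i -> 0 <= a <= 1 -> rho ^+ 2 < sqdist (g i a) z].
Proof.
move=> [_ ends _ _] Wz Jd Jz.
have [||e1 e1pos P1] := @finite_positive_bound R V
  (fun v e => W v -> e < sqdist (p v) z).
- by move=> v e e' /andP[_ e'e] H Wv; exact: le_lt_trans (H Wv).
- move=> v; have [Wv|nWv] := pselect (W v); last by exists 1.
  have d0 := sqdist_gt0 (Wz _ Wv).
  exists (sqdist (p v) z / 2); first by rewrite divr_gt0.
  by move=> _; lra.
have [||e2 e2pos P2] := @finite_positive_bound R I
  (fun i e => J i -> forall a, 0 <= a <= 1 -> e < sqdist (g i a) z).
- by move=> v e e' /andP[_ e'e] H Ji a a01; exact: le_lt_trans (H Ji a a01).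
- move=> i; have [Ji|nJi] := pselect (J i); last by exists 1.
  have [||e e0 He] := @positive_lower_bound R (fun a => sqdist (g i (clamp a)) z).
  + move=> x; apply: continuous_sqdist; last exact: cvg_cst.
    by have [gc _ _ _] := ends i (Jd _ Ji); exact: gc.
  + by move=> a a01; apply: sqdist_gt0; apply: Jz => //; exact: clamp_itv.
  exists e => // _ a a01; have := He a a01; by rewrite clamp_id.
(* The bounds [e1] and [e2] concern squared distances; [rho <= 1] gives [rho ^+ 2 <= rho], which is
   below both. *)
pose rho := Num.min 1 (Num.min e1 e2).
have rho0 : 0 < rho by rewrite !lt_min ltr01 e1pos.
have r1 : rho <= 1 by rewrite ge_min lexx.
have rr : rho ^+ 2 <= rho by rewrite expr2 ger_pMr.
have re1 : rho <= e1 by rewrite !ge_min lexx orbT.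
have re2 : rho <= e2 by rewrite !ge_min lexx !orbT.
exists rho; split=> // [v Wv|i a Ji a01].
- by apply: le_lt_trans (P1 v Wv); lra.
- by apply: le_lt_trans (P2 i Ji a a01); lra.
Qed.

Section Graphs.
Variable V : finType.
Implicit Types (G : edge_set V) (s t : {set V} -> V).

Definition drawing G s t (p : V -> point) (g : {set V} -> R -> point) : Prop :=
  (forall e, e \in G -> e = [set s e; t e]%SET) /\
  drawn (fun e => e \in G) s t p g.

(* The arcs [h b] leave the drawing of [G] from the vertices [att b] and end at
   the points [q b]; everything else lies in the region [Z]. *)
Definition rimmed (B : Type) (Z : point -> Prop) (q : B -> point)
    (att : B -> V) G : Prop :=
  exists s t p g (h : B -> R -> point),
    [/\ forall e, e \in G -> e = [set s e; t e]%SET,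
        drawn (sumf (fun e => is_true (e \in G)) (fun _ => True))
          (sumf (fun e => inl (s e)) (fun b => inl (att b)))
          (sumf (fun e => inl (t e)) (fun b => inr b)) (sumf p q) (sumf g h),
        forall v, Z (p v),
        forall e (a : R), e \in G -> 0 < a < 1 -> Z (g e a)
      & forall b (a : R), 0 < a < 1 -> Z (h b a)].

Lemma rimmed_comp (B : Type) (Z Z' : point -> Prop) (q : B -> point) att G
    (Phi : point -> point) :
  rimmed Z q att G ->
  (forall z, Z z -> {for z, continuous Phi}) ->
  (forall b, {for q b, continuous Phi}) ->
  (forall z w, (Z z \/ exists b, z = q b) -> (Z w \/ exists b, w = q b) ->
     Phi z = Phi w -> z = w) ->
  (forall z, Z z -> Z' (Phi z)) ->
  rimmed Z' (Phi \o q) att G.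
Proof.
move=> [s [t [p [g [h [ends dr Zp Zg Zh]]]]]] Pc Pq Pinj ZZ'.
exists s, t, (Phi \o p), (fun e => Phi \o g e), (fun b => Phi \o h b).
split=> //; last 3 first.
- by move=> v; apply: ZZ'.
- by move=> e a eG a01; apply: ZZ'; exact: Zg.
- by move=> b a a01; apply: ZZ'; exact: Zh.
have := @drawn_comp _ _ _ _ _ _ _ Phi (fun z => Z z \/ exists b, z = q b) dr.
have -> : Phi \o sumf p q = sumf (Phi \o p) (Phi \o q) by apply/funext; case.
have -> : (fun i => Phi \o sumf g h i) =
    sumf (fun e => Phi \o g e) (fun b => Phi \o h b) by apply/funext; case.
apply=> //.
- by case=> [v|b]; [left; exact: Zp|right; exists b].
- by case=> [e|b] a /= d a01; left; [exact: Zg|exact: Zh].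
- move=> z [/Pc //|[b ->]]; exact: Pq.
Qed.

Lemma continuous_comp_clamp (f : R -> point) :
  ({within `[0, 1], continuous f})%classic -> continuous (f \o @clamp R).
Proof.
move=> /subspace_continuousP fc x.
have c01 : `[0, 1]%classic (clamp x) by rewrite /= in_itv; exact: clamp_itv.
have cl : ((@clamp R) y @[y --> x] -->
    within `[0, 1]%classic (nbhs (clamp x)))%classic.
  move=> A /= [e /= e0 He].
  apply: (@filterS _ (nbhs x) _ ((@clamp R) @^-1` ball (clamp x) e)%classic); last first.
    exact: (@continuous_clamp R x _ (nbhsx_ballx _ e e0)).
  move=> y /= By; apply: He => //=.
  by rewrite in_itv; exact: clamp_itv.
exact: cvg_comp cl (fc _ c01).
Qed.

Lemma drawing_of_planar (v0 : V) G : simple_graph G -> is_planar R G ->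
  exists s t p g, drawing G s t p g.
Proof.
move=> /forall_inP Gs [p [g [pinj arcs avoid disj]]].
have ex e : exists st : V * V, e \in G ->
    [/\ e = [set st.1; st.2]%SET, g e 0 = p st.1 & g e 1 = p st.2].
  (* Ends are chosen for every set of vertices; [v0] is the default for sets that are not edges. *)
  have [eG|] := boolP (e \in G); last by exists (v0, v0).
  have [_ gim] := arcs e eG.
  have /cards2P[a [b [ab eab]]] : #|e| == 2%N by apply: Gs.
  have p0 : (p @` [set` e])%classic (g e 0) by rewrite -gim; exists 0 => //=; left.
  have pe v : v \in e -> p v = g e 0 \/ p v = g e 1.
    move=> ve; have : (g e @` [set 0; 1])%classic (p v) by rewrite gim; exists v.
    by move=> [x /= [->|->] <-]; [left|right].
  have [c ce gc] := p0.
  have [d [ed ecd]] : exists d, d != c /\ e = [set c; d]%SET.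
    move: ce; rewrite /= eab !inE => /orP[]/eqP ->.
      by exists b; rewrite eq_sym.
    by exists a; split=> //; rewrite finset.setUC.
  exists (c, d) => _; split=> //=.
  have [|e0|//] := pe d; first by rewrite ecd !inE eqxx orbT.
  by move: ed; rewrite -(inj_eq pinj) e0 gc eqxx.
have [st Hst] := choice ex.
exists (fun e => (st e).1), (fun e => (st e).2), p, g.
split; first by move=> e eG; have [] := Hst e eG.
split=> //.
- move=> e eG; have [_ g0 g1] := Hst e eG; have [[gc ginj] _] := arcs e eG.
  split=> //; first exact: continuous_comp_clamp.
- by move=> e a v eG a01; exact: avoid.
- by move=> i j a b iG jG /eqP ij a01 b01; exact: disj.
Qed.

Lemma planar_of_drawing G s t p g : drawing G s t p g -> is_planar R G.
Proof.
move=> [ends [pinj arcs avoid disj]]; exists p, (fun e => g e \o @clamp R); split=> //.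
- move=> e eG; have [gc g0 g1 ginj] := arcs e eG.
  have c0 : clamp (0 : R) = 0 by rewrite clamp_id ?lexx ?ler01.
  have c1 : clamp (1 : R) = 1 by rewrite clamp_id ?lexx ?ler01.
  split; first split.
  + exact: continuous_subspaceT.
  + move=> a b; rewrite !in_itv /= => a01 b01; rewrite !clamp_id//; exact: ginj.
  + have [se te] : s e \in e /\ t e \in e.
      by have := ends e eG; move: (s e) (t e) => a b ->; rewrite !inE !eqxx orbT.
    apply/seteqP; split=> [_ [x /= [->|->] <-]|_ [v /= ve <-]].
    * by exists (s e); rewrite //= c0 g0.
    * by exists (t e); rewrite //= c1 g1.
    * have : v \in [set s e; t e]%SET by rewrite -(ends e eG).
      rewrite !inE => /orP[]/eqP ->.
        by exists 0; [left|rewrite /= c0].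
      by exists 1; [right|rewrite /= c1].
- move=> e eG a v /andP[a0 a1] /=; rewrite clamp_id ?ltW//.
  by apply: avoid => //; rewrite a0.
- move=> e f eG fG /eqP ef a b /andP[a0 a1] /andP[b0 b1] /=; rewrite !clamp_id ?ltW//.
  by apply: disj => //; rewrite ?a0 ?b0.
Qed.

Lemma drawing_sub G G' s t p g : G' \subset G -> drawing G s t p g ->
  drawing G' s t p g.
Proof.
move=> /fintype.subsetP sub [ends [pinj arcs avoid disj]]; split; first by move=> e /sub/ends.
split=> //.
- by move=> e /sub/arcs.
- by move=> e a v /sub; exact: avoid.
- by move=> e f a b /sub eG /sub fG; exact: disj.
Qed.

End Graphs.
End Drawings.

(** * Opening a drawing at an interior point of an edge *)

Section Rims.
Variables (R : realType) (V : finType).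
Local Notation point := (R * R)%type.
Implicit Types (G : edge_set V) (s t : {set V} -> V) (p : V -> point)
  (g : {set V} -> R -> point).

Definition outside (c : point) (rho : R) : point -> Prop :=
  fun z => rho ^+ 2 < sqdist z c.

(** A disc round the middle of the arc avoids all vertices and other edges, but the arc itself may
    enter it many times. Only the piece before the first hit [a] and the piece after the last hit
    [b] are kept, so both stay outside. *)
Lemma cut_edge_oriented G s t p g e : drawing G s t p g -> e \in G ->
  exists c rho A B, [/\ 0 < rho, A <> B, sqdist A c = rho ^+ 2,
    sqdist B c = rho ^+ 2
    & rimmed (outside c rho) (fun b : bool => if b then B else A)
        (fun b : bool => if b then t e else s e) (G :\ e)%SET].
Proof.
move=> [ends dr] eG; have [pinj arcs avoid disj] := dr.
have [gc g0 g1 ginj] := arcs e eG.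
have half : 0 < (1 / 2 : R) < 1 by lra.
pose c := g e (1 / 2).
have [|||rho [rho0 outp outg]] := @free_disc R V _ _ s t p g c (fun _ => True)
  (fun f => f \in G /\ f <> e) dr.
- by move=> v _ ev; apply: (avoid e (1 / 2) v eG half).
- by move=> f [].
- move=> f a [fG fe] a01; exact: (drawn_avoid dr fG eG fe a01 half).
pose f (x : R) := sqdist (g e (clamp x)) c - rho ^+ 2.
have fc : continuous f.
  apply: continuous_for => x; apply: continuous_add; last exact: cvg_cst.
  by apply: continuous_sqdist; [exact: gc|exact: cvg_cst].
have r2 : 0 < rho ^+ 2 by rewrite exprn_gt0.
have fhalf : f (1 / 2) = - rho ^+ 2.
  by rewrite /f clamp_id; [rewrite /sqdist !subrr expr0n /= addr0 sub0r|lra].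
have f0 : 0 < f 0.
  by rewrite /f clamp_id ?lexx ?ler01// g0 subr_gt0; exact: outp.
have f1 : 0 < f 1.
  by rewrite /f clamp_id ?lexx ?ler01// g1 subr_gt0; exact: outp.
have [half0 half1 fh] : [/\ 0 < (1 / 2 : R), (1 / 2 : R) < 1 & f (1 / 2) <= 0].
  by split; lra.
have [a [aI fa apos]] := first_zero fc half0 f0 fh.
have [b [bI fb bpos]] := last_zero fc half1 fh f1.
have ah : a <> 1 / 2 by move=> E; move: fa; rewrite E fhalf; lra.
have {ah}ab : a < b.
  have : a != 1 / 2 by apply/eqP.
  by rewrite neq_lt => /orP[|]; lra.
have fE x : 0 <= x <= 1 -> 0 < f x -> outside c rho (g e x).
  by move=> x01; rewrite /f /outside clamp_id// subr_gt0.
have a01 : 0 <= a <= 1 by lra.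
have b01 : 0 <= b <= 1 by lra.
have Ac : sqdist (g e a) c = rho ^+ 2.
  by apply/eqP; rewrite -subr_eq0; move: fa; rewrite /f clamp_id// => ->.
have Bc : sqdist (g e b) c = rho ^+ 2.
  by apply/eqP; rewrite -subr_eq0; move: fb; rewrite /f clamp_id// => ->.
exists c, rho, (g e a), (g e b); split=> //.
  by move=> /ginj; rewrite a01 b01 => /(_ isT isT); lra.
(* Both loose ends run from their vertex to the circle, so the second piece is traversed
   backwards. *)
pose h (d : bool) (x : R) := g e (if d then 1 - (1 - b) * x else a * x).
have hdom (d : bool) (x : R) : 0 <= x <= 1 ->
    0 <= (if d then 1 - (1 - b) * x else a * x) <= 1.
  by move=> x01; case: d; apply/andP; split; nra.
have hint (d : bool) (x : R) : 0 < x < 1 ->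
    (if d then b < 1 - (1 - b) * x < 1 else 0 < a * x < a).
  by move=> x01; case: d; apply/andP; split; nra.
have hint' (d : bool) (x : R) : 0 < x < 1 ->
    0 < (if d then 1 - (1 - b) * x else a * x) < 1.
  by move=> x01; have := hint d x x01; case: d; lra.
have hout d x : 0 < x < 1 -> outside c rho (h d x).
  move=> x01; rewrite /h; apply: fE; first by have := hint' d x x01; lra.
  by have := hint d x x01; case: d => H; [apply: bpos|apply: apos]; lra.
exists s, t, p, g, h; split=> //;
  first (by move=> f'; rewrite in_setD1 => /andP[_]; exact: ends); last 2 first.
- by move=> v; exact: outp.
- move=> f' x; rewrite in_setD1 => /andP[/eqP fe fG] x01; apply: outg => //; lra.
have onrim (d : bool) : sqdist (if d then g e b else g e a) c = rho ^+ 2 by case: d.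
have nrim (z : point) d : outside c rho z -> z <> (if d then g e b else g e a).
  by move=> + E; rewrite /outside E onrim ltxx.
have gout f' x : f' \in (G :\ e)%SET -> 0 <= x <= 1 -> outside c rho (g f' x).
  by rewrite in_setD1 => /andP[/eqP fe fG] x01; exact: outg.
split.
- move=> [v|d] [w|d'] //=.
  + by move/pinj ->.
  + by move=> E; case: (@nrim (p v) d'); [exact: outp|].
  + by move=> E; case: (@nrim (p w) d); [exact: outp|].
  + have AB : g e a <> g e b by move=> /ginj; rewrite a01 b01 => /(_ isT isT); lra.
    by case: d; case: d' => // E; case: AB.
- move=> [f'|d] /=.
    by rewrite in_setD1 => /andP[_]; exact: arcs.
  move=> _; split.
  + have -> : h d \o @clamp R = (g e \o @clamp R) \o
        (fun x => if d then 1 - (1 - b) * clamp x else a * clamp x).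
      by apply/funext => x /=; rewrite /h [in RHS]clamp_id//; apply: hdom; exact: clamp_itv.
    apply: continuous_for => x; apply: continuous_comp; last exact: gc.
    case: d.
      apply: continuous_add; first exact: cvg_cst.
      apply: continuous_opp; apply: continuous_mul; first exact: cvg_cst.
      exact: continuous_clamp.
    by apply: continuous_mul; [exact: cvg_cst|exact: continuous_clamp].
  + by rewrite /h; case: d; rewrite !mulr0 ?subr0.
  + by rewrite /h; case: d; rewrite !mulr1 // subKr.
  + move=> x y x01 y01 /ginj; rewrite !hdom// => /(_ isT isT).
    have [a0 b1] : 0 < a /\ b < 1 by lra.
    case: d => E; last by apply: (@mulfI _ a) => //; rewrite lt0r_neq0.
    apply: (@mulfI _ (1 - b)); first by rewrite subr_eq0 gt_eqF.
    by move: E; lra.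
- move=> [f'|d] x [v|d'] /=.
  + by rewrite in_setD1 => /andP[_ fG]; exact: avoid.
  + by move=> fG x01; apply: nrim; apply: gout => //; lra.
  + by move=> _ x01; apply: avoid => //; exact: hint'.
  + by move=> _ x01; apply: nrim; exact: hout.
- move=> [f1'|d1] [f2'|d2] x y /=.
  + rewrite !in_setD1 => /andP[_ f1G] /andP[_ f2G] ne; apply: disj => // E.
    by apply: ne; rewrite E.
  + rewrite in_setD1 => /andP[/eqP fe fG] _ _ x01 y01; apply: disj => //; exact: hint'.
  + rewrite in_setD1 => _ /andP[/eqP fe fG] _ x01 y01; apply: disj => //; last exact: hint'.
    by move=> E; apply: fe.
  + move=> _ _ ne x01 y01 E.
    have {E} : (if d1 then 1 - (1 - b) * x else a * x) =
        (if d2 then 1 - (1 - b) * y else a * y).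
      by apply: ginj E; [have := hint' d1 x x01|have := hint' d2 y y01]; lra.
    have := hint d1 x x01; have := hint d2 y y01.
    by case: d1 ne; case: d2 => //= _; lra.
Qed.

End Rims.

Section Rims.
Variables (R : realType) (V : finType).
Local Notation point := (R * R)%type.
Implicit Types (G : edge_set V) (s t : {set V} -> V) (p : V -> point)
  (g : {set V} -> R -> point).

(** Lets an edge be assumed to start at a prescribed end. *)
Lemma drawing_flip G s t p g (F : pred {set V}) : drawing G s t p g ->
  drawing G (fun e => if F e then t e else s e) (fun e => if F e then s e else t e)
    p (fun e => if F e then fun x => g e (1 - x) else g e).
Proof.
move=> [ends [pinj arcs avoid disj]].
have flip (x : R) : 0 < x < 1 -> 0 < 1 - x < 1 by lra.
have flipc (x : R) : 0 <= x <= 1 -> 0 <= 1 - x <= 1 by lra.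
split.
  by move=> e eG; case: (F e); [rewrite finset.setUC|]; exact: ends.
split=> //.
- move=> e eG; have [gc g0 g1 ginj] := arcs e eG; case: (F e) => //; split.
  + have -> : (fun x => g e (1 - x)) \o @clamp R = (g e \o @clamp R) \o
        (fun x => 1 - clamp x).
      apply/funext => x /=; have := clamp_itv x => c01.
      by rewrite [in RHS]clamp_id//; lra.
    apply: continuous_for => x; apply: continuous_comp; last exact: gc.
    apply: continuous_add; first exact: cvg_cst.
    by apply: continuous_opp; exact: continuous_clamp.
  + by rewrite subr0.
  + by rewrite subrr.
  + move=> a b a01 b01 E.
    have {}E : 1 - a = 1 - b by apply: ginj E; exact: flipc.
    by lra.
- move=> e x v eG x01; case: (F e); apply: avoid => //; exact: flip.
- move=> e f x y eG fG ef x01 y01.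
  by case: (F e); case: (F f); apply: disj => //; exact: flip.
Qed.

Lemma cut_edge G u v : (exists s t p g, @drawing R V G s t p g) ->
  [set u; v]%SET \in G ->
  exists c rho A B, [/\ 0 < rho, A <> B, sqdist A c = rho ^+ 2,
    sqdist B c = rho ^+ 2
    & rimmed (@outside R c rho) (fun b : bool => if b then B else A)
        (fun b : bool => if b then v else u) (G :\ [set u; v])%SET].
Proof.
move=> [s [t [p [g dr]]]] uvG; pose e := [set u; v]%SET.
have := cut_edge_oriented (drawing_flip (fun e => s e != u) dr) uvG.
have [ends _] := dr; have := ends _ uvG; rewrite -/e.
move: (s e) (t e) => a b E.
have : u \in [set a; b]%SET by rewrite -E !inE eqxx.
have : v \in [set a; b]%SET by rewrite -E !inE eqxx orbT.
have : a \in e by rewrite E !inE eqxx.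
have : b \in e by rewrite E !inE eqxx orbT.
rewrite !inE; have [->|au] := eqVneq a u => /=.
  by move=> /orP[/eqP ->|/eqP -> //] _; rewrite orbb => /eqP ->.
by move=> _ /eqP <- _ /eqP <-.
Qed.

(** * Opening a drawing next to a vertex *)

Definition lerp (z w : point) (x : R) : point :=
  (z.1 + x * (w.1 - z.1), z.2 + x * (w.2 - z.2)).

Lemma sqdist_lerp z w x : sqdist (lerp z w x) z = x ^+ 2 * sqdist w z.
Proof. by rewrite /sqdist /=; ring. Qed.

Lemma continuous_lerp z w : continuous (lerp z w).
Proof.
apply: continuous_for => x; apply: continuous_pair.
all: apply: continuous_add; first exact: cvg_cst.
all: by apply: continuous_mul; [exact: cvg_id|exact: cvg_cst].
Qed.

(* Inside a small disc round [p x] the arcs at [x] are replaced by radii; the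
   segment towards [w] then only has to avoid finitely many directions. *)
Lemma straighten G s t p g x : drawing G s t p g ->
  exists s' t' g' w, [/\ drawing G s' t' p g', w <> p x,
    forall a v, 0 < a <= 1 -> p v <> lerp (p x) w a
    & forall a e b, 0 < a <= 1 -> e \in G -> 0 <= b <= 1 ->
        g' e b <> lerp (p x) w a].
Proof.
move=> /(drawing_flip (fun e => t e == x)).
set s1 := (fun e : {set V} => _); set t1 := (fun e : {set V} => _).
set g1 := (fun e : {set V} => _) => dr1.
(* After the flip every edge at [x] starts there. *)
have t1x e : e \in G -> t1 e <> x.
  move=> eG; have [_ [pinj arcs _ _]] := dr1; have [_ g0 g1' ginj] := arcs e eG.
  have ne : s1 e <> t1 e.
    move=> E; have : 0 = 1 :> R by apply: ginj; rewrite ?lexx ?ler01// g0 g1' E.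
    by move/eqP; rewrite eq_sym oner_eq0.
  by move: ne; rewrite /s1 /t1; have [->|/eqP] := eqVneq (t e) x => // /nesym.
move: s1 t1 g1 dr1 t1x => {s t g} s t g dr tx.
have [ends dr'] := dr; have [pinj arcs avoid disj] := dr'.
pose z := p x.
have [|||rho [rho0 outp outg]] := @free_disc R V _ _ s t p g z (fun v => v <> x)
  (fun e => e \in G /\ s e <> x) dr'.
- by move=> v vx /pinj.
- by move=> e [].
- move=> e a [eG sx] a01; have [_ g0 g1 _] := arcs e eG.
  have [->|a0] := eqVneq a 0; first by rewrite g0 => /pinj.
  have [->|a1] := eqVneq a 1; first by rewrite g1 => /pinj; exact: tx.
  apply: avoid => //; move: a01; rewrite !le_eqVlt eq_sym (negPf a0) (negPf a1) /=.
  by [].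
have r2 : 0 < rho ^+ 2 by rewrite exprn_gt0.
(* [tau] is the last time the arc is on the circle round [p x]; what comes later stays outside. *)
have ex e : exists tau : R, e \in G -> s e = x ->
    [/\ 0 < tau < 1, sqdist (g e tau) z = rho ^+ 2
      & forall a, tau < a <= 1 -> rho ^+ 2 < sqdist (g e a) z].
  have [eG|] := boolP (e \in G); last by exists 0.
  have [sx|] := pselect (s e = x); last by exists 0.
  have [gc g0 g1 ginj] := arcs e eG.
  pose f (y : R) := sqdist (g e (clamp y)) z - rho ^+ 2.
  have fc : continuous f.
    apply: continuous_for => y; apply: continuous_add; last exact: cvg_cst.
    by apply: continuous_sqdist; [exact: gc|exact: cvg_cst].
  have f0 : f 0 = - rho ^+ 2.
    by rewrite /f clamp_id ?lexx ?ler01// g0 sx /sqdist !subrr expr0n /= addr0 sub0r.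
  have f1 : 0 < f 1.
    by rewrite /f clamp_id ?lexx ?ler01// g1 subr_gt0; apply: outp; exact: tx.
  have f0' : f 0 <= 0 by rewrite f0; lra.
  have [tau [tauI ftau pos]] := last_zero fc ltr01 f0' f1.
  have tau0 : tau != 0 by apply/eqP => E; move: ftau; rewrite E f0; lra.
  have tau01 : 0 < tau < 1.
    by case/andP: tauI => t0 ->; rewrite lt_neqAle eq_sym tau0 t0.
  exists tau => _ _; split=> //.
  - have ct : clamp tau = tau by rewrite clamp_id//; lra.
    by apply/eqP; rewrite -subr_eq0; move: ftau; rewrite /f ct => ->.
  - move=> a aI; have := pos a aI; rewrite /f clamp_id; last by lra.
    by rewrite subr_gt0.
have [tau Htau] := choice ex.
pose g' e (a : R) : point := if (s e == x) && (a < tau e) then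
  lerp z (g e (tau e)) (a / tau e) else g e a.
have inside e a : e \in G -> s e = x -> 0 <= a < tau e ->
    sqdist (g' e a) z < rho ^+ 2.
  move=> eG sx /andP[a0 at_]; have [tau01 st _] := Htau e eG sx.
  rewrite /g' sx eqxx at_ /= sqdist_lerp st.
  have q0 : 0 <= a / tau e by rewrite divr_ge0 //; lra.
  have q1 : a / tau e < 1 by rewrite ltr_pdivrMr; lra.
  by rewrite gtr_pMl // expr_lt1.
have outsd e a : e \in G -> 0 < a <= 1 -> ~~ ((s e == x) && (a < tau e)) ->
    rho ^+ 2 <= sqdist (g e a) z.
  move=> eG a01; have [sx|/eqP sx _] := eqVneq (s e) x => /=.
    have [tau01 st pos] := Htau e eG sx; rewrite -leNgt le_eqVlt => /orP[/eqP <-|ta].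
      by rewrite st.
    by apply/ltW/pos; lra.
  by apply/ltW/outg => //; lra.
have dr2 : drawing G s t p g'.
  split=> //; split=> //.
  - move=> e eG; have [gc g0 g1 ginj] := arcs e eG.
    have [sx|sx] := eqVneq (s e) x; last first.
      have -> : g' e = g e by apply/funext => a; rewrite /g' (negPf sx).
      by [].
    have [tau01 st pos] := Htau e eG sx.
    have taun0 : tau e != 0 by rewrite gt_eqF; lra.
    split.
    (* A single formula for both pieces: at each time one of the two summands rests at the junction
       [g e (tau e)], which is subtracted. *)
    + have -> : g' e \o @clamp R = fun a =>
         ((lerp z (g e (tau e)) (Num.min (clamp a) (tau e) / tau e)).1 +
           (g e (clamp (Num.max (clamp a) (tau e)))).1 - (g e (tau e)).1,
          (lerp z (g e (tau e)) (Num.min (clamp a) (tau e) / tau e)).2 +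
           (g e (clamp (Num.max (clamp a) (tau e)))).2 - (g e (tau e)).2).
        apply/funext => a /=; rewrite /g' sx eqxx /=.
        have := clamp_itv a => c01.
        have [ct|ct] := ltP (clamp a) (tau e).
          by rewrite [clamp (tau e)]clamp_id; [rewrite /lerp /=; congr (_, _); ring|lra].
        rewrite [clamp (clamp a)]clamp_id// divff// /lerp /=.
        by rewrite [LHS]surjective_pairing; congr (_, _); ring.
      apply: continuous_for => a.
      have c1 : {for a, continuous
          (fun a => lerp z (g e (tau e)) (Num.min (clamp a) (tau e) / tau e))}.
        apply: (@continuous_comp _ _ _ (fun a => Num.min (clamp a) (tau e) / tau e));
          last exact: continuous_lerp.
        apply: continuous_mul; last exact: cvg_cst.
        apply: (@continuous_min R R (@clamp R) (cst (tau e))); last exact: cvg_cst.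
        exact: continuous_clamp.
      have c2 : {for a, continuous
          (fun a => g e (clamp (Num.max (clamp a) (tau e))))}.
        apply: (@continuous_comp _ _ _ (fun a => Num.max (clamp a) (tau e)) (g e \o @clamp R));
          last exact: gc.
        apply: (@continuous_max R R (@clamp R) (cst (tau e))); last exact: cvg_cst.
        exact: continuous_clamp.
      apply: continuous_pair.
        apply: continuous_add; last exact: cvg_cst.
        by apply: continuous_add; exact: continuous_fst.
      apply: continuous_add; last exact: cvg_cst.
      by apply: continuous_add; exact: continuous_snd.
    + rewrite /g' sx eqxx /=; have -> : 0 < tau e by lra.
      by rewrite mul0r /lerp !mul0r !addr0 -surjective_pairing.
    + by rewrite /g' sx eqxx /=; have -> : (1 < tau e) = false by lra.
    + move=> a b a01 b01 E.
      have cmp a' b' : 0 <= a' <= 1 -> 0 <= b' <= 1 -> g' e a' = g' e b' ->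
          a' < tau e -> tau e <= b' -> False.
        move=> a'01 b'01 E' at_ tb; have : sqdist (g' e a') z < rho ^+ 2.
          by apply: inside => //; lra.
        rewrite E' /g' sx eqxx /= [b' < _]ltNge tb /= ltNge => /negP; apply.
        by apply: outsd => //; [lra|rewrite sx eqxx /= -leNgt].
      have [at_|ta] := ltP a (tau e); have [bt|tb] := ltP b (tau e).
      * have := congr1 (fun y => sqdist y z) E; rewrite /= /g' sx eqxx at_ bt /=.
        have qa : 0 <= a / tau e by rewrite divr_ge0 //; lra.
        have qb : 0 <= b / tau e by rewrite divr_ge0 //; lra.
        rewrite !sqdist_lerp st => /(mulIf (lt0r_neq0 r2)) /eqP.
        rewrite eqrXn2 // => /eqP; apply: mulIf.
        by rewrite invr_neq0.
      * by case: (cmp a b).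
      * by case: (cmp b a).
      * move: E; rewrite /g' sx eqxx /= [a < _]ltNge [b < _]ltNge ta tb /=; exact: ginj.
  - move=> e a v eG a01; rewrite /g'; case: ifPn => [/andP[/eqP sx at_]|_]; last exact: avoid.
    have [tau01 st pos] := Htau e eG sx.
    have : sqdist (g' e a) z < rho ^+ 2 by apply: inside => //; lra.
    rewrite {1}/g' sx eqxx at_ /= => + E; rewrite E.
    have [vx|/eqP vx] := eqVneq v x; last by rewrite ltNge (ltW (outp v vx)).
    move: E; rewrite vx => /(congr1 (fun y => sqdist y z)); rewrite sqdist_lerp st.
    have -> : sqdist (p x) z = 0 by rewrite /sqdist !subrr expr0n addr0.
    have q0 : 0 < a / tau e by rewrite divr_gt0; lra.
    have : 0 < (a / tau e) ^+ 2 * rho ^+ 2 by rewrite mulr_gt0 ?exprn_gt0.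
    by move=> + E0; rewrite E0 ltxx.
  - have cross e f a b : e \in G -> f \in G -> e <> f -> 0 < a < 1 -> 0 < b < 1 ->
        (s e == x) && (a < tau e) -> ~~ ((s f == x) && (b < tau f)) ->
        g' e a <> g' f b.
      move=> eG fG ef a01 b01 /andP[/eqP sx at_] nf E.
      have : sqdist (g' e a) z < rho ^+ 2 by apply: inside => //; lra.
      by rewrite E /g' (negPf nf) ltNge outsd //; lra.
    move=> e f a b eG fG ef a01 b01.
    have [ein|eout] := boolP ((s e == x) && (a < tau e));
      have [fin|fout] := boolP ((s f == x) && (b < tau f)).
    + rewrite /g' ein fin => E.
      move: ein fin => /andP[/eqP sxe at_] /andP[/eqP sxf bt].
      have [te ste _] := Htau e eG sxe; have [tf stf _] := Htau f fG sxf.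
      (* Equal distances from the centre give equal ratios, hence equal feet on the circle, where
         the original arcs are disjoint. *)
      have q : a / tau e = b / tau f.
        have := congr1 (fun y => sqdist y z) E.
        rewrite !sqdist_lerp ste stf => /(mulIf (lt0r_neq0 r2)) /eqP.
        have qa : 0 <= a / tau e by rewrite divr_ge0 //; lra.
        have qb : 0 <= b / tau f by rewrite divr_ge0 //; lra.
        by rewrite eqrXn2 // => /eqP.
      have q0 : b / tau f != 0.
        by rewrite mulf_neq0 ?invr_neq0 // gt_eqF; lra.
      apply: (disj e f (tau e) (tau f)) => //.
      move: E; rewrite /lerp q => -[/addrI/(mulfI q0)/addIr E1 /addrI/(mulfI q0)/addIr E2].
      by rewrite [LHS]surjective_pairing [RHS]surjective_pairing E1 E2.
    + exact: cross.
    + by apply/nesym; apply: cross => //; apply/nesym.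
    + by rewrite /g' (negPf eout) (negPf fout); exact: disj.
(* A vertical radius gets slope 0 by the convention for division by 0. The new segment goes to the
   right with slope [m], steeper than every radius; [d0] below shows that a radius meeting it is not
   vertical. *)
pose slope e := ((g e (tau e)).2 - z.2) / ((g e (tau e)).1 - z.1).
pose m := 1 + \sum_e `|slope e|.
have mslope e : slope e < m.
  rewrite /m (bigD1 e) //=; have : 0 <= \sum_(i | i != e) `|slope i| by exact: sumr_ge0.
  have := ler_norm (slope e); lra.
(* Chosen so that [w], at squared distance [eta ^+ 2 * (1 + m ^+ 2)] from the centre, is inside the
   disc. *)
pose eta := Num.min 1 (rho ^+ 2 / (2 * (1 + m ^+ 2))).
have m2 : 0 < 1 + m ^+ 2 by have := sqr_ge0 m; lra.
have eta0 : 0 < eta by rewrite lt_min ltr01 divr_gt0 // mulr_gt0.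
have eta1 : eta <= 1 by rewrite ge_min lexx.
have eta2 : eta * (1 + m ^+ 2) < rho ^+ 2.
  apply: (@le_lt_trans _ _ (rho ^+ 2 / (2 * (1 + m ^+ 2)) * (1 + m ^+ 2))).
    by rewrite ler_pM2r // ge_min lexx orbT.
  by rewrite invfM mulrA -mulrA mulVf ?mulr1 ?gt_eqF //; lra.
pose w : point := (z.1 + eta, z.2 + eta * m).
have lw a : lerp z w a = (z.1 + a * eta, z.2 + a * eta * m).
  by rewrite /lerp /w /=; congr (_, _); ring.
have near a : 0 < a <= 1 -> 0 < sqdist (lerp z w a) z < rho ^+ 2.
  move=> /andP[a0 a1]; rewrite lw /sqdist /=.
  have -> : (z.1 + a * eta - z.1) ^+ 2 + (z.2 + a * eta * m - z.2) ^+ 2 =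
    a ^+ 2 * eta * (eta * (1 + m ^+ 2)) by ring.
  have a2 : 0 < a ^+ 2 <= 1 by rewrite exprn_gt0 // expr_le1 // ltW.
  have k : 0 < eta * (1 + m ^+ 2) by rewrite mulr_gt0.
  have j : 0 < a ^+ 2 * eta <= 1.
    by rewrite mulr_gt0 //=; [nra|lra].
  by rewrite mulr_gt0 //=; [nra|lra].
exists s, t, g', w; split=> //.
- move=> E; have := near 1; rewrite ltr01 lexx => /(_ isT)/andP[+ _].
  by rewrite sqdist_lerp E /sqdist !subrr expr0n /= addr0 mulr0 ltxx.
- move=> a v a01 E; have := near a a01; rewrite -E.
  have [->|/eqP vx] := eqVneq v x.
    by rewrite /sqdist !subrr expr0n /= addr0 ltxx.
  by rewrite andbC ltNge (ltW (outp v vx)).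
- move=> a e b a01 eG b01 E; have := near a a01; rewrite -E => /andP[n0 n1].
  have [b0|b0] := eqVneq b 0.
    have [_ [_ arcs' _ _]] := dr2; have [_ g0 _ _] := arcs' e eG.
    move: n0 n1; rewrite b0 g0; have [->|/eqP vx] := eqVneq (s e) x.
      by rewrite /sqdist !subrr expr0n /= addr0 ltxx.
    by move=> _; rewrite ltNge (ltW (outp _ vx)).
  have b01' : 0 < b <= 1.
    by move: b01; rewrite [0 <= b]le_eqVlt eq_sym (negPf b0).
  have [ein|eout] := boolP ((s e == x) && (b < tau e)); last first.
    by move: n1; rewrite /g' (negPf eout) ltNge outsd.
  move: E; rewrite /g' ein lw /lerp => -[/addrI E1 /addrI E2].
  case/andP: ein => /eqP sx bt; have [te ste _] := Htau e eG sx.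
  have q0 : 0 < b / tau e by rewrite divr_gt0; lra.
  have aeta : 0 < a * eta by rewrite mulr_gt0; lra.
  have d0 : (g e (tau e)).1 - z.1 != 0.
    by apply/eqP => D; move: E1; rewrite D mulr0; lra.
  have : slope e = m.
    rewrite /slope; apply: (mulfI (lt0r_neq0 q0)); rewrite mulrA E2.
    by rewrite -E1 mulrAC mulfK // mulrC.
  by have := mslope e; lra.
Qed.

(** The free segment given by [straighten] becomes the loose end: the disc is opened round its far
    end [w], and the segment is cut at its first hit. *)
Lemma vertex_access G x : (exists s t p g, @drawing R V G s t p g) ->
  exists c rho A, [/\ 0 < rho, sqdist A c = rho ^+ 2
    & rimmed (@outside R c rho) (fun _ : unit => A) (fun _ : unit => x) G].
Proof.
move=> [s0 [t0 [p [g0 /(straighten x)[s [t [g [w [dr wx wp wg]]]]]]]]].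
have [ends dr'] := dr; have [pinj arcs avoid disj] := dr'.
have w1 : lerp (p x) w 1 = w.
  by rewrite /lerp !mul1r [RHS]surjective_pairing; congr (_, _); ring.
have I1 : 0 < (1 : R) <= 1 by rewrite ltr01 lexx.
have [|||rho [rho0 outp outg]] := @free_disc R V _ _ s t p g w (fun _ => True)
  (fun e => e \in G) dr'.
- by move=> v _; rewrite -w1; exact: wp.
- by [].
- by move=> e b eG b01; rewrite -w1; exact: wg.
have r2 : 0 < rho ^+ 2 by rewrite exprn_gt0.
pose f (y : R) := sqdist (lerp (p x) w y) w - rho ^+ 2.
have fc : continuous f.
  apply: continuous_for => y; apply: continuous_add; last exact: cvg_cst.
  by apply: continuous_sqdist; [exact: continuous_lerp|exact: cvg_cst].
have f0 : 0 < f 0.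
  by rewrite /f /lerp !mul0r !addr0 -surjective_pairing subr_gt0; exact: outp.
have f1 : f 1 <= 0.
  by rewrite /f w1 /sqdist !subrr expr0n /= addr0 sub0r; lra.
have [a [aI fa apos]] := first_zero fc ltr01 f0 f1.
pose h (_ : unit) (y : R) := lerp (p x) w (a * y).
have hI (y : R) : 0 < y < 1 -> 0 < a * y < a by nra.
have hout d y : 0 < y < 1 -> outside w rho (h d y).
  by move=> /hI y01; have := apos (a * y); rewrite /f subr_gt0; apply; lra.
have Aw : sqdist (lerp (p x) w a) w = rho ^+ 2.
  by apply/eqP; rewrite -subr_eq0; move: fa; rewrite /f => ->.
have nrim z : outside w rho z -> z <> lerp (p x) w a.
  by move=> + E; rewrite /outside E Aw ltxx.
have linj y y' : lerp (p x) w y = lerp (p x) w y' -> y = y'.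
  have := sqdist_gt0 wx => d0 [/addrI E1 /addrI E2].
  have [e1|n1] := eqVneq (w.1 - (p x).1) 0; last exact: (mulIf n1).
  have [e2|n2] := eqVneq (w.2 - (p x).2) 0; last exact: (mulIf n2).
  by move: d0; rewrite /sqdist e1 e2 expr0n /= addr0 ltxx.
exists w, rho, (lerp (p x) w a); split=> //.
exists s, t, p, g, h; split=> //.
- split.
  + move=> [v|[]] [v'|[]] //=.
    * by move/pinj ->.
    * by move=> E; case: (@nrim (p v)) => //; exact: outp.
    * by move=> E; case: (@nrim (p v')) => //; exact: outp.
  + move=> [e|[]] /=; first exact: arcs.
    move=> _; split.
    * apply: continuous_for => y.
      apply: (@continuous_comp _ _ _ (fun y => a * clamp y) (lerp (p x) w));
        last exact: continuous_lerp.
      by apply: continuous_mul; [exact: cvg_cst|exact: continuous_clamp].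
    * by rewrite /h mulr0 /lerp !mul0r !addr0 -surjective_pairing.
    * by rewrite /h mulr1.
    * have an0 : a != 0 by rewrite gt_eqF //; lra.
      by move=> y y' _ _ /linj /(mulfI an0).
  + move=> [e|[]] y [v|[]] /=.
    * exact: avoid.
    * move=> eG y01; have y1 : 0 <= y <= 1 by lra.
      by apply: nrim; exact: outg.
    * move=> _ y01; have y1 : 0 < a * y <= 1 by have := hI _ y01; lra.
      by apply/nesym; exact: (wp _ _ y1).
    * by move=> _ y01; apply: nrim; exact: (hout tt).
  + move=> [e|[]] [f'|[]] y y' //=.
    * by move=> eG fG ef; apply: disj => // E; apply: ef; rewrite E.
    * move=> eG _ _ y01 y01'; have y1 : 0 < a * y' <= 1 by have := hI _ y01'; lra.
      have y2 : 0 <= y <= 1 by lra.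
      exact: (wg _ _ _ y1 eG y2).
    * move=> _ eG _ y01 y01'; have y1 : 0 < a * y <= 1 by have := hI _ y01; lra.
      have y2 : 0 <= y' <= 1 by lra.
      by apply/nesym; exact: (wg _ _ _ y1 eG y2).
- by move=> v; exact: outp.
- by move=> e y eG y01; apply: outg => //; lra.
Qed.

End Rims.

(** * Half-plane drawings and gluing *)

Section Chart.
Variable R : realType.
Local Notation point := (R * R)%type.
Implicit Types (c z w A B Q : point) (rho : R).

(** The antipode of [A] serves unless it is [B]; then [A] is turned by a right angle. *)
Lemma third_point c rho A B : 0 < rho -> sqdist A c = rho ^+ 2 ->
  exists Q, [/\ sqdist Q c = rho ^+ 2, Q <> A & Q <> B].
Proof.
move=> rho0; rewrite /sqdist => Ac.
have r2 : 0 < rho ^+ 2 by rewrite exprn_gt0.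
pose a1 := A.1 - c.1; pose a2 := A.2 - c.2.
have a12 : a1 ^+ 2 + a2 ^+ 2 = rho ^+ 2 by [].
have [EB|NB] := pselect (B = (c.1 - a1, c.2 - a2)).
  exists (c.1 - a2, c.2 + a1); split => /=.
  - by rewrite -a12; ring.
  - move=> E; have := congr1 fst E; have := congr1 snd E => /= E2 E1.
    have h1 : a1 = - a2 by rewrite /a1 -E1; ring.
    have h2 : a2 = a1 by rewrite {1}/a2 -E2; ring.
    have z1 : a1 = 0 by lra.
    by move: a12 r2; rewrite h2 z1 expr0n /= addr0 => <-; rewrite ltxx.
  - rewrite EB => -[h1 h2]; have z1 : a1 = 0 by lra.
    have z2 : a2 = 0 by lra.
    by move: a12 r2; rewrite z1 z2 expr0n /= addr0 => <-; rewrite ltxx.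
exists (c.1 - a1, c.2 - a2); split => /=.
- by rewrite -a12; ring.
- move=> E; have := congr1 fst E; have := congr1 snd E => /= E2 E1.
  have z1 : a1 = 0 by rewrite /a1 in E1 *; lra.
  have z2 : a2 = 0 by rewrite /a2 in E2 *; lra.
  by move: a12 r2; rewrite z1 z2 expr0n /= addr0 => <-; rewrite ltxx.
- by move=> E; apply: NB.
Qed.

(* The inversion at a third point [Q] of the circle turns the outside of the disc
   into a half-plane; an affine map then normalises the images of [A] and [B]. *)
Lemma halfplane_chart c rho A B : 0 < rho -> A <> B ->
  sqdist A c = rho ^+ 2 -> sqdist B c = rho ^+ 2 ->
  exists Phi : point -> point,
    let D z := outside c rho z \/ z = A \/ z = B in
    [/\ forall z, D z -> {for z, continuous Phi},
        forall z w, D z -> D w -> Phi z = Phi w -> z = w,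
        forall z, outside c rho z -> 0 < (Phi z).2,
        Phi A = (0, 0) & Phi B = (1, 0)].
Proof.
move=> rho0 AB Ac Bc; have [Q [Qc QA QB]] := third_point B rho0 Ac.
have r2 : 0 < rho ^+ 2 by rewrite exprn_gt0.
pose N z := sqdist z Q.
pose P1 z := (z.1 - Q.1) / N z; pose P2 z := (z.2 - Q.2) / N z.
pose k1 := c.1 - Q.1; pose k2 := c.2 - Q.2.
have kr : k1 ^+ 2 + k2 ^+ 2 = rho ^+ 2.
  by rewrite -Qc /sqdist /k1 /k2; ring.
pose D z := outside c rho z \/ z = A \/ z = B.
have NQ z : z <> Q -> 0 < N z by exact: sqdist_gt0.
have DQ z : D z -> z <> Q.
  move=> [oz|[->|->]] E; [|exact: QA|exact: QB].
  by move: oz; rewrite /outside E Qc ltxx.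
have sqE z : sqdist z c =
    N z - 2 * ((z.1 - Q.1) * k1 + (z.2 - Q.2) * k2) + rho ^+ 2.
  by rewrite -kr /N /sqdist /k1 /k2; ring.
(* The numerator [sqdist z c - rho ^+ 2] is the power of [z] with respect to the circle. It vanishes
   on the circle and is positive outside, so the inverted circle lies on the line where the product
   with [k] is [1 / 2]. *)
have PE z : z <> Q -> P1 z * k1 + P2 z * k2 =
    (1 - (sqdist z c - rho ^+ 2) / N z) / 2.
  move=> /NQ N0; rewrite sqE /P1 /P2; field.
  by rewrite lt0r_neq0.
pose e1 := P1 B - P1 A; pose e2 := P2 B - P2 A.
have Pinj z w : z <> Q -> w <> Q -> P1 z = P1 w -> P2 z = P2 w -> z = w.
  move=> /NQ z0 /NQ w0 E1 E2.
  have Nz y : 0 < N y -> P1 y ^+ 2 + P2 y ^+ 2 = (N y)^-1.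
    move=> y0; have -> : P1 y ^+ 2 + P2 y ^+ 2 = N y / (N y) ^+ 2.
      by rewrite /P1 /P2 !expr_div_n -mulrDl.
    by rewrite expr2 invfM mulrA divff ?mul1r // lt0r_neq0.
  have EN : N z = N w by apply: invr_inj; rewrite -!Nz// E1 E2.
  have i0 : (N w)^-1 != 0 by rewrite invr_neq0 ?lt0r_neq0.
  move: E1 E2; rewrite /P1 /P2 EN => /(mulIf i0)/addIr E1 /(mulIf i0)/addIr E2.
  by rewrite (surjective_pairing z) (surjective_pairing w) E1 E2.
have ke : e1 * k1 + e2 * k2 = 0.
  have -> : e1 * k1 + e2 * k2 =
     (P1 B * k1 + P2 B * k2) - (P1 A * k1 + P2 A * k2) by rewrite /e1 /e2; ring.
  by rewrite !PE; try exact/nesym; rewrite Ac Bc; ring.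
have ee : 0 < e1 ^+ 2 + e2 ^+ 2.
  rewrite lt_neqAle addr_ge0 ?sqr_ge0 // andbT eq_sym paddr_eq0 ?sqr_ge0 //.
  rewrite !sqrf_eq0 !subr_eq0; apply/negP => /andP[/eqP E1 /eqP E2]; apply: AB.
  by apply: Pinj => //; exact/nesym.
(* First coordinate: position along that line, scaled by the inverted [A] and [B]. Second
   coordinate: the power of [z] divided by [N z]. The directions [e] and [k] are orthogonal by [ke],
   which gives [det]. *)
pose Phi z : point := (((P1 z - P1 A) * e1 + (P2 z - P2 A) * e2) / (e1 ^+ 2 + e2 ^+ 2),
                       1 - 2 * (P1 z * k1 + P2 z * k2)).
have det : (k1 * e2 - k2 * e1) ^+ 2 = (k1 ^+ 2 + k2 ^+ 2) * (e1 ^+ 2 + e2 ^+ 2).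
  have -> : (k1 * e2 - k2 * e1) ^+ 2 =
    (k1 ^+ 2 + k2 ^+ 2) * (e1 ^+ 2 + e2 ^+ 2) - (e1 * k1 + e2 * k2) ^+ 2 by ring.
  by rewrite ke expr0n subr0.
have det0 : k1 * e2 - k2 * e1 != 0.
  by rewrite -sqrf_eq0 det kr mulf_neq0 // lt0r_neq0.
exists Phi; split.
- move=> z /DQ zQ; have N0 := lt0r_neq0 (NQ _ zQ).
  have cN : {for z, continuous N}.
    by apply: continuous_sqdist; [exact: cvg_id|exact: cvg_cst].
  have c1 : {for z, continuous P1}.
    apply: continuous_div => //; apply: continuous_add; last exact: cvg_cst.
    by apply: continuous_fst; exact: cvg_id.
  have c2 : {for z, continuous P2}.
    apply: continuous_div => //; apply: continuous_add; last exact: cvg_cst.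
    by apply: continuous_snd; exact: cvg_id.
  apply: continuous_pair.
    apply: continuous_mul; last exact: cvg_cst.
    by apply: continuous_add; apply: continuous_mul; try exact: cvg_cst;
       apply: continuous_add => //; exact: cvg_cst.
  apply: continuous_add; first exact: cvg_cst.
  apply: continuous_opp; apply: continuous_mul; first exact: cvg_cst.
  by apply: continuous_add; apply: continuous_mul => //; exact: cvg_cst.
- move=> z w /DQ zQ /DQ wQ [/(mulIf (invr_neq0 (lt0r_neq0 ee))) E1 E2].
  pose d1 := P1 z - P1 w; pose d2 := P2 z - P2 w.
  have E1' : d1 * e1 + d2 * e2 = 0 by rewrite /d1 /d2; lra.
  have E2' : d1 * k1 + d2 * k2 = 0 by rewrite /d1 /d2; lra.
  have z1 : d1 * (k1 * e2 - k2 * e1) = 0.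
    have -> : d1 * (k1 * e2 - k2 * e1) =
      (d1 * k1 + d2 * k2) * e2 - (d1 * e1 + d2 * e2) * k2 by ring.
    by rewrite E1' E2' !mul0r subr0.
  have z2 : d2 * (k1 * e2 - k2 * e1) = 0.
    have -> : d2 * (k1 * e2 - k2 * e1) =
      (d1 * e1 + d2 * e2) * k1 - (d1 * k1 + d2 * k2) * e1 by ring.
    by rewrite E1' E2' !mul0r subr0.
  move/eqP: z1; rewrite mulf_eq0 (negPf det0) orbF subr_eq0 => /eqP z1.
  move/eqP: z2; rewrite mulf_eq0 (negPf det0) orbF subr_eq0 => /eqP z2.
  exact: Pinj.
- move=> z oz; have zQ : z <> Q by apply: DQ; left.
  rewrite /= PE //; have : 0 < (sqdist z c - rho ^+ 2) / N z.
    by rewrite divr_gt0 ?NQ // subr_gt0.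
  lra.
- rewrite /Phi PE; last exact/nesym.
  by rewrite Ac !subrr !mul0r addr0 mul0r; congr (_, _); field.
- rewrite /Phi PE; last exact/nesym.
  rewrite Bc subrr mul0r subr0; congr (_, _); last by field.
  by rewrite -!expr2 divff // lt0r_neq0.
Qed.

End Chart.

Section Gluing.
Variables (R : realType) (V : finType).
Local Notation point := (R * R)%type.
Implicit Types (G : edge_set V) (s t : {set V} -> V) (p : V -> point)
  (g : {set V} -> R -> point).

Definition drawable G := exists s t p g, @drawing R V G s t p g.

Definition docked (B : Type) (q : B -> R) (att : B -> V) G : Prop :=
  rimmed (fun z : point => 0 < z.2) (fun b => (q b, 0)) att G.

Lemma edge_docked G u v : drawable G -> [set u; v]%SET \in G ->
  docked (fun b : bool => if b then 1 else 0) (fun b : bool => if b then v else u)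
    (G :\ [set u; v])%SET.
Proof.
move=> dG /(cut_edge dG)[c [rho [A [B [rho0 AB Ac Bc rim]]]]].
have [Phi [Pc Pinj Pout PA PB]] := halfplane_chart rho0 AB Ac Bc.
have -> : docked (fun b : bool => if b then 1 else 0) =
    @rimmed R V _ (fun z : point => 0 < z.2) (Phi \o (fun b : bool => if b then B else A)).
  congr rimmed; apply/funext => -[] /=; by rewrite ?PA ?PB.
apply: (rimmed_comp rim) => //.
- by move=> z oz; apply: Pc; left.
- by case; apply: Pc; right; [right|left].
- have H z : outside c rho z \/ (exists b : bool, z = if b then B else A) ->
      outside c rho z \/ z = A \/ z = B.
    by case=> [|[[] ->]]; [left|right; right|right; left].
  by move=> z w /H Dz /H Dw; exact: Pinj.
Qed.

Lemma vertex_docked G x : drawable G ->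
  docked (fun _ : unit => 0) (fun _ : unit => x) G.
Proof.
move=> /(vertex_access x)[c [rho [A [rho0 Ac rim]]]].
(* The chart normalises two points of the circle, so an auxiliary second one is supplied. *)
have [B [Bc BA _]] := third_point A rho0 Ac.
have [Phi [Pc Pinj Pout PA PB]] := halfplane_chart rho0 (nesym BA) Ac Bc.
have -> : docked (fun _ : unit => 0) =
    @rimmed R V _ (fun z : point => 0 < z.2) (Phi \o (fun _ : unit => A)).
  by congr rimmed; apply/funext => b /=; rewrite PA.
apply: (rimmed_comp rim) => //.
- by move=> z oz; apply: Pc; left.
- by move=> _; apply: Pc; right; left.
- have H z : outside c rho z \/ (exists b : unit, z = A) ->
      outside c rho z \/ z = A \/ z = B.
    by case=> [|[_ ->]]; [left|right; left].
  by move=> z w /H Dz /H Dw; exact: Pinj.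
Qed.

(** A drawing assembled from pieces is indexed by a sum type; this brings it back to edges as
    sets. *)
Lemma drawn_reindex (I J : Type) (U : Type) (dom : I -> Prop) (dom' : J -> Prop)
    (s t : I -> U) (p : U -> point) (g : I -> R -> point) (phi : J -> I) :
  drawn dom s t p g -> (forall j, dom' j -> dom (phi j)) ->
  (forall j k, dom' j -> dom' k -> phi j = phi k -> j = k) ->
  drawn dom' (s \o phi) (t \o phi) p (g \o phi).
Proof.
move=> [pinj ends avoid disj] dd inj; split=> //.
- by move=> j /dd /ends.
- by move=> j a v /dd; exact: avoid.
- move=> j k a b dj dk jk; apply: disj; [exact: dd|exact: dd|].
  by move=> E; apply: jk; exact: inj.
Qed.

End Gluing.

Section Gluing.
Variables (R : realType) (V : finType).
Local Notation point := (R * R)%type.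
Implicit Types (G : edge_set V) (s t : {set V} -> V) (p : V -> point)
  (g : {set V} -> R -> point).

Lemma set2_ends (e : {set V}) a b : e = [set a; b]%SET -> (a \in e) * (b \in e).
Proof. by move=> ->; rewrite !inE !eqxx orbT. Qed.

Definition mirror (z : point) : point := (z.1, - z.2).

Lemma continuous_mirror : continuous mirror.
Proof.
apply: continuous_for => z; apply: continuous_pair.
  by apply: continuous_fst; exact: cvg_id.
by apply: continuous_opp; apply: continuous_snd; exact: cvg_id.
Qed.

Lemma mirror_inj : injective mirror.
Proof. by move=> [x y] [x' y'] [-> /oppr_inj ->]. Qed.

Lemma glue_docked (B : finType) (q : B -> R) (att1 att2 : B -> V) G1 G2 (S : {set V}) :
  docked q att1 G1 -> docked q att2 G2 ->
  (forall e v, e \in G1 -> v \in e -> v \notin S) ->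
  (forall e v, e \in G2 -> v \in e -> v \in S) ->
  (forall b, att1 b \notin S) -> (forall b, att2 b \in S) ->
  injective (fun b => [set att1 b; att2 b]%SET) ->
  drawable R (G1 :|: G2 :|: [set [set att1 b; att2 b] | b : B])%SET.
Proof.
move=> [s1 [t1 [p1 [g1 [h1 [ends1 dr1 Zp1 Zg1 Zh1]]]]]].
move=> [s2 [t2 [p2 [g2 [h2 [ends2 dr2' Zp2' Zg2' Zh2']]]]]] G1S G2S a1S a2S einj.
have mc z : True -> {for z, continuous mirror} by move=> _; exact: continuous_mirror.
have dr2 := @drawn_comp _ _ _ _ _ _ _ _ mirror (fun _ => True) dr2'
  (fun _ => I) (fun _ _ _ _ => I) mc
  (fun z w _ _ => @mirror_inj z w).
pose p v := if v \in S then mirror (p2 v) else p1 v.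
(* In each half of the time one summand rests at [(q b, 0)], which is subtracted; continuity then
   needs no case distinction. *)
pose h b (a : R) : point :=
  ((h1 b (clamp (2 * a))).1 + (mirror (h2 b (clamp (2 - 2 * a)))).1 - q b,
   (h1 b (clamp (2 * a))).2 + (mirror (h2 b (clamp (2 - 2 * a)))).2).
have [pinj1 arcs1 avoid1 disj1] := dr1.
have [pinj2 arcs2 avoid2 disj2] := dr2.
have h11 b : h1 b 1 = (q b, 0) by have [] := arcs1 (inr b) Logic.I.
have h10 b : h1 b 0 = p1 (att1 b) by have [] := arcs1 (inr b) Logic.I.
have h21 b : mirror (h2 b 1) = (q b, 0).
  by have [_ _ E _] := arcs2 (inr b) Logic.I; rewrite [LHS]E /mirror /= oppr0.
have h20 b : mirror (h2 b 0) = mirror (p2 (att2 b)).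
  by have [] := arcs2 (inr b) Logic.I.
have hlow b a : 0 <= a <= 1 / 2 -> h b a = h1 b (2 * a).
  move=> aI; rewrite /h clamp_id; last by lra.
  have -> : clamp (2 - 2 * a) = 1.
    by rewrite /clamp (min_idPl _) ?(max_idPr _) //; lra.
  by rewrite h21 /= addrK addr0 -surjective_pairing.
have hhigh b a : 1 / 2 <= a <= 1 -> h b a = mirror (h2 b (2 - 2 * a)).
  move=> aI; rewrite /h [clamp (2 - 2 * a)]clamp_id; last by lra.
  have -> : clamp (2 * a) = 1.
    by rewrite /clamp (min_idPl _) ?(max_idPr _) //; lra.
  by rewrite h11 /= add0r addrC addKr.
have hhalf b : h b (1 / 2) = (q b, 0).
  by rewrite hlow; [have -> : 2 * (1 / 2) = 1 :> R by lra|lra].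
pose J := ({set V} + {set V} + B)%type.
pose dom : J -> Prop := sumf (sumf (fun e => is_true (e \in G1))
  (fun e => is_true (e \in G2))) (fun _ => True).
pose src : J -> V := sumf (sumf s1 s2) att1.
pose tgt : J -> V := sumf (sumf t1 t2) att2.
pose g : J -> R -> point := sumf (sumf g1 (fun e => mirror \o g2 e)) h.
have Zp v : if v \in S then (p v).2 < 0 else 0 < (p v).2.
  by rewrite /p; case: (v \in S); [rewrite /mirror /= oppr_lt0; exact: Zp2'|exact: Zp1].
have s1S e : e \in G1 -> (s1 e \notin S) * (t1 e \notin S).
  by move=> eG; have st := set2_ends (ends1 e eG); split; apply: (G1S e) => //; rewrite st.
have s2S e : e \in G2 -> (s2 e \in S) * (t2 e \in S).
  by move=> eG; have st := set2_ends (ends2 e eG); split; apply: (G2S e) => //; rewrite st.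
have lowI (a : R) : 0 < a < 1 / 2 -> 0 < 2 * a < 1 by lra.
have highI (a : R) : 1 / 2 < a < 1 -> 0 < 2 - 2 * a < 1 by lra.
have split3 (a : R) : 0 < a < 1 -> [\/ 0 < a < 1 / 2, a = 1 / 2 | 1 / 2 < a < 1].
  move=> /andP[a0 a1]; have [al|ah|->] := ltgtP a (1 / 2).
  - by constructor 1; rewrite a0.
  - by constructor 3; rewrite a1 andbT.
  - by constructor 2.
have Zlow b (a : R) : 0 < a < 1 / 2 -> 0 < (h b a).2.
  move=> aI; rewrite hlow; last by lra.
  by apply: Zh1; exact: lowI.
have Zhigh b (a : R) : 1 / 2 < a < 1 -> (h b a).2 < 0.
  move=> aI; rewrite hhigh; last by lra.
  by rewrite /mirror /= oppr_lt0; apply: Zh2'; exact: highI.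
have Zg1' e a : e \in G1 -> 0 < a < 1 -> 0 < (g1 e a).2 by exact: Zg1.
have Zg2 e a : e \in G2 -> 0 < a < 1 -> (mirror (g2 e a)).2 < 0.
  by move=> eG a01; rewrite /mirror /= oppr_lt0; exact: Zg2'.
have pos_neg (z w : point) : 0 < z.2 -> w.2 < 0 -> z <> w.
  by move=> z0 w0 E; move: z0; rewrite E ltNge (ltW w0).
have nz_axis (z : point) r : z.2 != 0 -> z <> (r, 0).
  by move=> + E; rewrite E eqxx.
have hp b a v : 0 < a < 1 -> h b a <> p v.
  move=> /split3[aI|->|aI].
  - have := Zp v; case: ifP => vS Z; first by apply: pos_neg; [exact: Zlow|].
    rewrite /p vS hlow; last by lra.
    exact: (avoid1 (inr b) _ (inl v) Logic.I (lowI _ aI)).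
  - rewrite hhalf; apply/nesym/nz_axis; have := Zp v.
    by case: ifP => _ Z; [rewrite lt_eqF|rewrite gt_eqF].
  - have := Zp v; case: ifP => vS Z.
      rewrite /p vS hhigh; last by lra.
      exact: (avoid2 (inr b) _ (inl v) Logic.I (highI _ aI)).
    by apply/nesym/pos_neg => //; exact: Zhigh.
have hg1 b e a a' : e \in G1 -> 0 < a < 1 -> 0 < a' < 1 -> g1 e a <> h b a'.
  move=> eG a01 /split3[aI|->|aI].
  - rewrite hlow; last by lra.
    by apply: (disj1 (inl e) (inr b)) => //; exact: lowI.
  - by rewrite hhalf; apply/nz_axis; rewrite gt_eqF // Zg1'.
  - by apply: pos_neg; [exact: Zg1'|exact: Zhigh].
have hg2 b e a a' : e \in G2 -> 0 < a < 1 -> 0 < a' < 1 -> mirror (g2 e a) <> h b a'.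
  move=> eG a01 /split3[aI|->|aI].
  - by apply/nesym/pos_neg; [exact: Zlow|exact: Zg2].
  - by rewrite hhalf; apply/nz_axis; rewrite lt_eqF // Zg2.
  - rewrite hhigh; last by lra.
    by apply: (disj2 (inl e) (inr b)) => //; exact: highI.
have dr : drawn dom src tgt p g.
  split.
  - move=> v w; have := Zp v; have := Zp w; rewrite /p.
    case: (v \in S); case: (w \in S) => Zw Zv E.
    + by have := @pinj2 (inl v) (inl w) E; case.
    + by case: (pos_neg _ _ Zw Zv).
    + by case: (pos_neg _ _ Zv Zw).
    + by have := @pinj1 (inl v) (inl w) E; case.
  - move=> [[e|e]|b] /= d.
    + have [gc g0 g1' ginj] := arcs1 (inl e) d; split=> //.
        by rewrite [LHS]g0 /p /= (negPf (s1S e d).1).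
      by rewrite [LHS]g1' /p /= (negPf (s1S e d).2).
    + have [gc g0 g1' ginj] := arcs2 (inl e) d; split=> //.
        by rewrite [LHS]g0 /p /= (s2S e d).1.
      by rewrite [LHS]g1' /p /= (s2S e d).2.
    + have [gc1 _ _ ginj1] := arcs1 (inr b) d.
      have [gc2 _ _ ginj2] := arcs2 (inr b) d.
      split.
      * apply: continuous_for => a.
        have c1 : {for a, continuous (fun a => h1 b (clamp (2 * clamp a)))}.
          apply: (@continuous_comp _ _ _ (fun a => 2 * clamp a) (h1 b \o @clamp R));
            last exact: gc1.
          by apply: continuous_mul; [exact: cvg_cst|exact: continuous_clamp].
        have c2 : {for a, continuous (fun a => mirror (h2 b (clamp (2 - 2 * clamp a))))}.
          apply: (@continuous_comp _ _ _ (fun a => 2 - 2 * clamp a)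
            ((mirror \o h2 b) \o @clamp R)); last exact: gc2.
          apply: continuous_add; first exact: cvg_cst.
          apply: continuous_opp.
          by apply: continuous_mul; [exact: cvg_cst|exact: continuous_clamp].
        apply: continuous_pair.
          apply: continuous_add; last exact: cvg_cst.
          by apply: continuous_add; [exact: (continuous_fst c1)|exact: (continuous_fst c2)].
        by apply: continuous_add; [exact: (continuous_snd c1)|exact: (continuous_snd c2)].
      * by rewrite hlow ?mulr0 ?h10 /p ?(negPf (a1S b)) //; lra.
      * rewrite hhigh; last by lra.
        have -> : 2 - 2 * 1 = 0 :> R by lra.
        by rewrite h20 /p a2S.
      * have low_high a a' : 0 <= a <= 1 -> 0 <= a' <= 1 -> a < 1 / 2 -> 1 / 2 <= a' ->
            h b a <> h b a'.
          move=> a01 a'01 al ah.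
          have [->|a0] := eqVneq a 0.
            have -> : h b 0 = p (att1 b).
              by rewrite hlow ?mulr0 ?h10 /p ?(negPf (a1S b)) //; lra.
            have [->|a1] := eqVneq a' 1.
              have -> : h b 1 = p (att2 b).
                rewrite hhigh; last by lra.
                have -> : 2 - 2 * 1 = 0 :> R by lra.
                by rewrite h20 /p a2S.
              have := Zp (att1 b); have := Zp (att2 b).
              by rewrite a2S (negPf (a1S b)) => H2 H1; exact: pos_neg.
            apply/nesym/hp; case/andP: a'01 => _; rewrite le_eqVlt (negPf a1) /= => ->.
            by lra.
          have {a0} a0 : 0 < a by move: a01; rewrite le_eqVlt eq_sym (negPf a0) => /andP[].
          have {a01} aI : 0 < a < 1 / 2 by rewrite a0.
          move: ah; rewrite le_eqVlt => /orP[/eqP <-|ah].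
            by rewrite hhalf; apply/nz_axis; rewrite gt_eqF // Zlow.
          have [->|a1] := eqVneq a' 1.
            have -> : h b 1 = p (att2 b).
              rewrite hhigh; last by lra.
              have -> : 2 - 2 * 1 = 0 :> R by lra.
              by rewrite h20 /p a2S.
            by apply: hp; lra.
          apply: pos_neg; first exact: Zlow.
          apply: Zhigh; rewrite ah; case/andP: a'01 => _.
          by rewrite le_eqVlt (negPf a1).
        move=> a a' a01 a'01 E.
        have [al|ah] := ltP a (1 / 2); have [al'|ah'] := ltP a' (1 / 2).
        -- move: E; rewrite !hlow; try lra; move=> E.
           have {E} : 2 * a = 2 * a' by apply: ginj1 E; lra.
           by lra.
        -- by case: (low_high a a').
        -- by case: (low_high a' a).
        -- move: E; rewrite !hhigh; try lra; move=> E.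
           have {E} : 2 - 2 * a = 2 - 2 * a' by apply: ginj2 E; lra.
           by lra.
  - move=> [[e|e]|b] a v /= d a01; last exact: hp.
      have := Zp v; rewrite /p; case: (v \in S) => Z; last exact: (avoid1 (inl e) a (inl v)).
      by apply: pos_neg => //; exact: Zg1'.
    have := Zp v; rewrite /p; case: (v \in S) => Z; first exact: (avoid2 (inl e) a (inl v)).
    by apply/nesym/pos_neg => //; exact: Zg2.
  - move=> [[e|e]|b] [[e'|e']|b'] a a' /= d d' ne a01 a'01.
    + by apply: (disj1 (inl e) (inl e')) => // -[E]; apply: ne; rewrite E.
    + by apply: pos_neg; [exact: Zg1'|exact: Zg2].
    + exact: hg1.
    + by apply/nesym/pos_neg; [exact: Zg1'|exact: Zg2].
    + by apply: (disj2 (inl e) (inl e')) => // -[E]; apply: ne; rewrite E.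
    + exact: hg2.
    + by apply/nesym; exact: hg1.
    + by apply/nesym; exact: hg2.
    + have bb : b <> b' by move=> E; apply: ne; rewrite E.
      have qq : q b <> q b'.
        by move=> E; have := @pinj1 (inr b) (inr b'); rewrite /= E => /(_ erefl)[].
      have bb' : inr b <> inr b' :> {set V} + B by case.
      move: (split3 _ a01) (split3 _ a'01) => [aI|->|aI] [aI'|->|aI'].
      * rewrite (hlow b) ?(hlow b'); [|lra|lra].
        by apply: (disj1 (inr b) (inr b')) => //; exact: lowI.
      * by rewrite hhalf; apply: nz_axis; rewrite gt_eqF // Zlow.
      * by apply: pos_neg; [exact: Zlow|exact: Zhigh].
      * by rewrite hhalf; apply/nesym/nz_axis; rewrite gt_eqF // Zlow.
      * by rewrite !hhalf => -[].
      * by rewrite hhalf; apply/nesym/nz_axis; rewrite lt_eqF // Zhigh.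
      * by apply/nesym/pos_neg; [exact: Zlow|exact: Zhigh].
      * by rewrite hhalf; apply: nz_axis; rewrite lt_eqF // Zhigh.
      * rewrite (hhigh b) ?(hhigh b'); [|lra|lra].
        by apply: (disj2 (inr b) (inr b')) => //; exact: highI.
pose E b := [set att1 b; att2 b]%SET.
pose phi e : J := match [pick b | e == E b] with
  | Some b => inr b | None => if e \in G1 then inl (inl e) else inl (inr e) end.
have EG1 b : E b \notin G1.
  by apply/negP => EG; have := G1S _ (att2 b) EG; rewrite a2S !inE eqxx orbT => /(_ isT).
have EG2 b : E b \notin G2.
  by apply/negP => EG; have := G2S _ (att1 b) EG; rewrite (negPf (a1S b)) !inE eqxx => /(_ isT).
have phiP e : e \in (G1 :|: G2 :|: [set E b | b : B])%SET ->
   [/\ dom (phi e), e = [set src (phi e); tgt (phi e)]%SET &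
       match phi e with inl (inl f) => e = f | inl (inr f) => e = f | inr b => e = E b end].
  rewrite /phi; case: pickP => [b /eqP ->|nE]; first by [].
  rewrite !inE => /orP[/orP[eG|eG]|/imsetP[b _ Eb]]; last by move: (nE b); rewrite Eb eqxx.
    by rewrite eG; split=> //=; exact: ends1.
  case: ifP => eG1; split=> //=; [exact: ends1|exact: ends2].
exists (src \o phi), (tgt \o phi), p, (g \o phi); split.
  by move=> e /phiP[].
apply: (drawn_reindex dr).
- by move=> e /phiP[].
- move=> e f /phiP[_ _ He] /phiP[_ _ Hf] Ef; move: He Hf; rewrite Ef.
  by case: (phi f) => [[f'|f']|b] -> ->.
Qed.

(** The isolated vertex [x] can leave its old place and move to the midpoint of the arc of [e],
    whose halves become the new edges. *)
Lemma subdivide_oriented G s t p g e x : drawing G s t p g -> e \in G ->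
  (forall f, f \in G -> x \notin f) ->
  drawable R ((G :\ e) :|: [set [set s e; x]; [set t e; x]])%SET.
Proof.
move=> [ends dr] eG xG; have [pinj arcs avoid disj] := dr.
have [gc g0 g1 ginj] := arcs e eG.
have sx f : f \in G -> (s f != x) * (t f != x).
  move=> fG; have st := set2_ends (ends f fG).
  by split; apply/eqP => E; have := xG f fG; rewrite -E st.
have st : s e != t e.
  apply/eqP => E; have : 0 = 1 :> R by apply: ginj; rewrite ?lexx ?ler01// g0 g1 E.
  by move/eqP; rewrite eq_sym oner_eq0.
pose p' v := if v == x then g e (1 / 2) else p v.
pose k (d : bool) (a : R) := if d then 1 - a / 2 else a / 2.
have kI d a : 0 <= a <= 1 -> 0 <= k d a <= 1 by rewrite /k; case: d; lra.
have kO d a : 0 < a < 1 -> 0 < k d a < 1 by rewrite /k; case: d; lra.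
pose J := ({set V} + bool)%type.
pose src : J -> V := sumf s (fun d => if d then t e else s e).
pose tgt : J -> V := sumf t (fun _ => x).
pose gg : J -> R -> point := sumf g (fun d a => g e (k d a)).
pose dom : J -> Prop := sumf (fun f => is_true (f \in (G :\ e)%SET)) (fun _ => True).
have halfI : 0 < (1 / 2 : R) < 1 by lra.
have dr' : drawn dom src tgt p' gg.
  split.
  - move=> v w; rewrite /p'; case: eqVneq => [->|vx]; case: eqVneq => [->|wx] //.
    + by move=> E; case: (avoid e (1 / 2) w).
    + by move=> E; case: (avoid e (1 / 2) v).
    + exact: pinj.
  - move=> [f|d] /=.
      rewrite in_setD1 => /andP[_ fG]; have [fc f0 f1 finj] := arcs f fG.
      by rewrite /p' !(negPf (sx f fG).1) !(negPf (sx f fG).2).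
    move=> _; split.
    + have -> : (fun a => g e (k d a)) \o @clamp R =
          (g e \o @clamp R) \o (fun a => k d (clamp a)).
        by apply/funext => a /=; rewrite [in RHS]clamp_id//; apply: kI; exact: clamp_itv.
      apply: continuous_for => a; apply: continuous_comp; last exact: gc.
      rewrite /k; case: d.
        apply: continuous_add; first exact: cvg_cst.
        apply: continuous_opp.
        by apply: continuous_mul; [exact: continuous_clamp|exact: cvg_cst].
      by apply: continuous_mul; [exact: continuous_clamp|exact: cvg_cst].
    + rewrite /k /p'; case: d; rewrite mul0r ?subr0 ?g0 ?g1.
        by rewrite (negPf (sx e eG).2).
      by rewrite (negPf (sx e eG).1).
    + by rewrite /k /p' eqxx; case: d => //; congr (g e _); lra.
    + move=> a b a01 b01 E; have {E} : k d a = k d b by apply: ginj E; exact: kI.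
      by rewrite /k; case: d; lra.
  - move=> [f|d] a v /=; rewrite /p'.
      rewrite in_setD1 => /andP[/eqP fe fG] a01; case: eqVneq => _; last exact: avoid.
      by apply: disj.
    move=> _ a01; case: eqVneq => _; last by apply: avoid => //; exact: kO.
    move=> E; have {E} : k d a = 1 / 2.
      by apply: ginj E; [have := kO d a a01|]; lra.
    by rewrite /k; case: d; lra.
  - move=> [f|d] [f'|d'] a b /=; rewrite ?in_setD1.
    + move=> /andP[_ fG] /andP[_ f'G] ne; apply: disj => // E; apply: ne; by rewrite E.
    + by move=> /andP[/eqP fe fG] _ _ a01 b01; apply: disj => //; exact: kO.
    + by move=> _ /andP[/eqP fe fG] _ a01 b01; apply/nesym/disj => //; exact: kO.
    + move=> _ _ ne a01 b01 E.
      have {E} : k d a = k d' b.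
        by apply: ginj E; [have := kO d a a01|have := kO d' b b01]; lra.
      by rewrite /k; case: d ne; case: d' => //= _; lra.
pose phi f : J := if f == [set s e; x]%SET then inr false
  else if f == [set t e; x]%SET then inr true else inl f.
exists (src \o phi), (tgt \o phi), p', (gg \o phi); split.
  move=> f; rewrite /= /phi finset.in_setU finset.in_set2.
  have [->//|n1] := eqVneq f [set s e; x]%SET.
  have [->//|n2] := eqVneq f [set t e; x]%SET.
  by rewrite !orbF in_setD1 => /andP[_ fG]; exact: (ends f fG).
apply: (drawn_reindex dr').
- move=> f; rewrite /= /phi finset.in_setU finset.in_set2.
  have [->//|n1] := eqVneq f [set s e; x]%SET.
  have [->//|n2] := eqVneq f [set t e; x]%SET.
  by rewrite !orbF.
- move=> f f' _ _; rewrite /phi.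
  have [->|n1] := eqVneq f [set s e; x]%SET; have [->|n1'] := eqVneq f' [set s e; x]%SET => //.
  + by case: ifP.
  + by case: ifP.
  + have [->|n2] := eqVneq f [set t e; x]%SET; have [->|n2'] := eqVneq f' [set t e; x]%SET => //.
    by case.
Qed.

Lemma subdivide G u v x : drawable R G -> [set u; v]%SET \in G ->
  (forall f, f \in G -> x \notin f) ->
  drawable R ((G :\ [set u; v]) :|: [set [set u; x]; [set v; x]])%SET.
Proof.
move=> [s [t [p [g dr]]]] eG xG; have := subdivide_oriented dr eG xG.
have [ends _] := dr; have := ends _ eG; pose e := [set u; v]%SET; rewrite -/e.
move: (s e) (t e) => a b E.
have : u \in [set a; b]%SET by rewrite -E !inE eqxx.
have : v \in [set a; b]%SET by rewrite -E !inE eqxx orbT.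
have : a \in e by rewrite E !inE eqxx.
have : b \in e by rewrite E !inE eqxx orbT.
rewrite !inE; have [->|au] := eqVneq a u => /=.
  by move=> /orP[/eqP ->|/eqP -> //] _; rewrite orbb => /eqP ->.
move=> _ /eqP <- _ /eqP <-.
by rewrite [[set [set a; x]; [set u; x]]%SET]finset.setUC.
Qed.

End Gluing.

(** * Planarity of the surgeries *)

Section Planarity.
Variables (R : realType) (V : finType).
Implicit Types (G H : edge_set V) (u v x y : V) (S : {set V}).

Lemma planar_sub G H : H \subset G -> is_planar R G -> is_planar R H.
Proof.
move=> /fintype.subsetP sub [p [g [pinj arcs avoid disj]]]; exists p, g; split=> //.
- by move=> e /sub; exact: arcs.
- by move=> e /sub; exact: avoid.
- by move=> e f /sub eG /sub fG; exact: disj.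
Qed.

Lemma planar_drawable G (v0 : V) : simple_graph G -> is_planar R G -> drawable R G.
Proof. by move=> Gs; exact: drawing_of_planar. Qed.

Lemma drawable_planar G : drawable R G -> is_planar R G.
Proof. by move=> [s [t [p [g]]]]; exact: planar_of_drawing. Qed.

Lemma drawable_sub G H : H \subset G -> drawable R G -> drawable R H.
Proof. by move=> sub [s [t [p [g dr]]]]; exists s, t, p, g; exact: drawing_sub dr. Qed.

Definition inside G S : edge_set V := [set e in G | e \subset S]%SET.

Lemma inside_sub G S : inside G S \subset G.
Proof. by apply/fintype.subsetP => e; rewrite inE => /andP[]. Qed.

Lemma inside_vertex G S e v : e \in inside G S -> v \in e -> v \in S.
Proof. by rewrite inE => /andP[_ /fintype.subsetP]; apply. Qed.

Lemma insideUC G x e : simple_graph G ->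
  (e \in inside G (~: component G x)%SET) || (e \in inside G (component G x)) = (e \in G).
Proof.
move=> /forall_inP Gs; rewrite !inE -andb_orr; case eG: (e \in G) => //=.
have /cards2P[a [b [_ E]]] : #|e| == 2%N by exact: Gs.
have cl c d : adjacent_in G c d -> c \in component G x -> d \in component G x.
  by move=> cd cC; exact: component_stable cC cd.
have ab : adjacent_in G a b by rewrite /adjacent_in -E.
have [aC|aC] := boolP (a \in component G x).
  apply/orP; right; rewrite E; apply/fintype.subsetP => z; rewrite finset.in_set2.
  by move=> /orP[]/eqP -> //; exact: cl ab aC.
apply/orP; left; rewrite E; apply/fintype.subsetP => z; rewrite finset.in_set2 finset.in_setC.
move=> /orP[]/eqP -> //; apply: contra aC; apply: cl; by rewrite adj_sym.
Qed.

Lemma planar_bridge G u x : simple_graph G -> is_planar R G ->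
  ~~ connect (adjacent_in G) u x -> is_planar R ([set u; x] |: G)%SET.
Proof.
move=> Gs Gp nux; have dG := planar_drawable u Gs Gp; pose S := component G x.
have d1 := drawable_sub (inside_sub G (~: S)%SET) dG.
have d2 := drawable_sub (inside_sub G S) dG.
have uS : u \notin S by rewrite inE connect_adj_sym.
have := @glue_docked R V unit _ _ _ _ _ S (vertex_docked u d1) (vertex_docked x d2).
move=> gl; apply: drawable_planar.
have -> : ([set u; x] |: G = inside G (~: S) :|: inside G S :|:
    [set [set u; x] | _ : unit])%SET.
  apply/setP => e; rewrite finset.in_setU1 !finset.in_setU insideUC // orbC; congr (_ || _).
  by apply/eqP/imsetP => [->|[_ _ ->] //]; exists tt.
apply: gl => //.
- by move=> e v eI vE; have := inside_vertex eI vE; rewrite finset.in_setC.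
- by move=> e v; exact: inside_vertex.
- by move=> _; exact: mem_component.
- by case; case.
Qed.

(** Each component is opened along its own edge. The chart puts [u] and [x] at 0, [v] and [y] at 1,
    so the gluing joins the right ends. *)
Lemma planar_switch G u v x y : simple_graph G -> is_planar R G -> nonbridge G u v ->
  ~~ connect (adjacent_in G) u x -> adjacent_in G x y ->
  is_planar R (swap G [set [set u; v]; [set x; y]] [set [set u; x]; [set v; y]])%SET.
Proof.
move=> Gs Gp uvN nux xyG; have dG := planar_drawable u Gs Gp; pose S := component G x.
have [uv uS vS xS yS] := switch_side Gs uvN nux xyG.
have /andP[uvG _] := uvN.
have d1 := drawable_sub (inside_sub G (~: S)%SET) dG.
have d2 := drawable_sub (inside_sub G S) dG.
have uv1 : [set u; v]%SET \in inside G (~: S)%SET.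
  rewrite inE uvG /=; apply/fintype.subsetP => z; rewrite finset.in_set2 finset.in_setC.
  by move=> /orP[]/eqP ->.
have xy2 : [set x; y]%SET \in inside G S.
  rewrite inE [_ \in G]xyG /=; apply/fintype.subsetP => z; rewrite finset.in_set2.
  by move=> /orP[]/eqP ->.
have := @glue_docked R V bool _ _ _ _ _ S (edge_docked d1 uv1) (edge_docked d2 xy2).
move=> gl; apply: drawable_planar.
have -> : (swap G [set [set u; v]; [set x; y]] [set [set u; x]; [set v; y]] =
   (inside G (~: S) :\ [set u; v]) :|: (inside G S :\ [set x; y]) :|:
    [set [set (if b then v else u); (if b then y else x)] | b : bool])%SET.
  apply/setP => e; rewrite !finset.in_setU; congr (_ || _); last first.
    rewrite !finset.in_set1; apply/orP/imsetP => [[/eqP ->|/eqP ->]|[[] _ ->]].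
    - by exists false.
    - by exists true.
    - by right.
    - by left.
  rewrite finset.in_setD finset.in_set2 !finset.in_setD1 -(insideUC x e Gs) -/S.
  have n1 : [set x; y]%SET \notin inside G (~: S)%SET.
    apply/negP => eI; have := inside_vertex eI (set21 x y).
    by rewrite finset.in_setC xS.
  have n2 : [set u; v]%SET \notin inside G S.
    by apply/negP => eI; have := inside_vertex eI (set21 u v); rewrite (negPf uS).
  have [->|e1] := eqVneq e [set u; v]%SET; first by rewrite /= (negPf n2) andbF.
  have [->|e2] := eqVneq e [set x; y]%SET; first by rewrite /= (negPf n1).
  by [].
apply: gl => //.
- move=> e w; rewrite finset.in_setD1 => /andP[_ eI] wE.
  by have := inside_vertex eI wE; rewrite finset.in_setC.
- by move=> e w; rewrite finset.in_setD1 => /andP[_ eI]; exact: (inside_vertex eI).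
- by case.
- by case.
- have xy : x != y by exact: (switch_neq Gs xyG).
  move=> [] [] // /eqP; rewrite set2_eq => /orP[]/andP[/eqP E1 /eqP E2].
  + by rewrite E1 eqxx in uv.
  + by rewrite E1 xS in vS.
  + by rewrite E1 eqxx in uv.
  + by rewrite E1 yS in uS.
Qed.

(** An isolated [x] subdivides [uv]. If [x] has a neighbour [y], the edge [xy] is deleted first and
    restored afterwards as a bridge. *)
Lemma planar_insert G u v x : simple_graph G -> is_planar R G -> adjacent_in G u v ->
  ~~ connect (adjacent_in G) u x -> (graph_degree G x <= 1)%N ->
  is_planar R (swap G [set [set u; v]] [set [set u; x]; [set v; x]])%SET.
Proof.
move=> Gs Gp uvG nux dx; have dG := planar_drawable u Gs Gp.
have nvx : ~~ connect (adjacent_in G) v x.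
  by apply: contra nux; apply: connect_trans (connect1 uvG).
have no_edge (H : edge_set V) : simple_graph H -> (forall y, ~~ adjacent_in H x y) ->
    forall f, f \in H -> x \notin f.
  move=> /forall_inP Hs iso f fH; apply/negP => xf.
  have /cards2P[a [b [_ E]]] : #|f| == 2%N by exact: Hs.
  move: xf fH; rewrite E finset.in_set2 => /orP[]/eqP <-; first exact/negP/iso.
  by rewrite set2C; exact/negP/iso.
have [[y xy]|iso] := pselect (exists y, adjacent_in G x y); last first.
  apply: drawable_planar; apply: subdivide dG uvG _; apply: no_edge => // y.
  by apply/negP => xy; apply: iso; exists y.
have uniq z : adjacent_in G x z -> z = y.
  move=> xz; apply/eqP; move: dx; rewrite graph_degree_nbrs // leqNgt; apply: contraNT => zy.
  rewrite (cardsD1 y) inE xy (cardsD1 z) !inE zy xz.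
  by rewrite addnA.
pose H := (G :\ [set x; y])%SET.
have HG : H \subset G by exact: subsetDl.
have Hs : simple_graph H.
  apply/forall_inP => e eH; move/forall_inP: Gs; apply; exact: (fintype.subsetP HG).
have xyu : [set u; v]%SET != [set x; y]%SET.
  rewrite set2_eq negb_or !negb_and (disconnected_neq nux) /=.
  by rewrite (disconnected_neq nvx) orbT.
have uvH : [set u; v]%SET \in H by rewrite finset.in_setD1 xyu.
have isoH z : ~~ adjacent_in H x z.
  rewrite /adjacent_in finset.in_setD1 negb_and negbK.
  by have [/uniq ->|] := boolP ([set x; z]%SET \in G); rewrite ?eqxx ?orbT.
have := subdivide (drawable_sub HG dG) uvH (no_edge _ Hs isoH).
set K := (_ :|: _)%SET => dK.
have Ks : simple_graph K.
  by apply: swap_simple => //; apply: simple_edge2;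
    [exact: disconnected_neq nux|exact: disconnected_neq nvx].
(* The former component without [x] is closed in [K]: only [xy] led from it to [x], and [u], [v] are
   elsewhere. *)
have nK : ~~ connect (adjacent_in K) y x.
  pose T := (component G x :\ x)%SET.
  have yx : y != x.
    by apply/eqP => E; have := adj_irr x Gs; rewrite -{2}E xy.
  have yT : y \in T.
    by rewrite finset.in_setD1 yx inE; apply: connect1.
  apply/negP => yxK; have xT : x \notin T by rewrite finset.in_setD1 eqxx.
  have [c [d [cT dT]]] := connect_cross yxK yT xT.
  move: cT; rewrite finset.in_setD1 => /andP[cx cC].
  have far w : ~~ connect (adjacent_in G) w x -> c != w.
    by move=> nw; apply: contraNneq nw => <-; rewrite connect_adj_sym; move: cC; rewrite inE.
  have cu := far u nux; have cv := far v nvx.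
  rewrite /adjacent_in finset.in_setU finset.in_set2 !set2_eq (negPf cx) (negPf cu) (negPf cv) /= !orbF.
  rewrite !finset.in_setD1 => /and3P[_ cdxy cd].
  have dC := component_stable cC cd.
  have dx' : d = x by apply/eqP; move: dT; rewrite finset.in_setD1 dC andbT negbK.
  move: cd cdxy; rewrite dx' => cd; have -> : c = y by apply: uniq; rewrite adj_sym.
  by rewrite set2C eqxx.
have := planar_bridge Ks (drawable_planar dK) nK.
have -> // : ([set y; x] |: K = swap G [set [set u; v]] [set [set u; x]; [set v; x]])%SET.
apply/setP => e; rewrite /swap /K !(finset.in_setU, finset.in_setU1, finset.in_setD,
  finset.in_setD1, finset.in_set1) (set2C y) orbA; congr (_ || _).
have [->|ne] := eqVneq e [set x; y]%SET; last by [].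
by rewrite eq_sym xyu [_ \in G]xy.
Qed.

End Planarity.

Theorem theorem1 (R : realType) :
  exists c : R, 0 < c /\
    forall r d D : nat, (3 <= D)%N -> planar_graphs R r d D <> finset.set0 ->
      c < unif_pr R (planar_graphs R r d D) (@connected_graph 'I_r).
Proof.
have [C HC] := connected_share.
(* [C.+1] also covers [r = 0], where every graph is connected and [C] might be 0; the other
   increment makes the inequality strict. *)
exists (C.+2%:R^-1); split; first by rewrite invr_gt0 ltr0n.
move=> r d D D3 /eqP; rewrite -finset.card_gt0 => A0.
set A := planar_graphs R r d D in A0 *.
have le : (#|A| <= C.+1 * #|[set G in A | connected_graph G]%SET|)%N.
  case: (posnP r) => [r0|r0].
    have -> : [set G in A | connected_graph G]%SET = A.
      apply/setP => G; rewrite inE; case: (G \in A) => //=.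
      by apply/forallP => -[i ir]; exfalso; have := leq_ltn_trans (leq0n i) ir; rewrite r0.
    by rewrite leq_pmull.
  have := HC 'I_r (fun G => `[< is_planar R G >]) d D D3.
  rewrite card_ord => /(_ r0) H; rewrite mulSn; apply: leq_trans (leq_addl _ _).
  apply: H.
  - by move=> G H HG /asboolP Gp; apply/asboolP; exact: planar_sub Gp.
  - by move=> G u x Gs /asboolP Gp nux; apply/asboolP; exact: planar_bridge.
  - by move=> G u v x y Gs /asboolP Gp uv nux xy; apply/asboolP; exact: planar_switch.
  - by move=> G u v x Gs /asboolP Gp uv nux dx; apply/asboolP; exact: planar_insert.
rewrite /unif_pr ltr_pdivlMr ?ltr0n // mulrC ltr_pdivrMr ?ltr0n //.
rewrite -natrM ltr_nat mulnC.
have c0 : (0 < #|[set G in A | connected_graph G]%SET|)%N.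
  by move: (leq_trans A0 le); rewrite muln_gt0 => /andP[].
by apply: leq_ltn_trans le _; rewrite ltn_pmul2r.
Qed.
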